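(* Fix $m>0$ and $N>0$. For each $c>0$ with $0<N^{2/3}<cN_*^{2/3}$ let $\rho_c$ be a symmetric decreasing minimizer of $E_c(N)$. Then, as $c\to\infty$, up to a subsequence of $\{\rho_c\}$ (that is, along a subsequence of any sequence of values $c\to\infty$), $$\rho_c\to\rho_\infty\quad\text{strongly in }L^1\cap L^{5/3}(\mathbb{R}^3),$$ where $\rho_\infty$ is a minimizer of $E_\infty(N)$.
   Context: Fix constants $\kappa>0$ and $q\ge 1$. For a density $\rho\ge 0$ on $\mathbb{R}^3$ put $$j_{mc}(\rho(x))=\frac{q}{8\pi^3}\int_{|p|<(6\pi^2\rho(x)/q)^{1/3}}\left(\sqrt{c^2|p|^2+m^2c^4}-mc^2\right)dp,\qquad D(\rho,\rho)=\frac12\int_{\mathbb{R}^3}\int_{\mathbb{R}^3}\frac{\rho(x)\rho(y)}{|x-y|}\,dxdy,$$ $$j_\infty(\rho(x))=\frac{q}{8\pi^3}\int_{|p|<(6\pi^2\rho(x)/q)^{1/3}}\frac{|p|^2}{2m}\,dp=\frac{3}{10m}\Big(\frac{6\pi^2}{q}\Big)^{2/3}\rho(x)^{5/3},$$ where $p\in\mathbb{R}^3$. Define $\mathcal{E}_c(\rho)=\int_{\mathbb{R}^3}j_{mc}(\rho(x))\,dx-\kappa D(\rho,\rho)$ and $\mathcal{E}_\infty(\rho)=\int_{\mathbb{R}^3}j_\infty(\rho(x))\,dx-\kappa D(\rho,\rho)$, and $$E_c(N)=\inf\Big\{\mathcal{E}_c(\rho):0\le\rho\in L^1\cap L^{4/3}(\mathbb{R}^3),\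 \int_{\mathbb{R}^3}\rho\,dx=N\Big\},$$ $$E_\infty(N)=\inf\Big\{\mathcal{E}_\infty(\rho):0\le\rho\in L^1\cap L^{5/3}(\mathbb{R}^3),\ \int_{\mathbb{R}^3}\rho\,dx=N\Big\}.$$ A minimizer of $E_c(N)$ (resp. $E_\infty(N)$) is an admissible $\rho$ attaining the infimum. ''Symmetric decreasing'' means radial about the origin and nonincreasing in $|x|$. The constant $N_*>0$ is the optimal (largest) constant such that $$\kappa N_*^{2/3}D(\rho,\rho)\le K_{cl}\|\rho\|_{L^{4/3}}^{4/3}\|\rho\|_{L^1}^{2/3}\quad\text{for all }0\le\rho\in L^1\cap L^{4/3}(\mathbb{R}^3),\qquad K_{cl}=\frac34\Big(\frac{6\pi^2}{q}\Big)^{1/3}.$$ *)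

(* Defs.v *)
From HB Require Import structures.
From mathcomp Require Import all_boot all_order all_algebra.
From mathcomp Require Import all_classical all_reals all_analysis.
Import Order.TTheory GRing.Theory Num.Theory.
Import numFieldNormedType.Exports.

Set Implicit Arguments.
Unset Strict Implicit.
Unset Printing Implicit Defensive.

Local Open Scope classical_set_scope.
Local Open Scope ring_scope.

(* The instance of [SigmaFiniteMeasure] that the library attaches to [\x] only
   applies to probability measures; [leb2] and [leb3] need the general one. *)
Lemma product_sigma_finite d1 d2 (T1 : measurableType d1)
    (T2 : measurableType d2) (R : realType)
    (m1 : {sigma_finite_measure set T1 -> \bar R})
    (m2 : {sigma_finite_measure set T2 -> \bar R}) :
  sigma_finite setT (m1 \x m2)%E.
Proof.
have /sigma_finiteP[F [TF ndF Foo]] := sigma_finiteT m1.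
have /sigma_finiteP[G [TG ndG Goo]] := sigma_finiteT m2.
exists (fun n => F n `*` G n).
  rewrite -setXTT TF TG; apply/seteqP; split=> [[x y] [/= [n _ Fnx] [k _ Gky]]|].
    exists (maxn n k) => //; split.
    - by move: x Fnx; exact/subsetPset/ndF/leq_maxl.
    - by move: y Gky; exact/subsetPset/ndG/leq_maxr.
  by move=> [x y] [n _ []/= ? ?]; split; exists n.
move=> k; have [mF Fk] := Foo k; have [mG Gk] := Goo k.
split; first exact: measurableX.
by rewrite product_measure1E// lte_mul_pinfty// ge0_fin_numE.
Qed.

Notation R3 R := (measurableTypeR R * measurableTypeR R * measurableTypeR R)%type.

Definition leb2 {R : realType} :
    set (measurableTypeR R * measurableTypeR R) -> \bar R :=
  (@lebesgue_measure R \x @lebesgue_measure R)%E.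
HB.instance Definition _ (R : realType) := Measure.on (@leb2 R).
HB.instance Definition _ (R : realType) :=
  Measure_isSigmaFinite.Build _ _ _ (@leb2 R)
    (product_sigma_finite (@lebesgue_measure R) (@lebesgue_measure R)).

Definition leb3 {R : realType} : set (R3 R) -> \bar R :=
  (@leb2 R \x @lebesgue_measure R)%E.
HB.instance Definition _ (R : realType) := Measure.on (@leb3 R).
HB.instance Definition _ (R : realType) :=
  Measure_isSigmaFinite.Build _ _ _ (@leb3 R)
    (product_sigma_finite (@leb2 R) (@lebesgue_measure R)).

(* The library's norm on a product type is the sup norm. *)
Definition norm3 (R : realType) (x : R3 R) : R :=
  Num.sqrt (x.1.1 ^+ 2 + x.1.2 ^+ 2 + x.2 ^+ 2).

Section energies.
Context {R : realType}.
Implicit Types (rho : R3 R -> R) (j : R -> \bar R).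

Definition fermi_ball (q s : R) : set (R3 R) :=
  [set p | norm3 p < (6 * pi ^+ 2 * s / q) `^ (1 / 3)].

Definition fermi_integral (q : R) (e : R3 R -> R) (s : R) : \bar R :=
  ((q / (8 * pi ^+ 3))%:E * \int[leb3]_(p in fermi_ball q s) (e p)%:E)%E.

Definition j_mc (q m c : R) : R -> \bar R :=
  fermi_integral q (fun p =>
    Num.sqrt (c ^+ 2 * norm3 p ^+ 2 + m ^+ 2 * c ^+ 4) - m * c ^+ 2).

Definition j_infty (q m : R) : R -> \bar R :=
  fermi_integral q (fun p => norm3 p ^+ 2 / (2 * m)).

(* On the null diagonal x = y the integrand is 0 since 0^-1 = 0. *)
Definition coulomb rho : \bar R :=
  ((1 / 2)%:E *
   \int[leb3]_x \int[leb3]_y (rho x * rho y / norm3 (x - y))%:E)%E.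

Definition energy (kappa : R) j rho : \bar R :=
  (\int[leb3]_x j (rho x) - kappa%:E * coulomb rho)%E.

Definition energy_c (kappa q m c : R) := energy kappa (j_mc q m c).

Definition energy_infty (kappa q m : R) := energy kappa (j_infty q m).

(* Elements of L^p are represented by pointwise nonnegative functions. *)
Definition nonneg_L1Lp (p : R) : set (R3 R -> R) :=
  [set rho | [/\ forall x, 0 <= rho x, rho \in Lfun leb3 1%:E
               & rho \in Lfun leb3 p%:E]].

Definition admissible (p N : R) : set (R3 R -> R) :=
  [set rho | nonneg_L1Lp p rho /\ (\int[leb3]_x (rho x)%:E = N%:E)%E].

Definition E_c (kappa q m c N : R) : \bar R :=
  ereal_inf [set energy_c kappa q m c rho | rho in admissible (4 / 3) N].

Definition E_infty (kappa q m N : R) : \bar R :=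
  ereal_inf [set energy_infty kappa q m rho | rho in admissible (5 / 3) N].

Definition minimizer_c (kappa q m c N : R) rho : Prop :=
  admissible (4 / 3) N rho /\ energy_c kappa q m c rho = E_c kappa q m c N.

Definition minimizer_infty (kappa q m N : R) rho : Prop :=
  admissible (5 / 3) N rho /\
  energy_infty kappa q m rho = E_infty kappa q m N.

(* The origin is exempted from monotonicity: otherwise a real-valued symmetric
   decreasing function would have to be bounded, by its value at 0. *)
Definition symmetric_decreasing rho : Prop :=
  (forall x y, norm3 x = norm3 y -> rho x = rho y) /\
  (forall x y, 0 < norm3 x -> norm3 x <= norm3 y -> rho y <= rho x).

Definition K_cl (q : R) : R := 3 / 4 * (6 * pi ^+ 2 / q) `^ (1 / 3).

Definition coulomb_inequality (kappa q M : R) : Prop :=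
  forall rho, nonneg_L1Lp (4 / 3) rho ->
  ((kappa * M `^ (2 / 3))%:E * coulomb rho <=
   (K_cl q)%:E * 'N[leb3]_((4 / 3)%:E)[EFin \o rho] `^ (4 / 3)
     * 'N[leb3]_1[EFin \o rho] `^ (2 / 3))%E.

Definition is_Nstar (kappa q Nstar : R) : Prop :=
  [/\ 0 < Nstar, coulomb_inequality kappa q Nstar
    & forall M, 0 < M -> coulomb_inequality kappa q M -> M <= Nstar].

Definition cvg_Lp (p : R) (u : nat -> R3 R -> R) (f : R3 R -> R) : Prop :=
  [/\ forall k, u k \in Lfun leb3 p%:E, f \in Lfun leb3 p%:E
    & ('N[leb3]_(p%:E)[EFin \o (u k \- f)%R])%E @[k --> \oo] --> 0%E].

End energies.

(* Main.v *)
Require Import Defs.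
From mathcomp Require Import all_boot all_order all_algebra.
From mathcomp Require Import all_classical all_reals all_analysis.
From mathcomp Require Import measurable_realfun ring lra.
Import Order.TTheory GRing.Theory Num.Theory.
Import numFieldNormedType.Exports.

(** The proof is a compactness argument in which every bound comes from a
comparison of energies.

A priori bounds.  The inequality that defines N_* is, up to constants, a
Hardy-Littlewood-Sobolev bound for the Coulomb energy ([hls]).  The kinetic
energy density j_mc(s) is at least a constant times min(s^(5/3), c s^(4/3))
([j_lower]), so for large c the kinetic energy absorbs the Coulomb energy, and
the kinetic energies of the minimizers are bounded ([energy_bounds]).  This
controls s^(5/3) only where s <= c^3.  For large c a minimizer has no mass
above that threshold ([density_threshold]): removing the part u of the density
above c^3 saves at least c times a multiple of the integral of u^(4/3), which
outweighs all the Coulomb energy that u carries, and the removed mass can be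
put back far from the origin at a strict gain
([lower_energy_by_adding_mass]).  Hence the minimizers are bounded in L^(5/3).

Compactness.  Being symmetric decreasing, the minimizers satisfy
rho^p |x|^3 <= const, for p = 1 and p = 5/3.  Helly selection gives a
subsequence that converges almost everywhere to some v ([helly_radial]).  The
two decay estimates give the upper semicontinuity of the Coulomb energy along
it ([coulomb_form_limsup]): the p = 5/3 estimate provides an integrable
majorant on bounded boxes, the p = 1 estimate a small potential outside.

Identification of the limit.  Fatou's lemma, together with
liminf j_mc(s_c) >= j_infty(s) when s_c -> s ([j_mc_liminf]), gives
energy_infty(v) <= liminf energy_c(rho_c), while j_mc <= j_infty gives
energy_c(rho_c) <= energy_infty(sigma) for every competitor sigma.  So v has at
most the energy of any competitor.  If v had lost mass, adding the missing mass far away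
would produce a competitor with strictly smaller energy; so v has mass N and is
a minimizer ([minimizer_infty_of_lower_energy]).

Strong convergence.  The energies converge, and the Coulomb energies are upper
semicontinuous, so the limsup of the kinetic energies of rho_c is at most the
kinetic energy of v ([kinetic_limit]).  Almost everywhere convergence without
loss in the integral gives strong convergence by Scheffe's argument
([fatou_scheffe], [strong_convergence]), applied to the mass for L^1 and to the
kinetic energy, which controls rho^(5/3), for L^(5/3). *)

Set Implicit Arguments.
Unset Strict Implicit.
Unset Printing Implicit Defensive.
Local Open Scope classical_set_scope.
Local Open Scope ring_scope.

(** * Lower limits, Fatou and Scheffe *)

Lemma norm3_ge0 (R : realType) (x : R3 R) : 0 <= norm3 x.
Proof. exact: sqrtr_ge0. Qed.

Ltac pos := repeat match goal with
  | |- is_true (0 < _) => first [done | apply: mulr_gt0 | rewrite invr_gt0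
      | apply: exprn_gt0 | apply: powR_gt0 | apply: pi_gt0 | apply: addr_gt0]
  | |- is_true (0 <= _) => first [done | by apply: ltW | apply: mulr_ge0
      | rewrite invr_ge0 | apply: exprn_ge0 | apply: powR_ge0 | apply: pi_ge0
      | apply: norm3_ge0 | apply: addr_ge0 | apply: ltW]
  end.

Section limits.
Context {R : realType}.
Implicit Types (u : nat -> \bar R) (y : \bar R).

Lemma limn_einf_ge u y :
  (\forall n \near \oo, (y <= u n)%E) -> (y <= limn_einf u)%E.
Proof.
move=> [n _ yu]; rewrite limn_einf_lim.
have := @ereal_nondecreasing_cvgn R (einfs u) (nondecreasing_einfs u).
move=> /cvg_lim -> //; apply: (@le_trans _ _ (einfs u n)).
  by apply: le_ereal_inf_tmp => _ /= [k nk <-]; exact: yu.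
by apply: ereal_sup_ubound; exists n.
Qed.

Lemma lt_limn_einf u y :
  (y < limn_einf u)%E -> \forall n \near \oo, (y < u n)%E.
Proof.
rewrite limn_einf_lim.
have := @ereal_nondecreasing_cvgn R (einfs u) (nondecreasing_einfs u).
move=> /cvg_lim -> //; move=> /ereal_sup_gt[_ [n _ <-]] yn.
exists n => // k /= nk; apply: (lt_le_trans yn).
by apply: ereal_inf_lbound; exists k.
Qed.

End limits.

Section integration.
Context {d} {T : measurableType d} {R : realType}.
Variable mu : {measure set T -> \bar R}.

Lemma fatou_le (f : T -> \bar R) (g : nat -> T -> \bar R) :
  measurable_fun setT f -> (forall n, measurable_fun setT (g n)) ->
  (forall x, 0 <= f x)%E -> (forall n x, 0 <= g n x)%E ->
  {ae mu, forall x, (f x <= limn_einf (g ^~ x))%E} ->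
  (\int[mu]_x f x <= limn_einf (fun n => \int[mu]_x g n x))%E.
Proof.
move=> mf mg f0 g0 fg.
apply: le_trans (fatou mu measurableT mg (fun n x _ => g0 n x)).
apply: ae_ge0_le_integral => //.
- by move=> x _; apply: limn_einf_ge; apply: nearW.
- apply: measurableT_comp => //.
  by apply: measurable_fun_limn_esup => n; exact: measurableT_comp.
- by apply: filterS fg => x.
Qed.

(** Fatou's lemma applied to the nonnegative functions [k n + k0 - h n], whose
lower limit is at least [2 k0], yields
[limsup (int h n) <= limsup (int k n) - int k0 <= 0].  Only the integrals of
[k n] have to converge, and from above, so that the lemma turns a convergence of
energies into a strong convergence. *)
Lemma fatou_scheffe (h : nat -> T -> R) (k : nat -> T -> \bar R)
    (k0 : T -> \bar R) :
  (forall n, measurable_fun setT (h n)) -> (forall n x, 0 <= h n x) ->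
  (forall n, measurable_fun setT (k n)) -> (forall n x, 0 <= k n x)%E ->
  measurable_fun setT k0 -> (forall x, 0 <= k0 x)%E ->
  (forall n x, (h n x)%:E <= k n x + k0 x)%E ->
  {ae mu, forall x, h n x @[n --> \oo] --> 0} ->
  {ae mu, forall x, (k0 x <= limn_einf (k ^~ x))%E} ->
  (\int[mu]_x k0 x < +oo)%E ->
  (forall e : R, 0 < e -> \forall n \near \oo,
     (\int[mu]_x k n x <= \int[mu]_x k0 x + e%:E)%E) ->
  (\int[mu]_x (h n x)%:E)%E @[n --> \oo] --> 0%E.
Proof.
move=> mh h0 mk kge0 mk0 k00 hk cvh kinf ik0 supk.
pose g n x := (k n x + k0 x - (h n x)%:E)%E.
have g0 n x : (0 <= g n x)%E by rewrite /g sube_ge0.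
have mg n : measurable_fun setT (g n).
  apply: emeasurable_funB; first exact: emeasurable_funD.
  exact/measurable_EFinP.
have kk0 : (forall x, 0 <= k0 x + k0 x)%E by move=> x; rewrite adde_ge0.
have mkk0 : measurable_fun setT (fun x => k0 x + k0 x)%E by exact: emeasurable_funD.
have Fat := fatou_le mkk0 mg kk0 g0.
have {}Fat : (\int[mu]_x (k0 x + k0 x) <= limn_einf (fun n => \int[mu]_x g n x))%E.
  apply: Fat; apply: filterS2 cvh kinf => x hx kx.
  have := kx; have := k00 x; have := hk ^~ x.
  rewrite /g; case: (k0 x) => [r| |] // {kx}; last first.
    move=> _ _ _; apply: limn_einf_ge; apply: nearW => n.
    by have := kge0 n x; case: (k n x).
  move=> hr r0 rk; apply/lee_subgt0Pr => e e0; apply: limn_einf_ge.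
  have rk' : ((r - e / 2)%:E < limn_einf (k^~ x))%E.
    by apply: lt_le_trans rk; rewrite lte_fin; lra.
  have e20 : 0 < e / 2 by lra.
  have /cvgrPdist_lt /(_ _ e20) hx' := hx.
  near=> n.
  have : ((r - e / 2)%:E < k n x)%E by near: n; exact: lt_limn_einf.
  have : `|0 - h n x| < e / 2 by near: n.
  rewrite sub0r normrN ger0_norm//.
  case: (k n x) => [s| |] //=; rewrite -?EFinD -?EFinN -?EFinD ?lte_fin ?lee_fin; first by lra.
  by rewrite addye// leey.
have fk0 : (\int[mu]_x k0 x)%E \is a fin_num.
  by rewrite ge0_fin_numE// integral_ge0.
have gh n : (\int[mu]_x g n x + \int[mu]_x (h n x)%:E = \int[mu]_x k n x + \int[mu]_x k0 x)%E.
  rewrite -!ge0_integralD//; last 2 first.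
    by move=> x _; rewrite lee_fin.
    exact/measurable_EFinP.
  by apply: eq_integral => x _; rewrite /g subeK.
have h00 n : (0 <= \int[mu]_x (h n x)%:E)%E by apply: integral_ge0 => x _; rewrite lee_fin.
have g00 n : (0 <= \int[mu]_x g n x)%E by apply: integral_ge0.
move: Fat; rewrite ge0_integralD// -(fineK fk0) => Fat.
set K := fine _ in Fat supk gh.
have main e : 0 < e -> \forall n \near \oo, (\int[mu]_x (h n x)%:E <= e%:E)%E.
  move=> e0; have e20 : 0 < e / 2 by lra.
  have Fat' : ((K + K - e / 2)%:E < limn_einf (fun n => \int[mu]_x g n x))%E.
    by apply: lt_le_trans Fat; rewrite -EFinD lte_fin; lra.
  near=> n.
  have : ((K + K - e / 2)%:E < \int[mu]_x g n x)%E by near: n; exact: lt_limn_einf.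
  have : (\int[mu]_x k n x <= K%:E + (e / 2)%:E)%E.
    by near: n; have := supk _ e20; rewrite -(fineK fk0).
  move: (gh n) (h00 n) (g00 n); rewrite -(fineK fk0) -/K.
  case: (\int[mu]_x g n x)%E => [a| |]; case: (\int[mu]_x (h n x)%:E)%E => [b| |];
    case: (\int[mu]_x k n x)%E => [c| |] //=.
  rewrite -!EFinD !lee_fin !lte_fin => -[]; lra.
apply/fine_cvgP; split.
  near=> n; have : (\int[mu]_x (h n x)%:E <= 1%:E)%E by near: n; exact: main.
  by have := h00 n; case: (\int[mu]_x (h n x)%:E)%E.
apply/cvgrPdist_le => e e0; near=> n.
have : (\int[mu]_x (h n x)%:E <= e%:E)%E by near: n; exact: main.
rewrite /= sub0r normrN; have := h00 n.
case: (\int[mu]_x (h n x)%:E)%E => [b| |]//=; rewrite !lee_fin => b0.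
by rewrite ger0_norm.
Unshelve. all: by end_near. Qed.

End integration.

Section ae_product.
Context {d1 d2} {T1 : measurableType d1} {T2 : measurableType d2} {R : realType}.
Variables (m1 : {sigma_finite_measure set T1 -> \bar R})
  (m2 : {sigma_finite_measure set T2 -> \bar R}).

Lemma ae_fst (P : T1 -> Prop) :
  {ae m1, forall x, P x} -> {ae (m1 \x m2)%E, forall z, P z.1}.
Proof.
move=> [N [mN N0 sN]]; exists (N `*` setT); split.
- exact: measurableX.
- transitivity (m1 N * m2 setT)%E; first exact: product_measure1E.
  by rewrite N0 mul0e.
- by move=> z /= Pz; split => //; exact: sN.
Qed.

Lemma ae_snd (P : T2 -> Prop) :
  {ae m2, forall x, P x} -> {ae (m1 \x m2)%E, forall z, P z.2}.
Proof.
move=> [N [mN N0 sN]]; exists (setT `*` N); split.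
- exact: measurableX.
- by rewrite product_measure1E// N0 mule0.
- by move=> z /= Pz; split => //; exact: sN.
Qed.

End ae_product.

(** * Cubes and the kernel |x|^(-5/2) in space *)

Lemma le_powR {R : realType} (p a b : R) :
  0 <= p -> 0 <= a -> a <= b -> a `^ p <= b `^ p.
Proof.
move=> p0 a0 ab; apply: ge0_ler_powR => //; rewrite nnegrE//.
exact: le_trans ab.
Qed.

Lemma integral_scale_indic d (T : measurableType d) (R : realType)
    (mu : {measure set T -> \bar R}) (A : set T) (a : R) :
  measurable A -> 0 <= a ->
  (\int[mu]_x (a * \1_A x)%:E = a%:E * mu A)%E.
Proof.
move=> mA a0; under eq_integral do rewrite EFinM.
rewrite ge0_integralZl_EFin//; first by rewrite integral_indic// setIT.
by apply/measurable_EFinP; exact: measurable_indic.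
Qed.

Section space.
Context {R : realType}.
Implicit Types (x y z c : R3 R) (r s : R).

(** Cubes serve as test sets instead of balls because their volume is a product
of lengths of intervals. *)
Definition cube c r : set (R3 R) :=
  [set x | [/\ `|x.1.1 - c.1.1| <= r, `|x.1.2 - c.1.2| <= r & `|x.2 - c.2| <= r]].

Lemma measurable_coord1 : measurable_fun setT (fun x : R3 R => x.1.1 : R).
Proof. exact: (measurableT_comp measurable_fst measurable_fst). Qed.

Lemma measurable_coord2 : measurable_fun setT (fun x : R3 R => x.1.2 : R).
Proof. exact: (measurableT_comp measurable_snd measurable_fst). Qed.

Lemma measurable_coord3 : measurable_fun setT (fun x : R3 R => x.2 : R).
Proof. exact: measurable_snd. Qed.

Lemma measurable_norm3 : measurable_fun setT (@norm3 R).
Proof.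
rewrite /norm3; apply: measurableT_comp.
  exact: (continuous_measurable_fun (@sqrt_continuous R)).
apply: measurable_funD; first apply: measurable_funD.
- apply: measurable_funX; exact: measurable_coord1.
- apply: measurable_funX; exact: measurable_coord2.
- apply: measurable_funX; exact: measurable_coord3.
Qed.

Lemma le_norm3 x r : 0 <= r ->
  (norm3 x <= r) = (x.1.1 ^+ 2 + x.1.2 ^+ 2 + x.2 ^+ 2 <= r ^+ 2).
Proof.
move=> r0; rewrite /norm3 -{1}(ger0_norm r0) -sqrtr_sqr ler_sqrt//.
exact: sqr_ge0.
Qed.

Lemma norm3_sqr x : norm3 x ^+ 2 = x.1.1 ^+ 2 + x.1.2 ^+ 2 + x.2 ^+ 2.
Proof. by rewrite sqr_sqrtr// !addr_ge0// sqr_ge0. Qed.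

Lemma norm3N x : norm3 (- x) = norm3 x.
Proof. by rewrite /norm3 /= !sqrrN. Qed.

Lemma norm3_coord x : [/\ `|x.1.1| <= norm3 x, `|x.1.2| <= norm3 x & `|x.2| <= norm3 x].
Proof.
have sq a : a ^+ 2 <= norm3 x ^+ 2 -> `|a| <= norm3 x.
  by rewrite -ler_sqrt ?sqr_ge0// !sqrtr_sqr (ger0_norm (norm3_ge0 x)).
by split; apply: sq; rewrite norm3_sqr; have := sqr_ge0 x.1.1;
  have := sqr_ge0 x.1.2; have := sqr_ge0 x.2; lra.
Qed.

Lemma norm3_le_coord x r :
  `|x.1.1| <= r -> `|x.1.2| <= r -> `|x.2| <= r -> norm3 x <= 2 * r.
Proof.
move=> h1 h2 h3; have r0 : 0 <= r by apply: le_trans h1.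
have sq (a : R) : `|a| <= r -> a ^+ 2 <= r ^+ 2.
  by move=> ar; rewrite -real_normK ?num_real// ler_sqr ?nnegrE.
rewrite le_norm3; last by rewrite mulr_ge0.
rewrite exprMn.
have := sq _ h1; have := sq _ h2; have := sq _ h3; have := sqr_ge0 r; lra.
Qed.

Lemma norm3_eq0 x : norm3 x = 0 -> x = 0.
Proof.
have [] := norm3_coord x => + + + x0; rewrite x0 !normr_le0.
by case: x {x0} => -[a b] c /= /eqP -> /eqP -> /eqP ->.
Qed.

Lemma notin_cube c r x : ~ cube c r x -> r <= norm3 (c - x).
Proof.
move=> ncx; rewrite leNgt; apply/negP => /ltW xr; apply: ncx.
have [h1 h2 h3] := norm3_coord (c - x).
by split; rewrite distrC; [apply: le_trans h1 _|apply: le_trans h2 _|apply: le_trans h3 _].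
Qed.

Lemma cubeE c r : cube c r =
  `[c.1.1 - r, c.1.1 + r]%classic `*` `[c.1.2 - r, c.1.2 + r]%classic `*`
  `[c.2 - r, c.2 + r]%classic.
Proof.
apply/seteqP; split => -[[x1 x2] x3] /=; rewrite /cube/= !in_itv/= !ler_distl.
  by move=> [-> -> ->].
by move=> [[-> ->] ->].
Qed.

Lemma measurable_cube c r : measurable (cube c r).
Proof.
rewrite cubeE; apply: measurableX; last exact: measurable_itv.
by apply: measurableX; exact: measurable_itv.
Qed.

Lemma leb3_cube c r : 0 <= r -> leb3 (cube c r) = ((2 * r) ^+ 3)%:E.
Proof.
move=> r0; rewrite cubeE.
have itv (a : R) : @lebesgue_measure R `[a - r, a + r]%classic = (2 * r)%:E.
  rewrite lebesgue_measure_itv /= lte_fin.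
  case: ifPn => [|/negbTE ar]; first by rewrite -EFinD => _; congr EFin; ring.
  by congr EFin; lra.
have m1 (a : R) : measurable (`[a - r, a + r]%classic : set (measurableTypeR R)).
  exact: measurable_itv.
have -> : @leb3 R (`[c.1.1 - r, c.1.1 + r]%classic `*` `[c.1.2 - r, c.1.2 + r]%classic `*`
  `[c.2 - r, c.2 + r]%classic) = 
  (@leb2 R ((`[(c.1.1 - r)%R, (c.1.1 + r)%R] : set R) `*` (`[(c.1.2 - r)%R, (c.1.2 + r)%R] : set R)) *
   @lebesgue_measure R `[(c.2 - r)%R, (c.2 + r)%R]%classic)%E.
  by apply: product_measure1E => //; exact: measurableX.
have -> : @leb2 R ((`[(c.1.1 - r)%R, (c.1.1 + r)%R] : set R) `*` (`[(c.1.2 - r)%R, (c.1.2 + r)%R] : set R)) = 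
  (@lebesgue_measure R (`[(c.1.1 - r)%R, (c.1.1 + r)%R]%classic) *
   @lebesgue_measure R (`[(c.1.2 - r)%R, (c.1.2 + r)%R]%classic))%E.
  by apply: product_measure1E.
by rewrite !itv -!EFinM; congr EFin; ring.
Qed.

Lemma integral_cube c r (a : R) : 0 <= r -> 0 <= a ->
  (\int[leb3]_x (a * \1_(cube c r) x)%:E = (a * (2 * r) ^+ 3)%:E)%E.
Proof.
move=> r0 a0; rewrite EFinM -(leb3_cube c r0); apply: integral_scale_indic => //.
exact: measurable_cube.
Qed.

Lemma cube_shrink x y (T : R) : (forall k, cube x (T / 4 ^+ k) y) -> x = y.
Proof.
move=> xy.
have small (a : R) : (forall k, `|a| <= T / 4 ^+ k) -> a = 0.
  move=> ha; apply/eqP; rewrite -normr_le0 leNgt; apply/negP => a0.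
  pose k := (Num.truncn (T / `|a|)).+1.
  have Tk : T / `|a| < 4 ^+ k.
    apply: lt_trans (truncnS_gt _) _; rewrite -natrX ltr_nat; exact: ltn_expl.
  have := ha k; rewrite ler_pdivlMr; last by rewrite exprn_gt0.
  by move: Tk; rewrite ltr_pdivrMr// mulrC; lra.
apply/esym; case: x y xy => -[x1 x2] x3 [[y1 y2] y3] xy.
by congr (_, _, _); apply/eqP; rewrite -subr_eq0; apply/eqP; apply: small => k;
  have [] := xy k.
Qed.

Lemma measurable_norm3B :
  measurable_fun setT (fun z : R3 R * R3 R => norm3 (z.1 - z.2)).
Proof.
rewrite /norm3; apply: measurableT_comp.
  exact: (continuous_measurable_fun (@sqrt_continuous R)).
apply: measurable_funD; first apply: measurable_funD.
- apply: measurable_funX; apply: measurable_funB.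
    exact: (measurableT_comp measurable_coord1 measurable_fst).
  exact: (measurableT_comp measurable_coord1 measurable_snd).
- apply: measurable_funX; apply: measurable_funB.
    exact: (measurableT_comp measurable_coord2 measurable_fst).
  exact: (measurableT_comp measurable_coord2 measurable_snd).
- apply: measurable_funX; apply: measurable_funB.
    exact: (measurableT_comp measurable_coord3 measurable_fst).
  exact: (measurableT_comp measurable_coord3 measurable_snd).
Qed.

Lemma measurable_norm3V :
  measurable_fun setT (fun z : R3 R * R3 R => (norm3 (z.1 - z.2))^-1).
Proof.
have -> : (fun z : R3 R * R3 R => (norm3 (z.1 - z.2))^-1) =
    (@powR R)^~ (-1) \o (fun z : R3 R * R3 R => norm3 (z.1 - z.2)).
  by apply/funext => z /=; rewrite powR_inv1 ?norm3_ge0.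
by apply: measurableT_comp; [exact: measurable_powR|exact: measurable_norm3B].
Qed.

Lemma measurable_norm3V1 x : measurable_fun setT (fun y => (norm3 (x - y))^-1).
Proof.
have -> : (fun y => (norm3 (x - y))^-1) =
  (fun z : R3 R * R3 R => (norm3 (z.1 - z.2))^-1) \o (pair x) by [].
apply: measurableT_comp; [exact: measurable_norm3V|exact: pair1_measurable].
Qed.

(** The exponent 5/2 is dual to 5/3, so that this power of the Coulomb kernel
pairs with densities in L^(5/3); it is locally integrable because 5/2 < 3. *)
Definition sing x : R := (norm3 x)^-1 `^ (5 / 2).

Lemma measurable_sing x : measurable_fun setT (fun y => sing (x - y)).
Proof.
have -> : (fun y => sing (x - y)) =
  (@powR R)^~ (5 / 2) \o (fun y => (norm3 (x - y))^-1) by [].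
apply: measurableT_comp; [exact: measurable_powR|exact: measurable_norm3V1].
Qed.

(** Between the cubes of half-sides [T / 4 ^ k] and [T / 4 ^ k.+1] the kernel is
at most [(4 ^ k.+1 / T) ^ (5/2) = 32 ^ k.+1 * T ^ (-5/2)], while the volume
decreases like [64 ^ (- k)]; the kernel is thus dominated by a series of
indicator functions whose integrals are geometric of ratio 1/2.  The bound is
uniform in the centre of the cube. *)
Lemma sing_bound : exists C : R -> R, forall x (T : R), 0 < T ->
  (\int[leb3]_(y in cube x T) (sing (x - y))%:E <= (C T)%:E)%E.
Proof.
pose w (T : R) := T^-1 `^ (5 / 2).
exists (fun T => 512 * w T * T ^+ 3) => x T T0.
pose a k : R := 32 ^+ k.+1 * w T.
have w0 : 0 <= w T by exact: powR_ge0.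
have a0 k : 0 <= a k by rewrite mulr_ge0// exprn_ge0.
pose f k y : \bar R := (a k * \1_(cube x (T / 4 ^+ k)) y)%:E.
have f0 k y : (0 <= f k y)%E by rewrite lee_fin mulr_ge0.
have mf k : measurable_fun setT (f k).
  by apply/measurable_EFinP; apply: measurable_funM => //;
    apply: measurable_indic; exact: measurable_cube.
have T4 k : 0 < T / 4 ^+ k by rewrite divr_gt0// exprn_gt0.
have le_series y : cube x T y -> ((sing (x - y))%:E <= \sum_(0 <= k <oo) f k y)%E.
  move=> Ty; have [->|xy] := pselect (x = y).
    rewrite /sing subrr /norm3 /= expr0n/= !addr0 sqrtr0 invr0 powR0//.
    exact: nneseries_ge0.
  have [k0 nk0] : exists k, ~~ `[< cube x (T / 4 ^+ k) y >].
    apply: contrapT => nk; apply: xy; apply: (cube_shrink (T := T)) => k.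
    by apply: contrapT => nck; apply: nk; exists k; apply/asboolP.
  have [k /asboolP nk kmin] := ex_minnP (ex_intro (fun k => ~~ `[< cube x (T / 4 ^+ k) y >]) k0 nk0).
  case: k nk kmin => [|k] nk kmin; first by rewrite expr0 divr1 in nk.
  have ck : cube x (T / 4 ^+ k) y.
    apply: contrapT => nck; have := kmin k; rewrite ltnn => H.
    by have : false by apply: H; apply/asboolPn.
  have xk := notin_cube nk.
  apply: (@le_trans _ _ (f k y)).
    rewrite /f indicE mem_set// mulr1 lee_fin /a /sing /w.
    have -> : 32 ^+ k.+1 = (4 ^+ k.+1 : R) `^ (5 / 2).
      have -> : (4 : R) = 2 ^+ 2 by rewrite -natrX.
      have -> : (32 : R) = 2 ^+ 5 by rewrite -natrX.
      rewrite -!exprM -[(2 ^+ (2 * _))]powR_mulrn// -powRrM -[LHS]powR_mulrn//.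
      by congr (_ `^ _); rewrite !natrM; field.
    rewrite -powRM ?exprn_ge0 ?invr_ge0 ?(ltW T0)//.
    apply: le_powR => //; first by rewrite invr_ge0 norm3_ge0.
    rewrite invf_ple ?posrE//; last first.
    - by rewrite divr_gt0// exprn_gt0.
    - by apply: lt_le_trans xk.
    by rewrite invf_div.
  apply: le_trans (nneseries_lim_ge k.+1 _) => //.
  by rewrite big_nat_recr//= leeDr// sume_ge0.
apply: (@le_trans _ _ (\int[leb3]_y \sum_(0 <= k <oo) f k y)%E).
  rewrite integral_mkcond; apply: ge0_le_integral => //.
  - by move=> y _; rewrite patchE; case: ifP => // _; rewrite lee_fin powR_ge0.
  - apply/(measurable_restrictT _ (measurable_cube _ _)).
    by apply: measurable_funTS; apply/measurable_EFinP; exact: measurable_sing.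
  - exact: ge0_emeasurable_sum.
  - move=> y _; rewrite patchE; case: ifPn => [|_]; first by rewrite inE; exact: le_series.
    exact: nneseries_ge0.
rewrite integral_nneseries//.
have intf k : (\int[leb3]_y f k y =
    ((512 * w T * T ^+ 3) / (2 ^ (k + 0.+1))%:R)%:E)%E.
  rewrite /f integral_cube ?(ltW (T4 k))//; congr EFin.
  rewrite /a natrX addn1.
  have -> : (32 : R) ^+ k.+1 = 32 * (2 ^+ k) ^+ 5.
    have E : (32 : R) = 2 ^+ 5 by rewrite -natrX.
    by rewrite exprS {2}E -!exprM mulnC.
  have -> : (4 : R) ^+ k = (2 ^+ k) ^+ 2.
    have E : (4 : R) = 2 ^+ 2 by rewrite -natrX.
    by rewrite E -!exprM mulnC.
  rewrite (exprS _ k); have : (2 ^+ k : R) != 0 by rewrite expf_neq0.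
  by move: (2 ^+ k) => P P0; field.
rewrite (eq_eseriesr (fun k _ => intf k)).
have /cvg_lim -> // := @cvg_geometric_eseries_half R (512 * w T * T ^+ 3) 0.
by rewrite expr0 divr1.
Qed.

End space.

(** * Kinetic energy densities *)

Lemma ler_min_mul (R : realDomainType) (a b x y : R) :
  0 <= a -> 0 <= b -> 0 <= x -> 0 <= y ->
  Num.min a b * Num.min x y <= Num.min (a * x) (b * y).
Proof.
move=> a0 b0 x0 y0; rewrite le_min; apply/andP; split; apply: ler_pM;
  by rewrite ?le_min ?ge_min ?lexx ?a0 ?b0 ?x0 ?y0 ?orbT.
Qed.

Section fermi.
Context {R : realType}.
Implicit Types (q m c s t : R) (e : R3 R -> R).

Definition kinetic m c t : R := Num.sqrt (c ^+ 2 * t ^+ 2 + m ^+ 2 * c ^+ 4) - m * c ^+ 2.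

(** With [X] the square root, [(X - m c^2) (X + m c^2) = c^2 t^2].  The lower
bound quantifies the nonrelativistic limit: the error is of order [c ^ -2] for
fixed [t]. *)
Lemma kinetic_bounds m c t : 0 < m -> 0 < c -> 0 <= t ->
  [/\ 0 <= kinetic m c t, kinetic m c t <= t ^+ 2 / (2 * m) &
      t ^+ 2 / (2 * m) - t ^+ 4 / (8 * m ^+ 3 * c ^+ 2) <= kinetic m c t].
Proof.
move=> m0 c0 t0; rewrite /kinetic; set X := Num.sqrt _.
have mc0 : 0 < m * c ^+ 2 by rewrite mulr_gt0// exprn_gt0.
have X0 : 0 <= X by exact: sqrtr_ge0.
have XX : X ^+ 2 = c ^+ 2 * t ^+ 2 + m ^+ 2 * c ^+ 4.
  by rewrite sqr_sqrtr// addr_ge0// mulr_ge0// exprn_ge0// ltW.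
have E0 : m * c ^+ 2 <= X.
  by rewrite -ler_sqr ?nnegrE ?(ltW mc0)// XX exprMn -exprM lerDr mulr_ge0// exprn_ge0// ltW.
have E1 : X <= m * c ^+ 2 + t ^+ 2 / (2 * m).
  have h : 0 <= t ^+ 2 / (2 * m) by rewrite divr_ge0 ?exprn_ge0// mulr_ge0// ltW.
  rewrite -ler_sqr ?nnegrE// ?addr_ge0 ?(ltW mc0)// XX -subr_ge0.
  have -> : (m * c ^+ 2 + t ^+ 2 / (2 * m)) ^+ 2 - (c ^+ 2 * t ^+ 2 + m ^+ 2 * c ^+ 4)
     = (t ^+ 2 / (2 * m)) ^+ 2 by field; rewrite gt_eqF.
  exact: sqr_ge0.
split; [by rewrite subr_ge0|by rewrite lerBlDl|].
set b := t ^+ 2 / (2 * m) in E1 *.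
have b0 : 0 <= b by rewrite divr_ge0 ?exprn_ge0// mulr_ge0// ltW.
set y := b - _.
have yE : y * (2 * (m * c ^+ 2) + b) <= c ^+ 2 * t ^+ 2.
  have -> : y * (2 * (m * c ^+ 2) + b) = c ^+ 2 * t ^+ 2 - t ^+ 6 / (16 * m ^+ 4 * c ^+ 2).
    by rewrite /y /b; field; rewrite !gt_eqF.
  rewrite gerBl divr_ge0// ?exprn_ge0// !mulr_ge0// ?exprn_ge0// ltW//.
have : c ^+ 2 * t ^+ 2 <= (X - m * c ^+ 2) * (2 * (m * c ^+ 2) + b).
  have -> : c ^+ 2 * t ^+ 2 = (X - m * c ^+ 2) * (X + m * c ^+ 2).
    rewrite -subr_sqr XX; ring.
  by apply: ler_wpM2l; [rewrite subr_ge0|lra].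
move/(le_trans yE); rewrite ler_pM2r//; lra.
Qed.

(** The kinetic energy is comparable with its nonrelativistic form when
[t <= 2 m c] and with its ultrarelativistic form [c t] beyond. *)
Lemma kinetic_lower m c t t0 : 0 < m -> 0 < c -> 0 <= t0 -> t0 <= t ->
  2^-1 * Num.min (c * t0) (t0 ^+ 2 / (2 * m)) <= kinetic m c t.
Proof.
move=> m0 c0 t00 t0t; have t_ge0 : 0 <= t by exact: le_trans t0t.
rewrite /kinetic; set X := Num.sqrt _.
have mc0 : 0 < m * c ^+ 2 by rewrite mulr_gt0// exprn_gt0.
have X0 : 0 <= X by exact: sqrtr_ge0.
have ct0 : 0 <= c * t by rewrite mulr_ge0// ltW.
have XX : X ^+ 2 = c ^+ 2 * t ^+ 2 + m ^+ 2 * c ^+ 4.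
  by rewrite sqr_sqrtr// addr_ge0// mulr_ge0// exprn_ge0// ltW.
have E0 : m * c ^+ 2 <= X.
  by rewrite -ler_sqr ?nnegrE ?(ltW mc0)// XX exprMn -exprM lerDr mulr_ge0// exprn_ge0// ltW.
have E1 : X <= m * c ^+ 2 + c * t.
  rewrite -ler_sqr ?nnegrE// ?addr_ge0 ?(ltW mc0)// XX -subr_ge0.
  have -> : (m * c ^+ 2 + c * t) ^+ 2 - (c ^+ 2 * t ^+ 2 + m ^+ 2 * c ^+ 4)
     = 2 * (m * c ^+ 2) * (c * t) by ring.
  by rewrite !mulr_ge0// ltW.
have cE : c ^+ 2 * t ^+ 2 <= (X - m * c ^+ 2) * (c * t + 2 * (m * c ^+ 2)).
  have -> : c ^+ 2 * t ^+ 2 = (X - m * c ^+ 2) * (X + m * c ^+ 2).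
    rewrite -subr_sqr XX; ring.
  by apply: ler_wpM2l; [rewrite subr_ge0|lra].
have [tm|tm] := leP t (2 * m * c).
  apply: (@le_trans _ _ (2^-1 * (t ^+ 2 / (2 * m)))).
    rewrite ler_pM2l//; rewrite ge_min; apply/orP; right.
    by rewrite ler_pM2r ?invr_gt0 ?mulr_gt0// lerXn2r ?nnegrE.
  have : c ^+ 2 * t ^+ 2 <= (X - m * c ^+ 2) * (4 * (m * c ^+ 2)).
    apply: le_trans cE _; apply: ler_wpM2l; first by rewrite subr_ge0.
    have : c * t <= c * (2 * m * c) by rewrite ler_pM2l.
    have -> : c * (2 * m * c) = 2 * (m * c ^+ 2) by ring.
    lra.
  have -> : (X - m * c ^+ 2) * (4 * (m * c ^+ 2)) = c ^+ 2 * ((X - m * c ^+ 2) * (4 * m)) by ring.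
  rewrite ler_pM2l ?exprn_gt0// -ler_pdivrMr ?mulr_gt0//.
  by apply: le_trans; rewrite le_eqVlt; apply/orP; left; apply/eqP; field; rewrite gt_eqF.
apply: (@le_trans _ _ (2^-1 * (c * t))).
  rewrite ler_pM2l//; rewrite ge_min; apply/orP; left.
  by rewrite ler_pM2l.
have ct1 : 0 < c * t by rewrite mulr_gt0// (le_lt_trans _ tm)// !mulr_ge0// ltW.
have : c ^+ 2 * t ^+ 2 <= (X - m * c ^+ 2) * (2 * (c * t)).
  apply: le_trans cE _; apply: ler_wpM2l; first by rewrite subr_ge0.
  have : c * (2 * m * c) <= c * t by rewrite ler_pM2l// ltW.
  have -> : c * (2 * m * c) = 2 * (m * c ^+ 2) by ring.
  lra.
have -> : c ^+ 2 * t ^+ 2 = (2^-1 * (c * t)) * (2 * (c * t)) by field.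
by rewrite ler_pM2r// mulr_gt0.
Qed.

Definition fermi_cst q : R := q / (8 * pi ^+ 3).
Definition fermi_radius q s : R := (6 * pi ^+ 2 * s / q) `^ (1 / 3).

Lemma fermi_cst_gt0 q : 0 < q -> 0 < fermi_cst q.
Proof. by move=> q0; rewrite divr_gt0// mulr_gt0// exprn_gt0// pi_gt0. Qed.

Lemma fermi_radius_cube q s : 0 < q -> 0 <= s ->
  fermi_radius q s ^+ 3 = 6 * pi ^+ 2 / q * s.
Proof.
move=> q0 s0; rewrite /fermi_radius -powR_mulrn ?powR_ge0// -powRrM.
rewrite div1r mulVf// powRr1; last by rewrite divr_ge0 ?(ltW q0)// !mulr_ge0 ?exprn_ge0 ?pi_ge0//.
by ring.
Qed.

Lemma fermi_radiusX q s (n : nat) : 0 < q -> 0 <= s ->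
  fermi_radius q s ^+ n = (6 * pi ^+ 2 / q) `^ (n%:R / 3) * s `^ (n%:R / 3).
Proof.
move=> q0 s0; rewrite /fermi_radius -powR_mulrn ?powR_ge0// -powRrM.
rewrite -powRM//; last by rewrite divr_ge0 ?(ltW q0)// !mulr_ge0 ?exprn_ge0 ?pi_ge0//.
by congr (_ `^ _); ring.
Qed.

Lemma lt_fermi_radius q s t : 0 < q -> 0 <= s -> 0 <= t ->
  (t < fermi_radius q s) = (t ^+ 3 < 6 * pi ^+ 2 / q * s).
Proof.
move=> q0 s0 t0; rewrite -fermi_radius_cube// ltr_pXn2r// nnegrE//.
exact: powR_ge0.
Qed.

Lemma measurable_fermi_ball q s : measurable (fermi_ball q s).
Proof.
rewrite (_ : fermi_ball q s = (fun p => norm3 p < fermi_radius q s) @^-1` [set true])//.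
rewrite -[X in measurable X]setTI.
exact: (measurable_fun_ltr measurable_norm3 (measurable_cst _)).
Qed.

Lemma fermi_integralE q e s : 0 < q -> measurable_fun setT e -> (forall p, 0 <= e p) ->
  fermi_integral q e s = (\int[leb3]_p
    (if (norm3 p < fermi_radius q s)%R then (fermi_cst q * e p)%:E else 0))%E.
Proof.
move=> q0 me e0; rewrite /fermi_integral -ge0_integralZl_EFin//; last 4 first.
- exact: measurable_fermi_ball.
- by move=> p _; rewrite lee_fin.
- by apply: measurable_funTS; exact/measurable_EFinP.
- by rewrite ltW// fermi_cst_gt0.
rewrite integral_mkcond; apply: eq_integral => p _; rewrite patchE.
by rewrite mem_setE /fermi_ball /fermi_radius /=; case: ifPn.
Qed.

Lemma fermi_ge0 q e s : 0 < q -> (forall p, 0 <= e p) -> (0 <= fermi_integral q e s)%E.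
Proof.
move=> q0 e0; apply: mule_ge0; first by rewrite lee_fin ltW// fermi_cst_gt0.
by apply: integral_ge0 => p _; rewrite lee_fin.
Qed.

Lemma fermi_at0 q e : fermi_integral q e 0 = 0%E.
Proof.
rewrite /fermi_integral (_ : fermi_ball q 0 = set0) ?integral_set0 ?mule0//.
rewrite -subset0 => p; rewrite /fermi_ball /= mulr0 mul0r powR0 ?ltNge ?norm3_ge0//.
Qed.

Lemma measurable_fermi_radius q : measurable_fun setT (fermi_radius q).
Proof.
have -> : fermi_radius q = (@powR R)^~ (1 / 3) \o (fun s => 6 * pi ^+ 2 * s / q) by [].
apply: measurableT_comp; first exact: measurable_powR.
by apply: measurable_funM => //; apply: measurable_funM.
Qed.

Lemma fermi_measurable_integrand q e : 0 < q -> measurable_fun setT e ->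
  measurable_fun setT (fun z : R * R3 R =>
    (if (norm3 z.2 < fermi_radius q z.1)%R then (fermi_cst q * e z.2)%:E else 0)%E).
Proof.
move=> q0 me; apply: measurable_fun_ifT => //.
- apply: measurable_fun_ltr.
    exact: (measurableT_comp measurable_norm3 measurable_snd).
  exact: (measurableT_comp (measurable_fermi_radius q) measurable_fst).
- apply/measurable_EFinP; apply: measurable_funM => //.
  exact: (measurableT_comp me measurable_snd).
Qed.

Lemma measurable_fermi q e : 0 < q -> measurable_fun setT e -> (forall p, 0 <= e p) ->
  measurable_fun setT (fermi_integral q e).
Proof.
move=> q0 me e0.
have := @measurable_fun_fubini_tonelli_F _ _ _ _ _ (@leb3 R) _ (fermi_measurable_integrand q0 me).
rewrite (_ : fubini_F _ _ = fermi_integral q e) => [|]; last first.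
  by apply/funext => s; rewrite fermi_integralE.
apply => -[s p] /=; case: ifP => // _.
by rewrite lee_fin mulr_ge0// ltW// fermi_cst_gt0.
Qed.

Lemma le_fermi q e e' s : 0 < q -> measurable_fun setT e -> (forall p, 0 <= e p) ->
  measurable_fun setT e' -> (forall p, e p <= e' p) ->
  (fermi_integral q e s <= fermi_integral q e' s)%E.
Proof.
move=> q0 me e0 me' ee'; apply: lee_wpmul2l.
  by rewrite lee_fin ltW// fermi_cst_gt0.
apply: ge0_le_integral.
- exact: measurable_fermi_ball.
- by move=> p _; rewrite lee_fin.
- by apply: measurable_funTS; exact/measurable_EFinP.
- by apply: measurable_funTS; exact/measurable_EFinP.
- by move=> p _; rewrite lee_fin.
Qed.

Lemma sqr_le_of_itv (P a : R) : 0 < P ->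
  a <= 3 / 8 * P + P / 8 -> 3 / 8 * P - P / 8 <= a -> a ^+ 2 <= P ^+ 2 / 4.
Proof.
move=> P0 au al; have -> : P ^+ 2 / 4 = (P / 2) ^+ 2 by field.
by rewrite ler_sqr ?nnegrE; lra.
Qed.

(** Part of the Fermi ball at distance at least a quarter of the radius from
the origin already contains a cube whose volume is a fixed fraction of the
cubed radius. *)
Lemma fermi_lower q e s (b : R) : 0 < q -> 0 <= s -> measurable_fun setT e ->
  (forall p, 0 <= e p) -> 0 <= b ->
  (forall p, fermi_radius q s / 4 <= norm3 p -> b <= e p) ->
  ((fermi_cst q * b * fermi_radius q s ^+ 3 / 64)%:E <= fermi_integral q e s)%E.
Proof.
move=> q0 s0 me e0 b0 be; set P := fermi_radius q s in be *.
have P0 : 0 <= P by exact: powR_ge0.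
have K0 := fermi_cst_gt0 q0.
have [P00|P1] := eqVneq P 0.
  by rewrite P00 expr0n/= mulr0 mul0r fermi_ge0.
have {}P1 : 0 < P by rewrite lt_neqAle eq_sym P1.
(* On the cube of centre x0 and half-side P / 8 all coordinates lie between
   P / 4 and P / 2, so that P / 4 <= |p| and |p|^2 <= 3 P^2 / 4. *)
pose x0 : R3 R := (3 / 8 * P, 3 / 8 * P, 3 / 8 * P).
have -> : fermi_cst q * b * P ^+ 3 / 64 = fermi_cst q * b * (2 * (P / 8)) ^+ 3 by field.
rewrite -(integral_cube x0); [|by pos|by pos].
rewrite fermi_integralE//; apply: ge0_le_integral => //.
- by move=> p _; rewrite lee_fin; pos.
- apply/measurable_EFinP; apply: measurable_funM => //; apply: measurable_indic.
  exact: measurable_cube.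
- exact: (measurableT_comp (fermi_measurable_integrand q0 me) (pair1_measurable s)).
move=> p _; rewrite indicE; case: (boolP (p \in _)) => [|_]; last first.
  by rewrite mulr0; case: ifP => // _; rewrite lee_fin mulr_ge0// ltW.
rewrite inE => -[]; rewrite /x0 /= !ler_distl => /andP[l1 u1] /andP[l2 u2] /andP[l3 u3].
have [a1 a2 a3] := norm3_coord p.
have P4 : P / 4 <= norm3 p by apply: le_trans a1; apply: le_trans (ler_norm _); lra.
have -> : norm3 p < P.
  rewrite -ltr_sqr ?nnegrE ?norm3_ge0// norm3_sqr.
  have := sqr_le_of_itv P1 u1 l1; have := sqr_le_of_itv P1 u2 l2.
  have := sqr_le_of_itv P1 u3 l3.
  have : 0 < P ^+ 2 by rewrite exprn_gt0.
  lra.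
by rewrite mulr1 lee_fin ler_pM2l// be.
Qed.

Definition kinetic_fun m c (p : R3 R) := kinetic m c (norm3 p).

Lemma j_mcE q m c : j_mc q m c = fermi_integral q (kinetic_fun m c).
Proof. by []. Qed.

Lemma measurable_kinetic m c : measurable_fun setT (kinetic_fun m c).
Proof.
apply: measurable_funB => //; apply: measurableT_comp.
  exact: (continuous_measurable_fun (@sqrt_continuous R)).
apply: measurable_funD => //; apply: measurable_funM => //.
apply: measurable_funX; exact: measurable_norm3.
Qed.

Lemma measurable_kinetic_infty m : measurable_fun setT (fun p : R3 R => norm3 p ^+ 2 / (2 * m)).
Proof.
apply: measurable_funM => //; apply: measurable_funX; exact: measurable_norm3.
Qed.

Lemma kinetic_fun_ge0 m c : 0 < m -> 0 < c -> forall p, 0 <= kinetic_fun m c p.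
Proof. by move=> m0 c0 p; have [] := kinetic_bounds m0 c0 (norm3_ge0 p). Qed.

Lemma kinetic_infty_ge0 m : 0 < m -> forall p : R3 R, 0 <= norm3 p ^+ 2 / (2 * m).
Proof. by move=> m0 p; rewrite divr_ge0 ?exprn_ge0 ?norm3_ge0// mulr_ge0// ltW. Qed.

Lemma j_mc_ge0 q m c s : 0 < q -> 0 < m -> 0 < c -> (0 <= j_mc q m c s)%E.
Proof. by move=> q0 m0 c0; apply: fermi_ge0 => //; exact: kinetic_fun_ge0. Qed.

Lemma j_infty_ge0 q m s : 0 < q -> 0 < m -> (0 <= j_infty q m s)%E.
Proof. by move=> q0 m0; apply: fermi_ge0 => //; exact: kinetic_infty_ge0. Qed.

Lemma measurable_j_mc q m c : 0 < q -> 0 < m -> 0 < c -> measurable_fun setT (j_mc q m c).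
Proof.
move=> q0 m0 c0; apply: measurable_fermi => //; first exact: measurable_kinetic.
exact: kinetic_fun_ge0.
Qed.

Lemma measurable_j_infty q m : 0 < q -> 0 < m -> measurable_fun setT (j_infty q m).
Proof.
move=> q0 m0; apply: measurable_fermi => //; first exact: measurable_kinetic_infty.
exact: kinetic_infty_ge0.
Qed.

Lemma j_mc_le_infty q m c s : 0 < q -> 0 < m -> 0 < c -> (j_mc q m c s <= j_infty q m s)%E.
Proof.
move=> q0 m0 c0; apply: le_fermi => //.
- exact: measurable_kinetic.
- exact: kinetic_fun_ge0.
- exact: measurable_kinetic_infty.
- by move=> p; have [] := kinetic_bounds m0 c0 (norm3_ge0 p).
Qed.

(** The Fermi ball of radius [P] lies in a cube of volume [(2 P) ^ 3], where the
integrand is at most [P ^ 2 / (2 m)]. *)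
Lemma j_infty_upper q m : 0 < q -> 0 < m ->
  exists2 C : R, 0 < C & forall s, 0 <= s -> (j_infty q m s <= (C * s `^ (5 / 3))%:E)%E.
Proof.
move=> q0 m0; have K0 := fermi_cst_gt0 q0.
have a0 : 0 < 6 * pi ^+ 2 / q by rewrite divr_gt0// mulr_gt0// exprn_gt0// pi_gt0.
exists (fermi_cst q / (2 * m) * 8 * (6 * pi ^+ 2 / q) `^ (5 / 3)).
  by pos.
move=> s s0; rewrite -mulrA -fermi_radiusX//.
set P := fermi_radius q s; have P0 : 0 <= P by exact: powR_ge0.
have -> : fermi_cst q / (2 * m) * 8 * P ^+ 5 = fermi_cst q * (P ^+ 2 / (2 * m)) * (2 * P) ^+ 3.
  by field; rewrite gt_eqF.
have b0 : 0 <= fermi_cst q * (P ^+ 2 / (2 * m)).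
  by rewrite mulr_ge0 ?(ltW K0)// divr_ge0 ?exprn_ge0// mulr_ge0// ltW.
rewrite -(integral_cube 0)//.
rewrite /j_infty fermi_integralE//; last 2 first.
- exact: measurable_kinetic_infty.
- exact: kinetic_infty_ge0.
apply: ge0_le_integral => //.
- move=> p _; case: ifP => // _; rewrite lee_fin mulr_ge0 ?(ltW K0)//.
  exact: kinetic_infty_ge0.
- exact: (measurableT_comp (fermi_measurable_integrand q0 (measurable_kinetic_infty m)) (pair1_measurable s)).
- apply/measurable_EFinP; apply: measurable_funM => //; apply: measurable_indic.
  exact: measurable_cube.
move=> p _; case: ifPn => [pP|_]; last by rewrite lee_fin mulr_ge0.
rewrite indicE mem_set; last first.
  have [a1 a2 a3] := norm3_coord p; have := ltW pP; rewrite /cube /= !subr0 => pP'.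
  by split; [apply: le_trans a1 _|apply: le_trans a2 _|apply: le_trans a3 _].
rewrite mulr1 lee_fin ler_pM2l// ler_pM2r ?invr_gt0 ?mulr_gt0//.
by rewrite ler_sqr ?nnegrE ?norm3_ge0// ltW.
Qed.

(** The minimum changes sides at [s = c ^ 3]: below that density the bound is
the nonrelativistic one, with the same constant for all [c]. *)
Lemma j_lower q m : 0 < q -> 0 < m ->
  exists2 d : R, 0 < d & forall s, 0 <= s ->
    ((d * s `^ (5 / 3))%:E <= j_infty q m s)%E /\
    (forall c, 0 < c -> ((d * Num.min (s `^ (5 / 3)) (c * s `^ (4 / 3)))%:E <= j_mc q m c s)%E).
Proof.
move=> q0 m0; have K0 := fermi_cst_gt0 q0; set K := fermi_cst q in K0.
pose a : R := 6 * pi ^+ 2 / q.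
have a0 : 0 < a by rewrite divr_gt0// mulr_gt0// exprn_gt0// pi_gt0.
pose d5 := K * a `^ (5 / 3) / ((64 * 64) * m).
pose d4 := K * a `^ (4 / 3) / (8 * 64).
have d50 : 0 < d5 by rewrite /d5; pos.
have d40 : 0 < d4 by rewrite /d4; pos.
exists (Num.min d5 d4); first by rewrite lt_min d50.
move=> s s0.
set P := fermi_radius q s; have P0 : 0 <= P by exact: powR_ge0.
have P5 : P ^+ 5 = a `^ (5 / 3) * s `^ (5 / 3) by rewrite /P fermi_radiusX.
have P4 : P ^+ 4 = a `^ (4 / 3) * s `^ (4 / 3) by rewrite /P fermi_radiusX.
split.
  apply: le_trans (@fermi_lower q _ s ((P / 4) ^+ 2 / (2 * m)) q0 s0 _ _ _ _).
  - rewrite lee_fin -/P -/K.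
    have -> : K * ((P / 4) ^+ 2 / (2 * m)) * P ^+ 3 / 64 = K * P ^+ 5 / ((32 * 64) * m).
      by field; rewrite gt_eqF.
    rewrite P5; apply: (@le_trans _ _ (d5 * s `^ (5 / 3))).
      by rewrite ler_wpM2r ?powR_ge0// ge_min lexx.
    rewrite /d5 -subr_ge0.
    have -> : K * (a `^ (5 / 3) * s `^ (5 / 3)) / ((32 * 64) * m) - K * a `^ (5 / 3) / ((64 * 64) * m) * s `^ (5 / 3) =
      K * (a `^ (5 / 3) * s `^ (5 / 3)) / ((64 * 64) * m) by field; rewrite gt_eqF.
    by clear d50 d40; pos.
  - exact: measurable_kinetic_infty.
  - exact: kinetic_infty_ge0.
  - by rewrite divr_ge0 ?exprn_ge0// ?divr_ge0// mulr_ge0// ltW.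
  - move=> p hp; rewrite ler_pM2r ?invr_gt0 ?mulr_gt0// ler_sqr ?nnegrE ?divr_ge0//.
    exact: norm3_ge0.
move=> c c0.
have mn0 : 0 <= Num.min (c * (P / 4)) ((P / 4) ^+ 2 / (2 * m)).
  by rewrite le_min; apply/andP; split; pos.
apply: le_trans (@fermi_lower q _ s (2^-1 * Num.min (c * (P / 4)) ((P / 4) ^+ 2 / (2 * m))) q0 s0 _ _ _ _).
- rewrite lee_fin -/P -/K.
  apply: le_trans (ler_min_mul (ltW d50) (ltW d40) (powR_ge0 _ _) _) _.
    by pos.
  have -> : K * (2^-1 * Num.min (c * (P / 4)) ((P / 4) ^+ 2 / (2 * m))) * P ^+ 3 / 64 =
    Num.min (c * (P / 4)) ((P / 4) ^+ 2 / (2 * m)) * (K * P ^+ 3 / 128) by field.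
  rewrite minr_pMl; last by clear d50 d40; pos.
  have -> : c * (P / 4) * (K * P ^+ 3 / 128) = K * c * P ^+ 4 / (8 * 64) by field.
  have -> : (P / 4) ^+ 2 / (2 * m) * (K * P ^+ 3 / 128) = K * P ^+ 5 / ((64 * 64) * m).
    by field; rewrite gt_eqF.
  rewrite P4 P5 /d5 /d4 minC le_eqVlt; apply/orP; left; apply/eqP.
  by congr Num.min; field; rewrite ?gt_eqF.
- exact: measurable_kinetic.
- exact: kinetic_fun_ge0.
- by rewrite mulr_ge0.
- by move=> p hp; apply: kinetic_lower => //; rewrite divr_ge0.
Qed.

(** Fatou's lemma in the momentum variable: a momentum in the limiting Fermi
ball is eventually in the Fermi ball of [s n], and there the relativistic energy
converges to the classical one by [kinetic_bounds]. *)
Lemma j_mc_liminf q m (c s : nat -> R) (s0 : R) : 0 < q -> 0 < m -> (forall n, 0 < c n) ->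
  (forall n, 0 <= s n) -> c n @[n --> \oo] --> +oo -> s n @[n --> \oo] --> s0 ->
  (j_infty q m s0 <= limn_einf (fun n => j_mc q m (c n) (s n)))%E.
Proof.
move=> q0 m0 c0 sn0 coo ss0.
have K0 := fermi_cst_gt0 q0.
have s00 : 0 <= s0.
  rewrite leNgt; apply/negP => s00.
  by have [n _ /(_ n (leqnn n))] := cvgr_lt _ ss0 _ s00; rewrite /= ltNge sn0.
rewrite /j_infty fermi_integralE//; [|exact: measurable_kinetic_infty|exact: kinetic_infty_ge0].
rewrite (_ : (fun n => j_mc q m (c n) (s n)) = (fun n => \int[leb3]_p
    (if (norm3 p < fermi_radius q (s n))%R then (fermi_cst q * kinetic_fun m (c n) p)%:E else 0))%E); last first.
  apply/funext => n; rewrite j_mcE fermi_integralE//; first exact: measurable_kinetic.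
  exact: kinetic_fun_ge0.
apply: fatou_le.
- exact: (measurableT_comp (fermi_measurable_integrand q0 (measurable_kinetic_infty m)) (pair1_measurable s0)).
- move=> n.
  exact: (measurableT_comp (fermi_measurable_integrand q0 (measurable_kinetic m (c n))) (pair1_measurable (s n))).
- by move=> p; case: ifP => // _; rewrite lee_fin mulr_ge0 ?(ltW K0)// kinetic_infty_ge0.
- by move=> n p; case: ifP => // _; rewrite lee_fin mulr_ge0 ?(ltW K0)// kinetic_fun_ge0.
apply: nearW => p; set t := norm3 p; have t0 : 0 <= t := norm3_ge0 p.
case: ifPn => [|_]; last first.
  apply: limn_einf_ge; apply: nearW => n; case: ifP => // _.
  by rewrite lee_fin mulr_ge0 ?(ltW K0)// kinetic_fun_ge0.
rewrite lt_fermi_radius// => ts; apply/lee_subgt0Pr => e e0; apply: limn_einf_ge.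
have a0 : 0 < 6 * pi ^+ 2 / q by rewrite divr_gt0// mulr_gt0// exprn_gt0// pi_gt0.
have tsn : \forall n \near \oo, t ^+ 3 / (6 * pi ^+ 2 / q) < s n.
  by apply: (cvgr_gt _ ss0); rewrite ltr_pdivrMr// mulrC.
pose A := fermi_cst q * (t ^+ 4 / (8 * m ^+ 3)) / e.
near=> n.
rewrite lt_fermi_radius//.
have -> : t ^+ 3 < 6 * pi ^+ 2 / q * s n.
  by rewrite mulrC -ltr_pdivrMr//; near: n.
rewrite -EFinD lee_fin.
have [_ _ low] := kinetic_bounds m0 (c0 n) t0.
have An : A <= c n by near: n; move/cvgryPge : coo; exact.
have c1 : 1 <= c n by near: n; move/cvgryPge : coo; exact.
have : fermi_cst q * (t ^+ 2 / (2 * m) - t ^+ 4 / (8 * m ^+ 3 * c n ^+ 2)) <=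
  fermi_cst q * kinetic_fun m (c n) p by rewrite ler_pM2l.
apply: le_trans; rewrite mulrBr lerB// invfM mulrA mulrA ler_pdivrMr ?exprn_gt0//.
move: An; rewrite /A ler_pdivrMr// mulrA => /le_trans; apply.
by rewrite mulrC ler_pM2l// expr2 ler_peMr// ltW.
Unshelve. all: by end_near. Qed.

End fermi.

(** * The Coulomb form *)

Section coulomb_form.
Context {R : realType}.
Implicit Types (f g : R3 R -> R) (x : R3 R).

Definition density f := measurable_fun setT f /\ forall x, 0 <= f x.

Lemma measurable_density_powR f (p : R) : density f ->
  measurable_fun setT (fun x => f x `^ p).
Proof.
move=> [mf _]; have -> : (fun x => f x `^ p) = (@powR R)^~ p \o f by [].
by apply: measurableT_comp; first exact: measurable_powR.
Qed.

Definition potential g x : \bar R := (\int[leb3]_y (g y / norm3 (x - y))%:E)%E.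

(** The symmetric bilinear form whose diagonal is twice the Coulomb energy; the
energy of a sum of densities is expanded through it. *)
Definition coulomb_form f g : \bar R :=
  (\int[leb3]_x \int[leb3]_y (f x * g y / norm3 (x - y))%:E)%E.

Local Notation B := coulomb_form.

Lemma coulombE f : coulomb f = ((1 / 2)%:E * B f f)%E.
Proof. by []. Qed.

Definition interaction f g (z : R3 R * R3 R) : \bar R :=
  (f z.1 * g z.2 / norm3 (z.1 - z.2))%:E.

Lemma measurable_interaction f g : density f -> density g ->
  measurable_fun setT (interaction f g).
Proof.
move=> [mf f0] [mg g0]; apply/measurable_EFinP; apply: measurable_funM.
  apply: measurable_funM; first exact: (measurableT_comp mf measurable_fst).
  exact: (measurableT_comp mg measurable_snd).
exact: measurable_norm3V.
Qed.

Lemma interaction_ge0 f g : density f -> density g -> forall z, (0 <= interaction f g z)%E.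
Proof.
move=> [_ f0] [_ g0] z; rewrite lee_fin mulr_ge0 ?mulr_ge0//.
by rewrite invr_ge0 norm3_ge0.
Qed.

(** On the product space symmetry is an exchange of variables, and comparison,
additivity and dominated convergence hold without inner integrals. *)
Lemma coulomb_form_prod f g : density f -> density g ->
  B f g = (\int[(leb3 \x leb3)%E]_z interaction f g z)%E.
Proof.
move=> df dg; rewrite (fubini_tonelli1 (interaction f g))//.
- exact: measurable_interaction.
- exact: interaction_ge0.
Qed.

Lemma coulomb_form_sym f g : density f -> density g -> B f g = B g f.
Proof.
move=> df dg; rewrite /B.
rewrite (fubini_tonelli (interaction f g)); last 2 first.
- exact: measurable_interaction.
- exact: interaction_ge0.
apply: eq_integral => x _; apply: eq_integral => y _.
by rewrite /interaction /= (mulrC (f y)) -norm3N opprB.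
Qed.

Lemma coulomb_form_ge0 f g : density f -> density g -> (0 <= B f g)%E.
Proof.
move=> df dg; rewrite coulomb_form_prod//; apply: integral_ge0 => z _.
exact: interaction_ge0.
Qed.

Lemma le_coulomb_form f f' g g' : density f -> density f' -> density g -> density g' ->
  (forall x, f x <= f' x) -> (forall x, g x <= g' x) -> (B f g <= B f' g')%E.
Proof.
move=> df df' dg dg' ff gg; rewrite !coulomb_form_prod//.
apply: ge0_le_integral => //.
- by move=> z _; exact: interaction_ge0.
- exact: measurable_interaction.
- exact: measurable_interaction.
move=> z _; rewrite lee_fin ler_wpM2r//; first by rewrite invr_ge0 norm3_ge0.
by apply: ler_pM => //; [exact: df.2|exact: dg.2].
Qed.

Lemma densityD f g : density f -> density g -> density (f \+ g).
Proof.
move=> [mf f0] [mg g0]; split; first exact: measurable_funD.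
by move=> x; rewrite addr_ge0.
Qed.

Lemma coulomb_formDl f f' g : density f -> density f' -> density g ->
  B (f \+ f') g = (B f g + B f' g)%E.
Proof.
move=> df df' dg; have dff := densityD df df'; rewrite !coulomb_form_prod//.
rewrite -ge0_integralD//.
- apply: eq_integral => z _; rewrite /interaction /= -EFinD; congr EFin.
  by rewrite !mulrDl.
- by move=> z _; exact: interaction_ge0.
- exact: measurable_interaction.
- by move=> z _; exact: interaction_ge0.
- exact: measurable_interaction.
Qed.

Lemma coulomb_formDr f g g' : density f -> density g -> density g' ->
  B f (g \+ g') = (B f g + B f g')%E.
Proof.
move=> df dg dg'; have dgg := densityD dg dg'.
by rewrite (coulomb_form_sym df dgg) (coulomb_formDl dg dg' df) (coulomb_form_sym dg df)
  (coulomb_form_sym dg' df).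
Qed.

Lemma measurable_potential_integrand g x : density g ->
  measurable_fun setT (fun y => (g y / norm3 (x - y))%:E).
Proof.
move=> [mg _]; apply/measurable_EFinP; apply: measurable_funM => //.
exact: measurable_norm3V1.
Qed.

Lemma coulomb_formE f g : density f -> density g ->
  B f g = (\int[leb3]_x ((f x)%:E * potential g x))%E.
Proof.
move=> [mf f0] dg; apply: eq_integral => x _; rewrite -ge0_integralZl_EFin//.
- by apply: eq_integral => y _; rewrite -EFinM mulrA.
- by move=> y _; rewrite lee_fin divr_ge0 ?dg.2 ?norm3_ge0.
- exact: measurable_potential_integrand.
Qed.

Lemma measurable_potential g : density g -> measurable_fun setT (potential g).
Proof.
move=> dg; have d1 : density (fun=> 1) by split => //; exact: measurable_cst.
have := @measurable_fun_fubini_tonelli_F _ _ _ _ _ (@leb3 R) _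
  (measurable_interaction d1 dg) (interaction_ge0 d1 dg).
rewrite (_ : fubini_F _ _ = potential g)//; apply/funext => x.
by apply: eq_integral => y _; rewrite /interaction /= mul1r.
Qed.

Lemma coulomb_form_le_potential f g (N W : R) : density f -> density g -> 0 <= W ->
  (\int[leb3]_x (f x)%:E <= N%:E)%E -> (forall x, potential g x <= W%:E)%E ->
  (B f g <= (N * W)%:E)%E.
Proof.
move=> df dg W0 fN gW; rewrite coulomb_formE//.
have pg0 x : (0 <= potential g x)%E.
  by apply: integral_ge0 => y _; rewrite lee_fin divr_ge0 ?dg.2 ?norm3_ge0.
apply: (@le_trans _ _ (\int[leb3]_x ((f x)%:E * W%:E))%E).
  apply: ge0_le_integral; first exact: measurableT.
  - by move=> x _; rewrite mule_ge0// lee_fin df.2.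
  - apply: emeasurable_funM; last exact: measurable_potential.
    by apply/measurable_EFinP; exact: df.1.
  - by apply: emeasurable_funM => //; apply/measurable_EFinP; exact: df.1.
  - by move=> x _; rewrite lee_wpmul2l// lee_fin df.2.
rewrite ge0_integralZr//; last 2 first.
- by apply/measurable_EFinP; exact: df.1.
- by move=> x _; rewrite lee_fin df.2.
by rewrite EFinM lee_wpmul2r// lee_fin.
Qed.

(** Either the left-hand side is below the first term, or
[s ^ (2/3) < k / a], that is [s < (k / a) ^ (3/2)], and it is below the
second. *)
Lemma young_potential (a s k : R) : 0 < a -> 0 <= s -> 0 <= k ->
  s * k <= a * s `^ (5 / 3) + a `^ (- (3 / 2)) * k `^ (5 / 2).
Proof.
move=> a0 s0 k0; have [h|h] := leP (s * k) (a * s `^ (5 / 3)).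
  by apply: le_trans h _; rewrite lerDl mulr_ge0 ?powR_ge0.
apply: (@le_trans _ _ (a `^ (- (3 / 2)) * k `^ (5 / 2))); last first.
  by rewrite lerDr; pos.
have {}s0 : 0 < s.
  by rewrite lt_neqAle s0 andbT; apply/eqP => s0'; move: h; rewrite -s0' mul0r powR0// mulr0 ltxx.
have E : s `^ (5 / 3) = s * s `^ (2 / 3).
  have -> : 5 / 3 = 1 + 2 / 3 :> R by field.
  by rewrite powRD ?powRr1 ?(ltW s0)// gt_eqF// implybT.
move: h; rewrite E mulrCA ltr_pM2l// => h.
have {}h : s `^ (2 / 3) <= k / a by rewrite ler_pdivlMr// mulrC ltW.
have : (s `^ (2 / 3)) `^ (3 / 2) <= (k / a) `^ (3 / 2) by apply: le_powR => //; exact: powR_ge0.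
rewrite -powRrM (_ : 2 / 3 * (3 / 2) = 1); last by field.
rewrite powRr1 ?(ltW s0)// => {}h.
apply: (@le_trans _ _ ((k / a) `^ (3 / 2) * k)); first by rewrite ler_wpM2r.
rewrite powRM ?invr_ge0 ?(ltW a0)//.
have -> : a^-1 `^ (3 / 2) = a `^ (- (3 / 2)).
  by rewrite -powR_inv1 ?(ltW a0)// -powRrM mulN1r.
have -> : k `^ (5 / 2) = k * k `^ (3 / 2).
  have -> : 5 / 2 = 1 + 3 / 2 :> R by field.
  by rewrite powRD ?powRr1// gt_eqF.
by rewrite le_eqVlt; apply/orP; left; apply/eqP; ring.
Qed.

(** Within the cube of half-side [T] around [x], Young's inequality with weight
[a] separates the density from the kernel; beyond it the kernel is at most
[1 / T].  The parameters [a] and [T] are free so that the bound can also be made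
small, when [F] is small ([tail_potential]). *)
Lemma potential_bound : exists C : R -> R, forall f x (a T F N : R), density f ->
  0 < a -> 0 < T ->
  (\int[leb3]_y (f y `^ (5 / 3))%:E <= F%:E)%E -> (\int[leb3]_y (f y)%:E <= N%:E)%E ->
  (potential f x <= (a * F + a `^ (- (3 / 2)) * C T + N / T)%:E)%E.
Proof.
have [C CP] := sing_bound (R := R); exists C => f x a T F N [mf f0] a0 T0 fF fN.
pose h1 y := (a * f y `^ (5 / 3))%:E.
pose h2 y := (a `^ (- (3 / 2)) * (\1_(cube x T) y * sing (x - y)))%:E.
pose h3 y := (f y / T)%:E.
have mfp := measurable_density_powR (5 / 3) (conj mf f0).
have m2' : measurable_fun setT (fun y => \1_(cube x T) y * sing (x - y)).
  apply: measurable_funM; last exact: measurable_sing.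
  by apply: measurable_indic; exact: measurable_cube.
have m1 : measurable_fun setT h1 by apply/measurable_EFinP; exact: measurable_funM.
have m2 : measurable_fun setT h2 by apply/measurable_EFinP; exact: measurable_funM.
have m3 : measurable_fun setT h3 by apply/measurable_EFinP; exact: measurable_funM.
have s0 y : 0 <= sing (x - y) by exact: powR_ge0.
have h10 y : (0 <= h1 y)%E by rewrite lee_fin; pos.
have h20 y : (0 <= h2 y)%E by rewrite lee_fin; pos.
have h30 y : (0 <= h3 y)%E by rewrite lee_fin; pos.
have -> : (a * F + a `^ (- (3 / 2)) * C T + N / T)%:E =
  (a%:E * F%:E + (a `^ (- (3 / 2)))%:E * (C T)%:E + N%:E * (T^-1)%:E)%E by [].
apply: (@le_trans _ _ (\int[leb3]_y (h1 y + h2 y + h3 y))%E).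
  apply: ge0_le_integral => //.
  - by move=> y _; rewrite lee_fin divr_ge0 ?norm3_ge0.
  - by apply: measurable_potential_integrand; split.
  - by apply: emeasurable_funD => //; exact: emeasurable_funD.
  move=> y _; have [yc|yc] := pselect (cube x T y).
    apply: (@le_trans _ _ (h1 y + h2 y)%E); last by rewrite leeDl.
    rewrite /h1 /h2 indicE mem_set// mul1r -EFinD lee_fin.
    by apply: young_potential => //; rewrite invr_ge0 norm3_ge0.
  apply: (@le_trans _ _ (h3 y)); last by rewrite leeDr// adde_ge0.
  rewrite lee_fin ler_wpM2l// lef_pV2 ?posrE//; first exact: notin_cube.
  exact: lt_le_trans (notin_cube yc).
rewrite ge0_integralD//; last 2 first.
- by move=> y _; rewrite adde_ge0.
- exact: emeasurable_funD.
rewrite ge0_integralD//; apply: leeD; first apply: leeD.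
- under eq_integral do rewrite /h1 EFinM.
  rewrite ge0_integralZl_EFin ?(ltW a0)//.
  - by rewrite lee_wpmul2l// lee_fin ltW.
  - by move=> y _; rewrite lee_fin powR_ge0.
  - by apply/measurable_EFinP.
- under eq_integral do rewrite /h2 EFinM.
  rewrite ge0_integralZl_EFin ?powR_ge0//.
  - rewrite lee_wpmul2l// ?lee_fin ?powR_ge0//.
    apply: le_trans (CP x T T0); rewrite [leRHS]integral_mkcond le_eqVlt; apply/orP; left; apply/eqP.
    apply: eq_integral => y _; rewrite patchE indicE; case: ifPn => _; first by rewrite mul1r.
    by rewrite mul0r.
  - by move=> y _; rewrite lee_fin; pos.
  - by apply/measurable_EFinP.
- under eq_integral do rewrite /h3 EFinM.
  rewrite ge0_integralZr//.
  - by rewrite lee_wpmul2r// lee_fin invr_ge0 ltW.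
  - by apply/measurable_EFinP.
  - by move=> y _; rewrite lee_fin.
  - by rewrite lee_fin invr_ge0 ltW.
Qed.

Lemma Lfun_densityP f (p : R) : 0 < p -> density f ->
  (f \in Lfun leb3 p%:E) <-> (\int[leb3]_x (f x `^ p)%:E < +oo)%E.
Proof.
move=> p0 [mf f0].
have E : (\int[leb3]_x (f x `^ p)%:E = 'N[leb3]_(p%:E)[EFin \o f] `^ p)%E.
  have pn0 : p != 0 by rewrite gt_eqF.
  rewrite (poweR_Lnorm _ _ pn0); apply: eq_integral => x _ /=.
  by rewrite ger0_norm.
rewrite E; split.
  by rewrite inE => /andP[_]; rewrite inE /= => h; exact: poweR_lty.
move=> h; rewrite inE; apply/andP; split; rewrite inE//.
by apply: lty_poweRy h; rewrite gt_eqF.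
Qed.

Lemma Lfun_density f (p : R) : (f \in Lfun leb3 p%:E) -> (forall x, 0 <= f x) -> density f.
Proof. by rewrite inE => /andP[]; rewrite inE. Qed.

Lemma mass_powR1 f : density f ->
  (\int[leb3]_x (f x `^ 1)%:E = \int[leb3]_x (f x)%:E)%E.
Proof. by move=> [_ f0]; apply: eq_integral => x _; rewrite powRr1. Qed.

Lemma nonneg_L1LpP f (p : R) : 0 < p ->
  nonneg_L1Lp p f <->
  [/\ density f, (\int[leb3]_x (f x)%:E < +oo)%E & (\int[leb3]_x (f x `^ p)%:E < +oo)%E].
Proof.
move=> p0; split=> [[f0 f1 fp]|[df f1 fp]].
  have df := Lfun_density f1 f0; split => //; last exact/(Lfun_densityP p0).
  by rewrite -mass_powR1//; exact/(Lfun_densityP ltr01).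
split; [exact: df.2| |exact/(Lfun_densityP p0)].
by apply: (Lfun_densityP ltr01 df).2; rewrite (mass_powR1 df).
Qed.

(** The Hardy-Littlewood-Sobolev bound, in terms of upper bounds of the two
integrals: no case distinction on infinite values is needed to apply it. *)
Definition hls (H : R) := forall f (A N : R), density f ->
    (\int[leb3]_x (f x)%:E <= N%:E)%E ->
    (\int[leb3]_x (f x `^ (4 / 3))%:E <= A%:E)%E ->
    (B f f <= (H * A * N `^ (2 / 3))%:E)%E.

(** The inequality that defines N_* is the Hardy-Littlewood-Sobolev bound with a
particular constant. *)
Lemma hls_of_coulomb_inequality (kappa q M : R) : 0 < kappa -> 0 < q -> 0 < M ->
  coulomb_inequality kappa q M ->
  exists2 H : R, 0 < H & hls H.
Proof.
move=> k0 q0 M0 ineq.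
have K0 : 0 < K_cl q by rewrite /K_cl; pos.
exists (2 * K_cl q / (kappa * M `^ (2 / 3))); first by pos.
move=> f A N df fN fA.
have := ineq f; rewrite nonneg_L1LpP//.
have f1 : (\int[leb3]_x (f x)%:E < +oo)%E by apply: le_lt_trans fN _; rewrite ltry.
have f43 : (\int[leb3]_x (f x `^ (4 / 3))%:E < +oo)%E by apply: le_lt_trans fA _; rewrite ltry.
move=> /(_ (And3 df f1 f43)).
rewrite poweR_Lnorm// Lnorm1 coulombE.
have -> : (\int[leb3]_x `|(EFin \o f) x| `^ (4 / 3) = \int[leb3]_x (f x `^ (4 / 3))%:E)%E.
  by apply: eq_integral => x _ /=; rewrite ger0_norm ?df.2.
have -> : (\int[leb3]_x `|(EFin \o f) x| = \int[leb3]_x (f x)%:E)%E.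
  by apply: eq_integral => x _ /=; rewrite ger0_norm ?df.2.
have f10 : (0 <= \int[leb3]_x (f x)%:E)%E by apply: integral_ge0 => x _; rewrite lee_fin df.2.
have f430 : (0 <= \int[leb3]_x (f x `^ (4 / 3))%:E)%E by apply: integral_ge0 => x _; rewrite lee_fin powR_ge0.
move: f1 f10 fN f43 f430 fA.
case: (\int[leb3]_x (f x)%:E)%E => [a| |] //= _ a0 aN.
case: (\int[leb3]_x (f x `^ (4 / 3))%:E)%E => [b| |] //= _ b0 bA.
have c0 : 0 < kappa * M `^ (2 / 3) by pos.
move: (coulomb_form_ge0 df df); case: (B f f) => [x| |] //= x0; last first.
  by rewrite (gt0_muley (x := (1 / 2)%:E)) ?lte_fin// gt0_muley ?lte_fin.
rewrite !lee_fin in a0 aN b0 bA x0 * => h.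
have Nx : a `^ (2 / 3) <= N `^ (2 / 3) by exact: le_powR.
have -> : 2 * K_cl q / (kappa * M `^ (2 / 3)) * A * N `^ (2 / 3) =
   2 * (K_cl q * A * N `^ (2 / 3)) / (kappa * M `^ (2 / 3)) by field; rewrite !gt_eqF// powR_gt0.
rewrite ler_pdivlMr//.
have : K_cl q * b * a `^ (2 / 3) <= K_cl q * A * N `^ (2 / 3).
  apply: ler_pM => //; [by pos|exact: powR_ge0|].
  by apply: ler_wpM2l => //; exact: ltW.
move: h; lra.
Qed.

End coulomb_form.

(** * Pointwise decay and the gain from adding mass far away *)

Section apriori.
Context {R : realType}.
Implicit Types (f g : R3 R -> R) (j : R -> \bar R).

Local Notation B := coulomb_form.

(** Substituting [s = u ^ 3] turns inequalities between the powers 1, 4/3 and 5/3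
into polynomial ones. *)
Lemma cube_root (s : R) : 0 <= s -> exists u : R,
  [/\ 0 <= u, s = u ^+ 3, s `^ (4 / 3) = u ^+ 4 & s `^ (5 / 3) = u ^+ 5].
Proof.
move=> s0; exists (s `^ (1 / 3)); split; rewrite ?powR_ge0// -powR_mulrn ?powR_ge0// -powRrM.
- by rewrite (_ : 1 / 3 * 3 = 1) ?powRr1//; field.
- by congr (_ `^ _); field.
- by congr (_ `^ _); field.
Qed.

Lemma powR43_le (s : R) : 0 <= s -> s `^ (4 / 3) <= s + s `^ (5 / 3).
Proof.
move=> /cube_root[u [u0 -> -> ->]].
have -> : u ^+ 3 + u ^+ 5 = u ^+ 3 * (1 + u ^+ 2) by ring.
have -> : u ^+ 4 = u ^+ 3 * u by ring.
apply: ler_wpM2l; first exact: exprn_ge0.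
have := sqr_ge0 (u - 1); rewrite sqrrB1; have := sqr_ge0 u; lra.
Qed.

Lemma powR53_le (c s : R) : 0 <= c -> 0 <= s -> s <= c ^+ 3 ->
  s `^ (5 / 3) <= c * s `^ (4 / 3).
Proof.
move=> c0 /cube_root[u [u0 -> -> ->]].
rewrite ler_pXn2r ?nnegrE// => uc.
have -> : u ^+ 5 = u * u ^+ 4 by ring.
by apply: ler_wpM2r => //; exact: exprn_ge0.
Qed.

Lemma powR53_ge (c s : R) : 0 <= c -> 0 <= s -> c ^+ 3 <= s ->
  c * s `^ (4 / 3) <= s `^ (5 / 3) /\ c * s <= s `^ (4 / 3).
Proof.
move=> c0 /cube_root[u [u0 -> -> ->]].
rewrite ler_pXn2r ?nnegrE// => uc.
have -> : u ^+ 5 = u * u ^+ 4 by ring.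
have -> : u ^+ 4 = u * u ^+ 3 by ring.
by split; apply: ler_wpM2r => //; pos.
Qed.

(** In the variable [u] of [cube_root] this is [2 b u <= u ^ 2 + b ^ 2].  The
Coulomb energy, controlled by the power 4/3, is thereby paid for by kinetic
energy and mass. *)
Lemma powR43_absorb (b c s : R) : 0 <= b -> b <= c -> 0 <= s ->
  b * s `^ (4 / 3) <= Num.min (s `^ (5 / 3)) (c * s `^ (4 / 3)) + b ^+ 2 * s.
Proof.
move=> b0 bc s0; have [_|_] := leP (s `^ (5 / 3)) (c * s `^ (4 / 3)); last first.
  rewrite -[leLHS]addr0; apply: lerD; last by pos.
  by apply: ler_wpM2r => //; exact: powR_ge0.
have [u [u0 -> -> ->]] := cube_root s0.
have -> : u ^+ 5 + b ^+ 2 * u ^+ 3 = u ^+ 3 * (u ^+ 2 + b ^+ 2) by ring.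
have -> : b * u ^+ 4 = u ^+ 3 * (b * u) by ring.
apply: ler_wpM2l; first exact: exprn_ge0.
have := sqr_ge0 (u - b); rewrite sqrrB; have := mulr_ge0 b0 u0.
have -> : u * b *+ 2 = 2 * (b * u) by ring.
lra.
Qed.

(** The value of [f] at [x] is a lower bound of [f] on a cube of volume
[(norm3 x) ^ 3 / 64] that lies within the ball of radius [norm3 x] and avoids
the origin, where [f] is not assumed monotone. *)
Lemma symmetric_decreasing_decay f (p M : R) : 0 < p -> density f ->
  symmetric_decreasing f -> (\int[leb3]_x (f x `^ p)%:E <= M%:E)%E ->
  forall x, 0 < norm3 x -> f x `^ p * norm3 x ^+ 3 <= 64 * M.
Proof.
move=> p0 df [_ dec] fM x x0; set r := norm3 x in x0 *.
pose c : R3 R := (r / 4, r / 4, r / 4).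
suff : ((f x `^ p * (2 * (r / 8)) ^+ 3)%:E <= M%:E)%E.
  rewrite lee_fin; have -> : f x `^ p * (2 * (r / 8)) ^+ 3 = (f x `^ p * r ^+ 3) / 64 by field.
  by rewrite ler_pdivrMr// [M * 64]mulrC.
rewrite -(integral_cube c) ?powR_ge0//; last by pos.
apply: le_trans fM; apply: ge0_le_integral => //.
- by move=> y _; rewrite lee_fin; pos.
- apply/measurable_EFinP; apply: measurable_funM => //; apply: measurable_indic.
  exact: measurable_cube.
- by apply/measurable_EFinP; exact: measurable_density_powR.
move=> y _; rewrite indicE; case: (boolP (y \in _)) => [|_]; last first.
  by rewrite mulr0 lee_fin powR_ge0.
rewrite inE mulr1 lee_fin /cube /c /= !ler_distl => -[/andP[l1 u1] /andP[l2 u2] /andP[l3 u3]].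
apply: le_powR; [exact: ltW|exact: df.2|apply: dec].
  have [+ _ _] := norm3_coord y; apply: lt_le_trans.
  by rewrite gtr0_norm; lra.
have h (a : R) : r / 4 - r / 8 <= a -> a <= r / 4 + r / 8 -> `|a| <= 3 / 8 * r.
  by move=> al au; rewrite ger0_norm; lra.
apply: (le_trans (norm3_le_coord (h _ l1 u1) (h _ l2 u2) (h _ l3 u3))).
by rewrite -/r; lra.
Qed.

Lemma ae_neq (x : R3 R) : {ae leb3, forall y, y <> x}.
Proof.
exists (cube x 0); split; first exact: measurable_cube.
  by rewrite leb3_cube// mulr0 expr0n.
move=> y /= /contrapT ->; split; rewrite subrr normr0//.
Qed.

(** Two points of a cube of half-side [r] are at distance at most [4 r]. *)
Lemma coulomb_form_cube_lower c (r e : R) : 0 < r -> 0 <= e ->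
  (((e * (2 * r) ^+ 3) ^+ 2 / (4 * r))%:E <= B (fun x => (e * \1_(cube c r) x)%R) (fun x => (e * \1_(cube c r) x)%R))%E.
Proof.
move=> r0 e0; set t := fun x => (e * \1_(cube c r) x)%R.
have dt : density t.
  split; last by move=> x; rewrite mulr_ge0.
  by apply: measurable_funM => //; apply: measurable_indic; exact: measurable_cube.
set D := (e * (2 * r) ^+ 3)%R.
have D0 : 0 <= D by rewrite /D; pos.
have low x : cube c r x -> ((D / (4 * r))%:E <= potential t x)%E.
  move=> cx.
  have -> : (D / (4 * r))%R = ((4 * r)^-1 * e) * (2 * r) ^+ 3 by rewrite /D; ring.
  rewrite -(integral_cube c); [|exact: ltW|by pos].
  apply: ae_ge0_le_integral => //.
  - by move=> y _; rewrite lee_fin; pos.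
  - apply/measurable_EFinP; apply: measurable_funM => //; apply: measurable_indic.
    exact: measurable_cube.
  - by move=> y _; rewrite lee_fin divr_ge0 ?norm3_ge0 ?dt.2.
  - exact: measurable_potential_integrand.
  apply: filterS (ae_neq x) => y yx _; rewrite /t indicE.
  case: (boolP (y \in _)) => [|_]; last by rewrite !mulr0 mul0r.
  rewrite inE => cy; rewrite !mulr1 lee_fin mulrC ler_wpM2l// lef_pV2 ?posrE; last 2 first.
  - by pos.
  - rewrite lt_neqAle norm3_ge0 andbT eq_sym; apply/eqP => /norm3_eq0 /eqP.
    by rewrite subr_eq0 => /eqP xy; apply: yx.
  have h (a b d : R) : `|a - d| <= r -> `|b - d| <= r -> `|a - b| <= 2 * r.
    move=> h1 h2; have -> : a - b = (a - d) - (b - d) by ring.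
    by apply: le_trans (ler_normB _ _) _; lra.
  have [cx1 cx2 cx3] := cx; have [cy1 cy2 cy3] := cy.
  have := @norm3_le_coord _ (x - y) _ (h _ _ _ cx1 cy1) (h _ _ _ cx2 cy2) (h _ _ _ cx3 cy3).
  by move=> /le_trans; apply; lra.
rewrite coulomb_formE//.
have -> : (D ^+ 2 / (4 * r))%R = (D / (4 * r) * e) * (2 * r) ^+ 3 by rewrite /D; ring.
rewrite -(integral_cube c); [|exact: ltW|by pos].
have pg0 x : (0 <= potential t x)%E.
  by apply: integral_ge0 => y _; rewrite lee_fin divr_ge0 ?dt.2 ?norm3_ge0.
apply: ge0_le_integral; first exact: measurableT.
- by move=> y _; rewrite lee_fin; pos.
- apply/measurable_EFinP; apply: measurable_funM => //; apply: measurable_indic.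
  exact: measurable_cube.
- apply: emeasurable_funM; last exact: measurable_potential.
  by apply/measurable_EFinP; exact: dt.1.
move=> x _; rewrite /t indicE; case: (boolP (x \in _)) => [|_]; last first.
  by rewrite !mulr0 mul0e.
rewrite inE !mulr1 => /low h; rewrite mulrC EFinM.
by apply: lee_wpmul2l; [rewrite lee_fin|exact: h].
Qed.

Lemma energy_lt (kappa k e1 e2 b : R) (K' B' : \bar R) : 0 < kappa ->
  (K' <= (k + e1)%:E)%E -> ((b + e2)%:E <= B')%E -> 2 * e1 < kappa * e2 ->
  (K' - kappa%:E * ((1 / 2)%:E * B') < k%:E - kappa%:E * ((1 / 2)%:E * b%:E))%E.
Proof.
move=> k0; case: K' => [k'| |] //; case: B' => [b'| |] //.
- rewrite !lee_fin => h1 h2 h3; rewrite -!EFinM -!EFinN -!EFinD lte_fin.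
  have : kappa * (b + e2) <= kappa * b' by rewrite ler_pM2l.
  by lra.
- move=> _ _ _; rewrite gt0_muley ?lte_fin// gt0_muley ?lte_fin//=.
  by rewrite ltNyr.
- by move=> _ _ _; rewrite -!EFinM -!EFinN -EFinD /= ltNyr.
- move=> _ _ _; rewrite gt0_muley ?lte_fin// gt0_muley ?lte_fin//=.
  by rewrite ltNyr.
Qed.

Lemma measurable_comp_density j f : measurable_fun setT j -> density f ->
  measurable_fun setT (j \o f).
Proof. by move=> mj [mf _]; exact: measurableT_comp. Qed.

(** The missing mass [N - N'] is spread uniformly on a cube of side [L] at
distance [L] from the origin.  There the density stays of order [L ^ -3], so the
kinetic cost is of order [(L ^ -3) ^ (5/3) * L ^ 3 = L ^ -2], whereas the self-energy of
the added mass lowers the total energy by an amount of order [1 / L], which wins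
for large [L].  The lemma prevents the loss of mass in the limit, and it also
serves to compare a minimizer with its truncations. *)
Lemma lower_energy_by_adding_mass j f (kappa C G N N' : R) :
  measurable_fun setT j -> (forall s, 0 <= j s)%E -> 0 <= C ->
  (forall s, 0 <= s -> (j s <= (C * s `^ (5 / 3))%:E)%E) -> 0 < kappa -> 0 <= G ->
  density f -> (forall x, 0 < norm3 x -> f x * norm3 x ^+ 3 <= G) ->
  (\int[leb3]_x (f x)%:E = N'%:E)%E -> N' < N ->
  (\int[leb3]_x (f x `^ (5 / 3))%:E < +oo)%E -> (B f f < +oo)%E ->
  exists g, [/\ density g, (\int[leb3]_x (g x)%:E = N%:E)%E,
     (\int[leb3]_x (g x `^ (5 / 3))%:E < +oo)%E
     & (energy kappa j g < energy kappa j f)%E].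
Proof.
move=> mj j0 C0 jC kap0 G0 df fG fN' N'N f53 Bf.
pose del := N - N'; have del0 : 0 < del by rewrite subr_gt0.
pose S := C * (G + del) `^ (5 / 3).
have S0 : 0 <= S by rewrite /S; pos.
(* S / L^2 bounds the kinetic cost, and del^2 / (2 L) is a lower bound of the
   self-energy of the added mass; L makes the second outweigh the first. *)
pose L := 4 * S / (kappa * del ^+ 2) + 1.
have L0 : 0 < L by rewrite /L ltr_wpDl//; pos.
have SL : 2 * (S / L ^+ 2) < kappa * (del ^+ 2 / (2 * L)).
  have : 4 * S < kappa * del ^+ 2 * L.
    rewrite [ltRHS]mulrC -ltr_pdivrMr; last by pos.
    by rewrite /L ltrDl.
  have -> : 2 * (S / L ^+ 2) = (4 * S) / (2 * L ^+ 2) by field; rewrite gt_eqF.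
  have -> : kappa * (del ^+ 2 / (2 * L)) = (kappa * del ^+ 2 * L) / (2 * L ^+ 2).
    by field; rewrite gt_eqF.
  by rewrite ltr_pM2r// invr_gt0; pos.
pose c : R3 R := (3 / 2 * L, 3 / 2 * L, 3 / 2 * L).
pose Q := cube c (L / 2); pose eps := del / L ^+ 3.
have eps0 : 0 < eps by rewrite /eps; pos.
pose t x := eps * \1_Q x.
have mQ : measurable_fun setT (\1_Q : R3 R -> R).
  by apply: measurable_indic; exact: measurable_cube.
have dt : density t.
  split; first exact: measurable_funM.
  by move=> x; rewrite /t; pos.
have dg := densityD df dt.
pose p := ((G + del) / L ^+ 3) `^ (5 / 3).
have p0 : 0 <= p by exact: powR_ge0.
have pE : C * p * L ^+ 3 = S / L ^+ 2.
  rewrite /p powRM; [|by pos|by pos].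
  have -> : (L ^+ 3)^-1 `^ (5 / 3) = L ^- 5.
    rewrite -!exprVn -[X in X `^ _]powR_mulrn; last by pos.
    rewrite -powRrM (_ : 3 * (5 / 3) = 5); last by field.
    by rewrite powR_mulrn//; pos.
  by rewrite /S; field; rewrite gt_eqF.
have gQ x : Q x -> (f x + t x) `^ (5 / 3) <= p.
  move=> Qx; apply: le_powR => //; first by rewrite addr_ge0 ?df.2 ?dt.2.
  have xL : L <= norm3 x.
    have [+ _ _] := norm3_coord x; apply: le_trans; apply: le_trans (ler_norm _).
    by case: Qx => + _ _; rewrite /c /= ler_distl => /andP[+ _]; lra.
  have x0 : 0 < norm3 x by exact: lt_le_trans xL.
  have -> : t x = del / L ^+ 3 by rewrite /t indicE mem_set// mulr1.
  rewrite [leRHS]mulrDl lerD2r ler_pdivlMr ?exprn_gt0//.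
  apply: le_trans (fG x x0); apply: ler_wpM2l; first exact: df.2.
  by rewrite ler_pXn2r ?nnegrE ?norm3_ge0// ltW.
have tN x : ~ Q x -> t x = 0 by move=> nQ; rewrite /t indicE memNset// mulr0.
have LQ : (2 * (L / 2)) ^+ 3 = L ^+ 3 by congr (_ ^+ _); field.
have L20 : 0 <= L / 2 by pos.
exists (f \+ t); split; [exact: dg| | |].
- under eq_integral do rewrite /= EFinD.
  rewrite ge0_integralD//; last 4 first.
  + by move=> x _; rewrite lee_fin df.2.
  + by apply/measurable_EFinP; exact: df.1.
  + by move=> x _; rewrite lee_fin dt.2.
  + by apply/measurable_EFinP; exact: dt.1.
  rewrite fN' (integral_cube c L20 (ltW eps0)) LQ -EFinD; congr EFin.
  by rewrite /eps /del; field; rewrite gt_eqF.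
- apply: (@le_lt_trans _ _ (\int[leb3]_x ((f x `^ (5 / 3))%:E + (p * \1_Q x)%:E))%E).
    apply: ge0_le_integral => //.
    + by move=> x _; rewrite lee_fin powR_ge0.
    + by apply/measurable_EFinP; exact: measurable_density_powR.
    + apply: emeasurable_funD; apply/measurable_EFinP.
        exact: measurable_density_powR.
      exact: measurable_funM.
    move=> x _; rewrite -EFinD lee_fin.
    have [Qx|nQ] := pselect (Q x).
      rewrite indicE mem_set// mulr1; apply: le_trans (gQ _ Qx) _.
      by rewrite lerDr powR_ge0.
    by rewrite /= tN// addr0 lerDl; pos.
  rewrite ge0_integralD//; last 4 first.
  + by move=> x _; rewrite lee_fin powR_ge0.
  + by apply/measurable_EFinP; exact: measurable_density_powR.
  + by move=> x _; rewrite lee_fin; pos.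
  + by apply/measurable_EFinP; exact: measurable_funM.
  by rewrite (integral_cube c L20 p0) lte_add_pinfty// ltry.
have kf : (\int[leb3]_x j (f x) < +oo)%E.
  apply: (@le_lt_trans _ _ (\int[leb3]_x (C%:E * (f x `^ (5 / 3))%:E))%E).
    apply: ge0_le_integral => //.
    - exact: measurable_comp_density.
    - apply/measurable_EFinP; apply: measurable_funM => //.
      exact: measurable_density_powR.
    - by move=> x _; rewrite -EFinM; apply: jC; exact: df.2.
  rewrite ge0_integralZl_EFin//.
  - by rewrite lte_mul_pinfty// lee_fin.
  - by move=> x _; rewrite lee_fin powR_ge0.
  - by apply/measurable_EFinP; exact: measurable_density_powR.
have kf0 : (0 <= \int[leb3]_x j (f x))%E by exact: integral_ge0.
have Bf0 := coulomb_form_ge0 df df.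
rewrite /energy !coulombE.
have kg : (\int[leb3]_x j (f x + t x)%R <= \int[leb3]_x j (f x) + (S / L ^+ 2)%:E)%E.
  apply: (@le_trans _ _ (\int[leb3]_x (j (f x) + (C * p * \1_Q x)%:E))%E).
    apply: ge0_le_integral => //.
    - exact: measurable_comp_density.
    - apply: emeasurable_funD; first exact: measurable_comp_density.
      by apply/measurable_EFinP; exact: measurable_funM.
    move=> x _; have [Qx|nQ] := pselect (Q x).
      apply: (@le_trans _ _ (C * p)%:E).
        apply: le_trans (jC _ _) _; first by rewrite addr_ge0 ?df.2 ?dt.2.
        by rewrite lee_fin ler_wpM2l// gQ.
      by rewrite indicE mem_set// mulr1 leeDr.
    by rewrite tN// addr0 leeDl// lee_fin; pos.
  rewrite ge0_integralD//; last 3 first.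
  - exact: measurable_comp_density.
  - by move=> x _; rewrite lee_fin; pos.
  - by apply/measurable_EFinP; exact: measurable_funM.
  rewrite (integral_cube c L20) ?LQ ?pE//; by pos.
have Bg : (B f f + (del ^+ 2 / (2 * L))%:E <= B (f \+ t)%R (f \+ t)%R)%E.
  have dft := densityD df dt.
  rewrite (coulomb_formDl df dt dft) (coulomb_formDr df df dt) (coulomb_formDr dt df dt).
  apply: leeD; first by apply: leeDl; exact: coulomb_form_ge0.
  have := @coulomb_form_cube_lower c (L / 2) eps _ (ltW eps0); rewrite LQ.
  have -> : (eps * L ^+ 3)%R = del by rewrite /eps; field; rewrite gt_eqF.
  have -> : (4 * (L / 2))%R = 2 * L by field.
  move=> h; apply: le_trans (h _) _; first by pos.
  by apply: leeDr; exact: coulomb_form_ge0.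
move: kf kf0 kg Bf Bf0 Bg.
case: (\int[leb3]_x j (f x))%E => [k| |] //; case: (B f f) => [b| |] // _ _ kg _ _ Bg.
exact: (energy_lt kap0 kg Bg SL).
Qed.

End apriori.

(** * Uniform bounds for the minimizers *)

Section apriori_bounds.
Context {R : realType}.
Implicit Types (f g : R3 R -> R) (j : R -> \bar R).

Local Notation B := coulomb_form.

Lemma L43_of_L53 f : density f -> (\int[leb3]_x (f x)%:E < +oo)%E ->
  (\int[leb3]_x (f x `^ (5 / 3))%:E < +oo)%E -> (\int[leb3]_x (f x `^ (4 / 3))%:E < +oo)%E.
Proof.
move=> df f1 f53.
have m1 : measurable_fun setT (fun x => (f x)%:E) by apply/measurable_EFinP; exact: df.1.
have m53 : measurable_fun setT (fun x => (f x `^ (5 / 3))%:E).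
  by apply/measurable_EFinP; exact: measurable_density_powR.
apply: (@le_lt_trans _ _ (\int[leb3]_x ((f x)%:E + (f x `^ (5 / 3))%:E))%E); last first.
  rewrite ge0_integralD//; first exact: lte_add_pinfty.
  - by move=> x _; rewrite lee_fin df.2.
  - by move=> x _; rewrite lee_fin powR_ge0.
apply: ge0_le_integral => //.
- by move=> x _; rewrite lee_fin powR_ge0.
- by apply/measurable_EFinP; exact: measurable_density_powR.
- exact: emeasurable_funD.
- by move=> x _; rewrite -EFinD lee_fin; apply: powR43_le; exact: df.2.
Qed.

Lemma admissibleP f (p N : R) : 0 < p -> admissible p N f <->
  [/\ density f, (\int[leb3]_x (f x)%:E = N%:E)%E & (\int[leb3]_x (f x `^ p)%:E < +oo)%E].
Proof.
move=> p0; split=> [[/(nonneg_L1LpP _ p0)[df _ fp] fN]|[df fN fp]] //.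
by split => //; apply/nonneg_L1LpP => //; split => //; rewrite fN ltry.
Qed.

Lemma admissible_L43 f (N : R) : density f -> (\int[leb3]_x (f x)%:E = N%:E)%E ->
  (\int[leb3]_x (f x `^ (5 / 3))%:E < +oo)%E -> admissible (4 / 3) N f.
Proof.
move=> df fN f53; have p43 : 0 < 4 / 3 :> R by rewrite divr_gt0.
apply: (admissibleP f N p43).2; split; [exact: df|exact: fN|].
by apply: (L43_of_L53 df _ f53); rewrite fN ltry.
Qed.

Lemma E_c_le (kappa q m c N : R) f : admissible (4 / 3) N f ->
  (E_c kappa q m c N <= energy_c kappa q m c f)%E.
Proof. by move=> af; apply: ereal_inf_lbound; exists f. Qed.

Lemma kinetic_integral_upper j f (C F : R) : measurable_fun setT j -> (forall s, 0 <= j s)%E ->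
  0 <= C -> (forall s, 0 <= s -> (j s <= (C * s `^ (5 / 3))%:E)%E) -> density f ->
  (\int[leb3]_x (f x `^ (5 / 3))%:E <= F%:E)%E -> (\int[leb3]_x j (f x) <= (C * F)%:E)%E.
Proof.
move=> mj j0 C0 jC df fF.
apply: (@le_trans _ _ (\int[leb3]_x (C%:E * (f x `^ (5 / 3))%:E))%E).
  apply: ge0_le_integral => //.
  - exact: measurable_comp_density.
  - apply/measurable_EFinP; apply: measurable_funM => //.
    exact: measurable_density_powR.
  - by move=> x _; rewrite -EFinM; apply: jC; exact: df.2.
rewrite ge0_integralZl_EFin//.
- by rewrite EFinM lee_wpmul2l// lee_fin.
- by move=> x _; rewrite lee_fin powR_ge0.
- by apply/measurable_EFinP; exact: measurable_density_powR.
Qed.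

(** The trial density is uniform on the unit cube; since [j_mc <= j_infty], its
energy is bounded independently of [c]. *)
Lemma E_c_upper (kappa q m N : R) : 0 < kappa -> 0 < q -> 0 < m -> 0 < N ->
  exists2 E0 : R, 0 <= E0 & forall c, 0 < c -> (E_c kappa q m c N <= E0%:E)%E.
Proof.
move=> kap0 q0 m0 N0; have [C C0 jC] := j_infty_upper q0 m0.
pose Q : set (R3 R) := cube 0 (1 / 2).
pose f x : R := N * \1_Q x.
have df : density f.
  split; last by move=> x; rewrite /f; pos.
  by apply: measurable_funM => //; apply: measurable_indic; exact: measurable_cube.
have r0 : 0 <= 1 / 2 :> R by [].
have r1 : (2 * (1 / 2)) ^+ 3 = 1 :> R by rewrite (_ : 2 * (1 / 2) = 1) ?expr1n//; field.
have fN : (\int[leb3]_x (f x)%:E = N%:E)%E.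
  by rewrite (integral_cube 0 r0 (ltW N0)) r1 mulr1.
have f53 : (\int[leb3]_x (f x `^ (5 / 3))%:E = (N `^ (5 / 3))%:E)%E.
  transitivity ((N `^ (5 / 3) * (2 * (1 / 2)) ^+ 3)%:E); last by rewrite r1 mulr1.
  have p0 : 0 <= N `^ (5 / 3) by exact: powR_ge0.
  rewrite -(integral_cube 0 r0 p0); apply: eq_integral => x _; rewrite /f indicE.
  case: (x \in _); first by rewrite !mulr1.
  by rewrite !mulr0 powR0// gt_eqF.
have af : admissible (4 / 3) N f by apply: admissible_L43 => //; rewrite f53 ltry.
exists (C * N `^ (5 / 3)); first by pos.
move=> c c0; apply: le_trans (E_c_le kappa q m c af) _.
have Bf := coulomb_form_ge0 df df.
apply: (@le_trans _ _ (\int[leb3]_x j_mc q m c (f x))%E).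
  rewrite /energy_c /energy geeDl// oppe_le0 coulombE mule_ge0//; first by rewrite lee_fin ltW.
  by rewrite mule_ge0.
apply: kinetic_integral_upper => //.
- exact: measurable_j_mc.
- by move=> s; exact: j_mc_ge0.
- exact: ltW.
- by move=> s s0; apply: le_trans (jC s s0); exact: j_mc_le_infty.
- by rewrite f53.
Qed.

Lemma minimizer_cP (kappa q m c N : R) f : minimizer_c kappa q m c N f ->
  [/\ density f, (\int[leb3]_x (f x)%:E = N%:E)%E,
     (\int[leb3]_x (f x `^ (4 / 3))%:E < +oo)%E &
     energy_c kappa q m c f = E_c kappa q m c N].
Proof. by move=> [/admissibleP[]// df fN f43 ef]. Qed.

(** With [b] such that [d * b = h + 1], where [h] bounds the Coulomb energy by
the integral of [f ^ (4/3)], [powR43_absorb] shows that the kinetic energy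
controls [h + 1] times that integral up to a constant.  The Coulomb energy uses
up [h] times it, so that a bound on the energy bounds what remains. *)
Lemma energy_bounds (kappa q m N H d E0 : R) : 0 < kappa -> 0 < q -> 0 < m -> 0 < N -> 0 < H ->
  hls H -> 0 < d -> 0 <= E0 ->
  (forall s, 0 <= s -> forall c, 0 < c ->
     ((d * Num.min (s `^ (5 / 3)) (c * s `^ (4 / 3)))%:E <= j_mc q m c s)%E) ->
  exists c0 A K : R, [/\ 0 < c0, 0 <= A, 0 <= K & forall c f, c0 <= c -> density f ->
    (\int[leb3]_x (f x)%:E = N%:E)%E -> (\int[leb3]_x (f x `^ (4 / 3))%:E < +oo)%E ->
    (energy_c kappa q m c f <= E0%:E)%E ->
    (\int[leb3]_x (f x `^ (4 / 3))%:E <= A%:E)%E /\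
    (\int[leb3]_x j_mc q m c (f x) <= K%:E)%E ].
Proof.
move=> kap0 q0 m0 N0 H0 HLS d0 E00 jd.
pose h := kappa * H * N `^ (2 / 3); have h0 : 0 < h by rewrite /h; pos.
pose b := (h + 1) / d; have b0 : 0 < b by rewrite /b; pos.
pose A := E0 + d * b ^+ 2 * N.
have A0 : 0 <= A by rewrite /A; pos.
exists b, A, (E0 + h * A); split => //; first by pos.
move=> c f bc df fN f43 fE.
have c0 : 0 < c by exact: lt_le_trans bc.
have mf43 := measurable_density_powR (4 / 3) df.
have f430 : (0 <= \int[leb3]_x (f x `^ (4 / 3))%:E)%E.
  by apply: integral_ge0 => x _; rewrite lee_fin powR_ge0.
have mj : measurable_fun setT (fun x => j_mc q m c (f x)).
  by apply: measurable_comp_density => //; exact: measurable_j_mc.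
have jge0 x : (0 <= j_mc q m c (f x))%E by exact: j_mc_ge0.
have K0 : (0 <= \int[leb3]_x j_mc q m c (f x))%E by exact: integral_ge0.
have main : ((d * b)%:E * \int[leb3]_x (f x `^ (4 / 3))%:E <=
   \int[leb3]_x j_mc q m c (f x) + (d * b ^+ 2)%:E * N%:E)%E.
  have db0 : 0 <= d * b ^+ 2 by pos.
  rewrite -ge0_integralZl_EFin//; last 3 first.
  - by move=> x _; rewrite lee_fin powR_ge0.
  - by apply/measurable_EFinP.
  - by pos.
  rewrite -fN -ge0_integralZl_EFin//; last 2 first.
  - by move=> x _; rewrite lee_fin df.2.
  - by apply/measurable_EFinP; exact: df.1.
  rewrite -ge0_integralD//; last 2 first.
  - by move=> x _; rewrite -EFinM lee_fin mulr_ge0 ?df.2.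
  - by apply/measurable_EFinP; apply: measurable_funM => //; exact: df.1.
  apply: ge0_le_integral; first exact: measurableT.
  - by move=> x _; rewrite -EFinM lee_fin; pos.
  - by apply/measurable_EFinP; exact: measurable_funM.
  - apply: emeasurable_funD => //.
    by apply/measurable_EFinP; apply: measurable_funM => //; exact: df.1.
  move=> x _; have fx0 := df.2 x.
  apply: le_trans (leeD (jd _ fx0 _ c0) (lexx _)); rewrite -!EFinM -EFinD lee_fin.
  have := powR43_absorb (ltW b0) bc fx0.
  by rewrite -(ler_pM2l d0) mulrDr !mulrA.
move: f43 f430 main (HLS f) => +++/(_ _ N df); rewrite fN => + + + /(_ _ (lexx _)).
case: (\int[leb3]_x (f x `^ (4 / 3))%:E)%E => [a| |] //= _ a0 main /(_ a (lexx _)).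
have Bf := coulomb_form_ge0 df df.
move: fE K0 main Bf; rewrite /energy_c /energy coulombE.
case: (\int[leb3]_x j_mc q m c (f x))%E => [k| |] //; case: (B f f) => [x| |] //.
rewrite !lee_fin => fE k0 main x0 xa.
have dbE : d * b = h + 1 by rewrite /b; field; rewrite gt_eqF.
have xh : kappa * x <= h * a.
  by rewrite /h -!mulrA ler_pM2l// mulrA mulrAC.
have kx0 : 0 <= kappa * x by pos.
have ha0 : 0 <= h * a by pos.
have aA : a <= A.
  move: main; rewrite dbE /A => main.
  have : (h + 1) * a <= E0 + h * a + d * b ^+ 2 * N by lra.
  lra.
split => //.
have : h * a <= h * A by rewrite ler_pM2l.
lra.
Qed.

Lemma lee_add3 (x y z w : \bar R) :
  (0 <= y -> 0 <= z -> 0 <= w -> x <= x + y + (z + w))%E.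
Proof. by move=> y0 z0 w0; rewrite -addeA leeDl// !adde_ge0. Qed.

(** The balance of energies for [density_threshold], with [K] for kinetic
energies, [s] and [u] for the parts of the density below and above the
threshold, [del] for the mass of [u] and [a] for the integral of its power 4/3.
The kinetic energy of [u] is at least [d * c * a], while its Coulomb energy,
including the interaction with [s], is at most of order [a]. *)
Lemma truncation_gain (kappa d c H N W a del : R) (Ks Ku Bss Bus Buu : \bar R) :
  0 < kappa -> 0 < d -> 1 <= c -> 0 <= W -> 0 < del -> c * del <= a ->
  d + kappa * H * N `^ (2 / 3) + 2 * kappa * W <= d * c ->
  (0 <= Ks)%E -> (Ks < +oo)%E -> ((d * c * a)%:E <= Ku)%E -> (Ku < +oo)%E ->
  (0 <= Bss)%E -> (Bss < +oo)%E -> (0 <= Bus)%E -> (Bus <= (del * W)%:E)%E ->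
  (0 <= Buu)%E -> (Buu <= (H * a * N `^ (2 / 3))%:E)%E ->
  (Ks + Ku - kappa%:E * ((1 / 2)%:E * (Bss + Bus + (Bus + Buu))) <
   Ks - kappa%:E * ((1 / 2)%:E * Bss))%E -> False.
Proof.
move=> kap0 d0 c1 W0 del0 dela; move: (N `^ (2 / 3)) => P cbig.
case: Ks => [ks| |] //; case: Ku => [ku| |] //; case: Bss => [bss| |] //.
case: Bus => [bus| |] //; case: Buu => [buu| |] // _ _ hku _ _ _ _ hbus hbuu0 hbuu.
rewrite -?EFinD -?EFinM -?EFinN -?EFinD lte_fin => Elt.
rewrite !lee_fin in hku hbus hbuu0 hbuu.
have a0 : 0 < a by apply: lt_le_trans dela; rewrite mulr_gt0//; lra.
have dela' : del <= a by apply: le_trans dela; rewrite ler_peMl// ltW.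
have e1 : kappa * bus <= kappa * W * a.
  rewrite -mulrA ler_pM2l//; apply: (le_trans hbus); rewrite mulrC.
  by apply: ler_wpM2l.
have e2 : kappa * buu <= kappa * H * P * a.
  by rewrite -!mulrA ler_pM2l// [P * a]mulrC mulrA.
have e3 : (d + kappa * H * P + 2 * kappa * W) * a <= d * c * a.
  by apply: ler_wpM2r => //; exact: ltW.
have e5 : 0 < d * a by rewrite mulr_gt0.
have e6 : 0 <= kappa * W * a by rewrite !mulr_ge0// ltW.
have e7 : 0 <= kappa * buu by rewrite mulr_ge0// ltW.
lra.
Qed.

(** A minimizer has no mass where it exceeds [c ^ 3].  Split [f = s + u] at this
threshold.  Since the lower bound on [j] is [d s ^ (5/3)] below the threshold,
[s] is bounded in L^(5/3) and its potential is bounded by [W].  If [u] carried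
mass, discarding it would lower the energy for large [c] ([truncation_gain]),
and restoring its mass far away would lower it further
([lower_energy_by_adding_mass]), against minimality.  This plays the role of
the Euler-Lagrange equation in giving an L^(5/3) bound. *)
Lemma density_threshold j f (kappa C d c H N A K W : R) :
  measurable_fun setT j -> (forall s, 0 <= j s)%E -> j 0 = 0%E -> 0 <= C ->
  (forall s, 0 <= s -> (j s <= (C * s `^ (5 / 3))%:E)%E) ->
  (forall s, 0 <= s ->
     ((d * Num.min (s `^ (5 / 3)) (c * s `^ (4 / 3)))%:E <= j s)%E) ->
  0 < kappa -> 0 < d -> 0 <= N -> hls H ->
  (forall g x, density g -> (\int[leb3]_x (g x)%:E <= N%:E)%E ->
    (\int[leb3]_x (g x `^ (5 / 3))%:E <= (K / d)%:E)%E -> (potential g x <= W%:E)%E) ->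
  0 <= W -> 0 <= H -> 1 <= c ->
  d + kappa * H * N `^ (2 / 3) + 2 * kappa * W <= d * c ->
  density f -> symmetric_decreasing f -> (\int[leb3]_x (f x)%:E = N%:E)%E ->
  (\int[leb3]_x (f x `^ (4 / 3))%:E <= A%:E)%E -> (\int[leb3]_x j (f x) <= K%:E)%E ->
  (forall g, admissible (4 / 3) N g -> (energy kappa j f <= energy kappa j g)%E) ->
  (\int[leb3]_x (f x `^ (5 / 3))%:E <= (K / d)%:E)%E /\
  {ae leb3, forall x, ((d * f x `^ (5 / 3))%:E <= j (f x))%E}.
Proof.
move=> mj jge0 j0 C0 jC jd kap0 d0 N0 HLS pot W0 H0 c_ge1 cbig df symf fN fA fK minf.
have c_gt0 : 0 < c by lra.
pose P x := f x <= c ^+ 3.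
pose s x := if P x then f x else 0.
pose u x := if P x then 0 else f x.
have mP : measurable_fun setT P by apply: measurable_fun_ler => //; exact: df.1.
have ds : density s.
  split; first by apply: measurable_fun_ifT => //; exact: df.1.
  by move=> x; rewrite /s; case: ifP => // _; exact: df.2.
have du : density u.
  split; first by apply: measurable_fun_ifT => //; exact: df.1.
  by move=> x; rewrite /u; case: ifP => // _; exact: df.2.
have fsu : f = s \+ u.
  by apply/funext => x; rewrite /s /u /=; case: ifP => _; rewrite ?addr0 ?add0r.
have sf x : s x <= f x by rewrite /s; case: ifP => // _; exact: df.2.
have uf x : u x <= f x by rewrite /u; case: ifP => // _; exact: df.2.
have jsu x : j (f x) = (j (s x) + j (u x))%E.
  by rewrite /s /u; case: ifP => _; rewrite j0 ?adde0 ?add0e.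
have Ksu : (\int[leb3]_x j (f x) = \int[leb3]_x j (s x) + \int[leb3]_x j (u x))%E.
  transitivity (\int[leb3]_x (j (s x) + j (u x)))%E.
    by apply: eq_integral => x _; exact: jsu.
  by rewrite ge0_integralD//; exact: measurable_comp_density.
have Ks0 : (0 <= \int[leb3]_x j (s x))%E by exact: integral_ge0.
have Ku0 : (0 <= \int[leb3]_x j (u x))%E by exact: integral_ge0.
have Ks : (\int[leb3]_x j (s x) <= K%:E)%E.
  by apply: le_trans fK; rewrite Ksu; apply: leeDl.
have js x : ((d * s x `^ (5 / 3))%:E <= j (s x))%E.
  apply: le_trans (jd _ (ds.2 x)); rewrite lee_fin ler_pM2l// le_min lexx/=.
  apply: powR53_le; [exact: ltW|exact: ds.2|].
  by rewrite /s; case: ifP => // _; pos.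
have s53 : (\int[leb3]_x (s x `^ (5 / 3))%:E <= (K / d)%:E)%E.
  have : (d%:E * \int[leb3]_x (s x `^ (5 / 3))%:E <= K%:E)%E.
    rewrite -ge0_integralZl_EFin//; last 3 first.
    - by move=> x _; rewrite lee_fin powR_ge0.
    - by apply/measurable_EFinP; exact: measurable_density_powR.
    - exact: ltW.
    apply: le_trans Ks; apply: ge0_le_integral => //.
    - by move=> x _; rewrite -EFinM lee_fin; pos.
    - by apply/measurable_EFinP; apply: measurable_funM => //; exact: measurable_density_powR.
    - exact: measurable_comp_density.
    - by move=> x _; rewrite -EFinM; exact: js.
  have -> : (K / d)%:E = ((d^-1)%:E * K%:E)%E by rewrite -EFinM mulrC.
  by rewrite lee_pdivlMl.
have mass g : density g -> (forall x, g x <= f x) -> exists2 a : R, 0 <= a <= N &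
    (\int[leb3]_x (g x)%:E = a%:E)%E.
  move=> dg gf.
  have : (\int[leb3]_x (g x)%:E <= N%:E)%E.
    rewrite -fN; apply: ge0_le_integral => //.
    - by move=> x _; rewrite lee_fin dg.2.
    - by apply/measurable_EFinP; exact: dg.1.
    - by apply/measurable_EFinP; exact: df.1.
    - by move=> x _; rewrite lee_fin.
  have : (0 <= \int[leb3]_x (g x)%:E)%E by apply: integral_ge0 => x _; rewrite lee_fin dg.2.
  case: (\int[leb3]_x (g x)%:E)%E => [a| |] // a0 aN.
  by exists a => //; rewrite -!lee_fin a0.
have [a /andP[a0 aN] sa] := mass s ds sf.
have [del /andP[del0 delN] udel] := mass u du uf.
have adel : a + del = N.
  apply: EFin_inj; rewrite -fN EFinD -sa -udel -ge0_integralD//.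
  - by apply: eq_integral => x _; rewrite fsu.
  - by move=> x _; rewrite lee_fin ds.2.
  - by apply/measurable_EFinP; exact: ds.1.
  - by move=> x _; rewrite lee_fin du.2.
  - by apply/measurable_EFinP; exact: du.1.
have fN' : (\int[leb3]_x (f x)%:E <= N%:E)%E by rewrite fN.
have Bf := HLS _ _ _ df fN' fA.
have [jus ujs ub] : [/\ (forall x, (d * c * u x `^ (4 / 3))%:E <= j (u x))%E,
   (forall x, c * u x <= u x `^ (4 / 3)) &
   (forall x, u x `^ (4 / 3) <= f x `^ (4 / 3))].
  split=> x.
  - have [Px|nP] := boolP (P x).
      by rewrite /u Px powR0 ?mulr0.
    apply: le_trans (jd _ (du.2 x)); rewrite lee_fin -mulrA ler_pM2l//.
    rewrite le_min lexx andbT /u (negbTE nP).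
    apply: (powR53_ge _ _ _).1; [exact: ltW|exact: df.2|].
    by rewrite ltW// ltNge.
  - have [Px|nP] := boolP (P x); first by rewrite /u Px powR0 ?mulr0.
    rewrite /u (negbTE nP).
    apply: (powR53_ge _ _ _).2; [exact: ltW|exact: df.2|].
    by rewrite ltW// ltNge.
  - by apply: le_powR => //; exact: du.2.
have u43_0 : (0 <= \int[leb3]_x (u x `^ (4 / 3))%:E)%E.
  by apply: integral_ge0 => x _; rewrite lee_fin powR_ge0.
have u43_A : (\int[leb3]_x (u x `^ (4 / 3))%:E <= A%:E)%E.
  apply: le_trans fA; apply: ge0_le_integral => //.
  - by move=> x _; rewrite lee_fin powR_ge0.
  - by apply/measurable_EFinP; exact: measurable_density_powR.
  - by apply/measurable_EFinP; exact: measurable_density_powR.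
  - by move=> x _; rewrite lee_fin.
have [a43 a43E] : exists a43, (\int[leb3]_x (u x `^ (4 / 3))%:E = a43%:E)%E.
  move: u43_0 u43_A; case: (\int[leb3]_x (u x `^ (4 / 3))%:E)%E => [r| |] //.
  by exists r.
have dela43 : c * del <= a43.
  rewrite -lee_fin EFinM -udel -a43E -ge0_integralZl_EFin//; last 3 first.
  - by move=> x _; rewrite lee_fin du.2.
  - by apply/measurable_EFinP; exact: du.1.
  - exact: ltW.
  apply: ge0_le_integral => //.
  - by move=> x _; rewrite -EFinM lee_fin mulr_ge0 ?du.2 ?ltW.
  - by apply/measurable_EFinP; apply: measurable_funM => //; exact: du.1.
  - by apply/measurable_EFinP; exact: measurable_density_powR.
  - by move=> x _; rewrite -EFinM lee_fin.
have Ku : ((d * c * a43)%:E <= \int[leb3]_x j (u x))%E.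
  rewrite EFinM -a43E -ge0_integralZl_EFin//; last 3 first.
  - by move=> x _; rewrite lee_fin powR_ge0.
  - by apply/measurable_EFinP; exact: measurable_density_powR.
  - by pos.
  apply: ge0_le_integral => //.
  - by move=> x _; rewrite -EFinM lee_fin; pos.
  - by apply/measurable_EFinP; apply: measurable_funM => //; exact: measurable_density_powR.
  - exact: measurable_comp_density.
  - by move=> x _; rewrite -EFinM; exact: jus.
have del_eq0 : del = 0.
  apply/eqP; rewrite eq_le del0 andbT leNgt; apply/negP => del_gt0.
  have aN' : a < N by rewrite -adel ltrDl.
  have Bexp : (B f f = B s s + B s u + (B u s + B u u))%E.
    have dsu := densityD ds du.
    by rewrite fsu (coulomb_formDl ds du dsu) (coulomb_formDr ds ds du) (coulomb_formDr du ds du).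
  have Bss0 := coulomb_form_ge0 ds ds.
  have Bsu0 := coulomb_form_ge0 ds du.
  have Bus0 := coulomb_form_ge0 du ds.
  have Buu0 := coulomb_form_ge0 du du.
  have uN : (\int[leb3]_x (u x)%:E <= N%:E)%E by rewrite udel lee_fin.
  have sN : (\int[leb3]_x (s x)%:E <= N%:E)%E by rewrite sa lee_fin.
  have Buu : (B u u <= (H * a43 * N `^ (2 / 3))%:E)%E.
    by apply: HLS => //; rewrite a43E.
  have Bus : (B u s <= (del * W)%:E)%E.
    apply: coulomb_form_le_potential => //; first by rewrite udel.
    by move=> x; exact: pot.
  have Bsu : B s u = B u s by exact: coulomb_form_sym.
  have decf x : 0 < norm3 x -> s x * norm3 x ^+ 3 <= 64 * N.
    move=> x0; apply: (@le_trans _ _ (f x * norm3 x ^+ 3)).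
      by apply: ler_wpM2r; [rewrite exprn_ge0 ?norm3_ge0|exact: sf].
    rewrite -[f x]powRr1; last exact: df.2.
    apply: (symmetric_decreasing_decay ltr01 df symf _ x0).
    by rewrite (mass_powR1 df) fN.
  have Bss_fin : (B s s < +oo)%E.
    apply: le_lt_trans (ltry (H * A * N `^ (2 / 3))); apply: le_trans Bf; rewrite Bexp.
    exact (lee_add3 (B s s) Bsu0 Bus0 Buu0).
  have s53' : (\int[leb3]_x (s x `^ (5 / 3))%:E < +oo)%E.
    by apply: le_lt_trans s53 (ltry _).
  have N64 : 0 <= 64 * N by rewrite mulr_ge0.
  have [g [dg gN g53 gE]] := lower_energy_by_adding_mass mj jge0 C0 jC kap0 N64 ds decf sa aN' s53' Bss_fin.
  have := le_lt_trans (minf g (admissible_L43 dg gN g53)) gE.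
  rewrite /energy !coulombE Bexp Ksu Bsu => Elt.
  have Ksfin := le_lt_trans Ks (ltry K).
  have Kufin : (\int[leb3]_x j (u x) < +oo)%E.
    apply: le_lt_trans (ltry K); apply: le_trans fK; rewrite Ksu.
    by apply: leeDr; exact: Ks0.
  exact: (truncation_gain kap0 d0 c_ge1 W0 del_gt0 dela43 cbig Ks0 Ksfin Ku Kufin
    Bss0 Bss_fin Bus0 Bus Buu0 Buu Elt).
have u_eq0 : {ae leb3, forall x, u x = 0}.
  have mu : measurable_fun setT (EFin \o u) by apply/measurable_EFinP; exact: du.1.
  have : (\int[leb3]_x `|(EFin \o u) x| = 0)%E.
    transitivity (\int[leb3]_x (u x)%:E)%E; last by rewrite udel del_eq0.
    by apply: eq_integral => x _ /=; rewrite ger0_norm// du.2.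
  move=> /(ae_eq_integral_abs leb3 measurableT mu).
  by apply: filterS => x /(_ I) /= [].
have sfae : {ae leb3, forall x, s x = f x}.
  apply: filterS u_eq0 => x ux; have : f x = s x + u x by rewrite {1}fsu.
  by rewrite ux addr0.
split.
- apply: le_trans s53; rewrite le_eqVlt; apply/orP; left; apply/eqP.
  apply: ge0_ae_eq_integral => //.
  - by apply/measurable_EFinP; exact: measurable_density_powR.
  - by apply/measurable_EFinP; exact: measurable_density_powR.
  - by move=> x _; rewrite lee_fin powR_ge0.
  - by move=> x _; rewrite lee_fin powR_ge0.
  - by apply: filterS sfae => x -> _.
- by apply: filterS sfae => x <-.
Qed.

Lemma minimizer_bounds (kappa q m N H : R) : 0 < kappa -> 0 < q -> 0 < m -> 0 < N -> 0 < H ->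
  hls H ->
  exists c1 F K d : R, [/\ 0 < c1, 0 <= F, 0 <= K, 0 < d & forall c f, c1 <= c ->
    minimizer_c kappa q m c N f -> symmetric_decreasing f ->
    [/\ (\int[leb3]_x (f x `^ (5 / 3))%:E <= F%:E)%E,
        (\int[leb3]_x j_mc q m c (f x) <= K%:E)%E &
        {ae leb3, forall x, ((d * f x `^ (5 / 3))%:E <= j_mc q m c (f x))%E} ] ].
Proof.
move=> kap0 q0 m0 N0 H0 HLS.
have [C C0 jC] := j_infty_upper q0 m0.
have [d d0 jd'] := j_lower q0 m0.
have jd s (s0 : 0 <= s) := (jd' s s0).2.
have [E0 E00 EE] := E_c_upper kap0 q0 m0 N0.
have [c0 [A [K [c00 A0 K0 bd]]]] := energy_bounds kap0 q0 m0 N0 H0 HLS d0 E00 jd.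
have [Cs pot] := potential_bound (R := R).
pose F := K / d; have F0 : 0 <= F by rewrite /F; pos.
(* The bound of potential_bound with a = T = 1. *)
pose W := Num.max 0 (1 * F + 1 `^ (- (3 / 2)) * Cs 1 + N / 1).
have W0 : 0 <= W by rewrite le_max lexx.
pose h := kappa * H * N `^ (2 / 3); have h0 : 0 < h by rewrite /h; pos.
pose c1 := c0 + 1 + h / d + 2 * kappa * W / d.
have hd : 0 < h / d by pos.
have Wd : 0 <= 2 * kappa * W / d by pos.
have [c1_gt0 c01 hc1] :
    [/\ 0 < c1, c0 <= c1 & 1 + h / d + 2 * kappa * W / d <= c1].
  rewrite /c1; move: c00 hd Wd; move: (h / d) (2 * kappa * W / d); clear.
  by move=> a b *; split; lra.
have one_c1 : 1 <= c1.
  move: hd Wd hc1; move: (h / d) (2 * kappa * W / d) (c1); clear.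
  by move=> a b x *; lra.
exists c1, F, K, d; split; [exact: c1_gt0|exact: F0|exact: K0|exact: d0|].
move=> c f c1c minf symf.
have [df fN f43 fE] := minimizer_cP minf.
have c0c : c0 <= c by exact: le_trans c01 c1c.
have c_ge1 : 1 <= c by exact: le_trans one_c1 c1c.
have c_gt0 : 0 < c by exact: lt_le_trans ltr01 c_ge1.
have fE0 : (energy_c kappa q m c f <= E0%:E)%E by rewrite fE; exact: EE.
have [fA fK] := bd c f c0c df fN f43 fE0.
suff [? ?] : (\int[leb3]_x (f x `^ (5 / 3))%:E <= (K / d)%:E)%E /\
  {ae leb3, forall x, ((d * f x `^ (5 / 3))%:E <= j_mc q m c (f x))%E} by split.
apply: (@density_threshold _ f kappa C d c H N A K W).
- exact: measurable_j_mc.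
- by move=> s; exact: j_mc_ge0.
- exact: fermi_at0.
- exact: ltW.
- by move=> s s0; apply: le_trans (jC s s0); exact: j_mc_le_infty.
- by move=> s s0; exact: jd.
- exact: kap0.
- exact: d0.
- exact: ltW.
- exact: HLS.
- move=> g x dg gN gF; apply: (le_trans (pot g x 1 1 F N dg ltr01 ltr01 gF gN)).
  by rewrite lee_fin le_max lexx orbT.
- exact: W0.
- exact: ltW.
- exact: c_ge1.
- have -> : d + kappa * H * N `^ (2 / 3) + 2 * kappa * W = d * (1 + h / d + 2 * kappa * W / d).
    by rewrite -/h; field; rewrite gt_eqF.
  by rewrite (ler_pM2l d0); exact: le_trans hc1 c1c.
- exact: df.
- exact: symf.
- exact: fN.
- exact: fA.
- exact: fK.
- by move=> g ag; move: fE; rewrite /energy_c => ->; exact: E_c_le.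
Qed.

End apriori_bounds.

(** * Helly selection for radial densities *)

Section diagonal.
Context {R : realType}.

Lemma increasing_ge_id (f : nat -> nat) : increasing_seq f -> forall n, (n <= f n)%N.
Proof.
move=> fi; elim=> [//|n ih]; apply: (leq_ltn_trans ih).
have : (f n.+1 <= f n)%O = (n.+1 <= n)%N by exact: fi.
by rewrite ltnn ltnNge => h; apply/negP => h'; move: h; rewrite leEnat h'.
Qed.

(** The classical diagonal argument: [S k] is the k-th nested extraction, given
by the Bolzano-Weierstrass theorem, and [S n n] is eventually a subsequence of
each of them. *)
Lemma diagonal_extraction (a : nat -> nat -> R) (M : nat -> R) :
  (forall k n, `|a k n| <= M k) ->
  exists2 phi : nat -> nat, {homo phi : i j / (i < j)%N} &
    forall k, cvgn (fun n => a k (phi n)).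
Proof.
move=> aM.
have BW (w : nat -> R) : exists f : nat -> nat, increasing_seq f /\ (bounded_fun w -> cvgn (w \o f)).
  have [bw|nb] := pselect (bounded_fun w).
    by have [f fi fc] := bolzano_weierstrass bw; exists f.
  by exists id; split.
have [F FP] := choice BW.
pose S := fix S k : nat -> nat := if k is k'.+1 then S k' \o F (a k' \o S k') else id.
have Si k : increasing_seq (S k).
  elim: k => [//|k ih] n m /=.
  by rewrite ih; exact: (FP _).1.
have ST k j : exists2 T : nat -> nat, increasing_seq T & forall m, S (k + j)%N m = S k (T m).
  elim: j => [|j [T Ti TE]]; first by exists id => // m; rewrite addn0.
  exists (T \o F (a (k + j)%N \o S (k + j)%N)).
    by move=> n m /=; rewrite Ti; exact: (FP _).1.
  by move=> m; rewrite addnS /= TE.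
exists (fun n => S n n).
  apply: homo_ltn => [? ? ?|n]; first exact: ltn_trans.
  rewrite /= ltnNge; apply/negP => h.
  have := Si n (F (a n \o S n) n.+1) n; rewrite leEnat => E.
  rewrite h in E; have := @increasing_ge_id _ (FP (a n \o S n)).1 n.+1.
  move=> h'; have : (n < n)%N by apply: leq_trans h' _; rewrite -E.
  by rewrite ltnn.
move=> k.
have cv : cvgn (a k \o S k.+1).
  have := (FP (a k \o S k)).2; apply.
  exists (M k); split; first exact: num_real.
  by move=> x Mx n _ /=; apply: le_trans (aM _ _) (ltW Mx).
pose l := limn (a k \o S k.+1).
have al : (a k \o S k.+1) n @[n --> \oo] --> l by exact: cv.
apply/cvg_ex; exists l; apply/cvgrPdist_lt => e e0.
have /cvgrPdist_lt /(_ _ e0) [n0 _ nl] := al.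
exists (maxn n0 k.+1) => // n /=; rewrite geq_max => /andP[n0n kn].
have [T Ti TE] := ST k.+1 (n - k.+1)%N.
move: TE; rewrite subnKC// => ->.
by apply: (nl (T n)) => /=; apply: leq_trans (increasing_ge_id Ti n).
Qed.

End diagonal.

Section limsup.
Context {R : realType}.
Implicit Types (w : nat -> \bar R) (y : \bar R).

Lemma limn_esupE w : limn_esup w = (- limn_einf (-%E \o w))%E.
Proof. by rewrite limn_einfN oppeK. Qed.

Lemma limn_esup_le w y : (\forall n \near \oo, (w n <= y)%E) -> (limn_esup w <= y)%E.
Proof.
move=> wy; rewrite limn_esupE leeNl; apply: limn_einf_ge.
by apply: filterS wy => n; rewrite /= leeN2.
Qed.

Lemma limn_esup_lt w y : (limn_esup w < y)%E -> \forall n \near \oo, (w n < y)%E.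
Proof.
rewrite limn_esupE lteNl => /lt_limn_einf.
by apply: filterS => n; rewrite /= lteN2.
Qed.

Lemma cvg_of_einf_esup (w : nat -> R) (l : R) :
  (l%:E <= limn_einf (fun n => (w n)%:E))%E -> (limn_esup (fun n => (w n)%:E) <= l%:E)%E ->
  w n @[n --> \oo] --> l.
Proof.
move=> lw wl; apply/cvgrPdist_lt => e e0.
have h1 : \forall n \near \oo, ((l - e)%:E < (w n)%:E)%E.
  by apply: lt_limn_einf; apply: lt_le_trans lw; rewrite lte_fin ltrBlDr ltrDl.
have h2 : \forall n \near \oo, ((w n)%:E < (l + e)%:E)%E.
  by apply: limn_esup_lt; apply: le_lt_trans wl _; rewrite lte_fin ltrDl.
near=> n.
have : ((l - e)%:E < (w n)%:E)%E by near: n.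
have : ((w n)%:E < (l + e)%:E)%E by near: n.
by rewrite !lte_fin distrC ltr_distl => -> ->.
Unshelve. all: by end_near. Qed.

Lemma rat_between_ereal (x y : \bar R) : (x < y)%E ->
  exists r : rat, (x < (ratr r)%:E)%E /\ ((ratr r)%:E < y)%E.
Proof.
have real (a b : R) : a < b -> exists r : rat, a < ratr r /\ ratr r < b.
  by move=> /rat_in_itvoo[r]; rewrite in_itv /= => /andP[? ?]; exists r.
case: x => [a| |]; case: y => [b| |] // ab.
- by have [r [h1 h2]] := real _ _ ab; exists r; rewrite !lte_fin.
- have [|r [h1 h2]] := real a (a + 1); first by rewrite ltrDl.
  by exists r; rewrite lte_fin ltry.
- have [|r [h1 h2]] := real (b - 1) b; first by rewrite ltrBlDr ltrDl.
  by exists r; rewrite lte_fin ltNyr.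
- by exists 0; rewrite ltry ltNyr.
Qed.

End limsup.

Section helly.
Context {R : realType}.
Implicit Types (f g : R3 R -> R).

Lemma null_of_countable_sections (S : set (R3 R)) : measurable S ->
  (forall z, countable [set t | S (z, t)]) -> leb3 S = 0%E.
Proof.
move=> mS cS.
have m1 : measurable_fun setT (fun x : R3 R => (\1_S x)%:E : \bar R).
  by apply/measurable_EFinP; exact: measurable_indic.
transitivity (\int[leb3]_x (\1_S x)%:E)%E.
  by rewrite integral_indic// setIT.
rewrite (fubini_tonelli1 (m1 := leb2) (m2 := @lebesgue_measure R) (fun x : R3 R => (\1_S x)%:E))//.
apply: integral0_eq => z _; rewrite /fubini_F.
rewrite (_ : (fun y => (\1_S (z, y))%:E) = (fun y => (\1_[set t | S (z, t)] y)%:E)); last first.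
  by apply/funext => y; rewrite !indicE; congr (_%:R%:E); apply/idP/idP; rewrite !inE.
rewrite integral_indic ?setIT//.
  by apply: countable_lebesgue_measure0.
have := pair1_measurable z measurableT mS; rewrite setTI.
exact.
Qed.

(** Extract a subsequence that converges at all points [pt k] of positive
rational norm, and let [U] and [L] be the upper and lower limits of the
subsequence.  By monotonicity [U y <= L x] as soon as [norm3 x < norm3 y], so the
intervals between [L] and [U] at points of different norms are disjoint.  On each
line parallel to the third axis a rational number chosen in the interval and the
sign of the coordinate determine the point, so [L < U] happens at countably many
points of the line, hence on a null set. *)
Lemma helly_radial (u : nat -> R3 R -> R) (G : R) :
  (forall n, density (u n)) -> (forall n, symmetric_decreasing (u n)) ->
  (forall n x, 0 < norm3 x -> u n x * norm3 x ^+ 3 <= G) ->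
  exists phi v, [/\ {homo phi : i j / (i < j)%N}, density v,
    forall x, 0 < norm3 x -> v x * norm3 x ^+ 3 <= G &
    {ae leb3, forall x, u (phi n) x @[n --> \oo] --> v x}].
Proof.
move=> du symu uG.
(* The default 1 only matters for indices that code no rational. *)
pose rad (k : nat) : R := if unpickle k is Some r then ratr (r : rat) else 1.
pose pt k : R3 R := (rad k, 0, 0).
pose a k n := if 0 < rad k then u n (pt k) else 0.
have npt k : norm3 (pt k) = `|rad k| by rewrite /norm3 /= expr0n /= !addr0 sqrtr_sqr.
have aM k n : `|a k n| <= `|G| / `|rad k| ^+ 3.
  rewrite /a; case: ifPn => r0; last by rewrite normr0; pos.
  rewrite ger0_norm; last exact: (du n).2.
  rewrite ler_pdivlMr; last by rewrite exprn_gt0// normr_gt0 gt_eqF.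
  rewrite -npt; apply: le_trans (ler_norm G); apply: uG.
  by rewrite npt normr_gt0 gt_eqF.
have [phi phi_incr aphi] := diagonal_extraction aM.
pose U x := limn_esup (fun n => (u (phi n) x)%:E).
pose L x := limn_einf (fun n => (u (phi n) x)%:E).
have mu n : measurable_fun setT (fun x => (u n x)%:E : \bar R).
  by apply/measurable_EFinP; exact: (du n).1.
have mU : measurable_fun setT U by exact: measurable_fun_limn_esup.
have mL : measurable_fun setT L.
  apply: measurableT_comp => //; apply: measurable_fun_limn_esup => n.
  exact: measurableT_comp.
have U0 x : (0 <= U x)%E.
  apply: le_trans (limn_einf_sup _); apply: limn_einf_ge; apply: nearW => n.
  by rewrite lee_fin (du _).2.
have UG x : 0 < norm3 x -> (U x <= (G / norm3 x ^+ 3)%:E)%E.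
  move=> x0; apply: limn_esup_le; apply: nearW => n.
  by rewrite lee_fin ler_pdivlMr ?exprn_gt0// uG.
have UL x y : 0 < norm3 x -> norm3 x < norm3 y -> (U y <= L x)%E.
  move=> x0 xy; have [r] := rat_in_itvoo xy; rewrite in_itv /= => /andP[xr ry].
  have radr : rad (pickle r) = ratr r by rewrite /rad pickleK.
  have r0 : 0 < ratr r :> R by exact: lt_trans xr.
  have nptr : norm3 (pt (pickle r)) = ratr r by rewrite npt radr gtr0_norm.
  pose l := limn (fun n => a (pickle r) (phi n)).
  have al : a (pickle r) (phi n) @[n --> \oo] --> l by exact: aphi.
  have aE n : a (pickle r) n = u n (pt (pickle r)) by rewrite /a radr r0.
  apply: (@le_trans _ _ l%:E).
    apply/lee_addgt0Pr => e e0; apply: limn_esup_le; rewrite -EFinD.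
    have : \forall n \near \oo, a (pickle r) (phi n) < l + e.
      by apply: (cvgr_lt _ al); rewrite ltrDl.
    apply: filterS => n /ltW; rewrite lee_fin; apply: le_trans; rewrite aE.
    by apply: (symu (phi n)).2; rewrite nptr// ltW.
  apply/lee_subgt0Pr => e e0; apply: limn_einf_ge; rewrite -EFinN -EFinD.
  have : \forall n \near \oo, l - e < a (pickle r) (phi n).
    by apply: (cvgr_gt _ al); rewrite ltrBlDr ltrDl.
  apply: filterS => n /ltW; rewrite lee_fin => /le_trans; apply; rewrite aE.
  by apply: (symu (phi n)).2 => //; rewrite nptr// ltW.
pose S : set (R3 R) := [set x | 0 < norm3 x] `&` [set x | (L x < U x)%E].
have mpos : measurable [set x : R3 R | 0 < norm3 x].
  rewrite (_ : [set x | _] = (fun x : R3 R => 0 < norm3 x) @^-1` [set true])//.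
  rewrite -[X in measurable X]setTI.
  have mlt : measurable_fun setT (fun x : R3 R => 0 < norm3 x).
    by apply: measurable_fun_ltr => //; exact: measurable_norm3.
  exact: mlt.
have mLU : measurable [set x : R3 R | (L x < U x)%E].
  rewrite -[X in measurable X]setTI.
  exact: (measurable_lte measurableT mL mU).
have mS : measurable S by exact: measurableI.
have S0 : leb3 S = 0%E.
  apply: null_of_countable_sections => // z; apply/countable_injP.
  have HR t : exists r : rat, S (z, t) -> (L (z, t) < (ratr r)%:E)%E /\ ((ratr r)%:E < U (z, t))%E.
    have [[_ /rat_between_ereal [r hr]]|] := pselect (S (z, t)); first by exists r.
    by exists 0.
  have [rr rrP] := choice HR.
  have lt_norm t t' : `|t| < `|t'| -> norm3 (z, t) < norm3 (z, t') :> R.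
    move=> tt; rewrite -ltr_sqr ?nnegrE ?norm3_ge0// !norm3_sqr /= ltrD2l.
    by rewrite -[t ^+ 2]real_normK ?num_real// -[t' ^+ 2]real_normK ?num_real// ltr_sqr ?nnegrE.
  have noinj t t' : S (z, t) -> S (z, t') -> rr t = rr t' -> `|t| < `|t'| -> False.
    move=> St St' rt tt.
    have [h1 _] := rrP t St; have [_ h2] := rrP t' St'.
    have h3 := UL _ _ St.1 (lt_norm _ _ tt).
    by have := lt_trans (lt_le_trans h2 h3) h1; rewrite rt ltxx.
  exists (fun t => pickle (0 < t, rr t)) => t t'; rewrite !inE => St St'.
  move=> /(pcan_inj pickleK)[tt rt].
  have [lt|gt|eq] := ltgtP `|t| `|t'|.
  - by case: (noinj t t').
  - by case: (noinj t' t).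
  move: tt eq; have [t0|t0] := ltP 0 t.
    by move=> /esym t'0; rewrite !gtr0_norm.
  move=> /esym/negbT; rewrite -leNgt => t'0; rewrite !ler0_norm//.
  exact: oppr_inj.
exists phi, (fun x => fine (U x)); split => //.
- split; first exact: measurableT_comp.
  by move=> x; apply: fine_ge0.
- move=> x x0; rewrite -ler_pdivlMr ?exprn_gt0//.
  by have := UG x x0; have := U0 x; case: (U x).
exists (S `|` cube 0 0); split.
- by apply: measurableU => //; exact: measurable_cube.
- have c0 : leb3 (cube (0 : R3 R) 0) = 0%E by rewrite leb3_cube// mulr0 expr0n.
  exact: (null_set_setU mS (measurable_cube _ _) S0 c0).
move=> x /= nx; apply: contrapT => /not_orP[nS nc]; apply: nx.
have x0 : 0 < norm3 x.
  rewrite lt_neqAle norm3_ge0 andbT eq_sym; apply/eqP => /norm3_eq0 x0; apply: nc.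
  by rewrite x0; split; rewrite subrr normr0.
have LU : (U x <= L x)%E by rewrite leNgt; apply/negP => h; apply: nS.
have Ufin : U x \is a fin_num.
  by rewrite ge0_fin_numE//; apply: le_lt_trans (UG x x0) (ltry _).
apply: cvg_of_einf_esup; rewrite fineK//.
Qed.

End helly.

(** * Upper semicontinuity of the Coulomb energy *)

Section coulomb_limsup.
Context {R : realType}.
Implicit Types (f g : R3 R -> R).

Local Notation B := coulomb_form.
Local Notation box r := (cube (0%R : R3 R) r).

Definition cut (A : set (R3 R)) f : R3 R -> R := fun x => f x * \1_A x.

Lemma density_cut A f : measurable A -> density f -> density (cut A f).
Proof.
move=> mA [mf f0]; split; last by move=> x; rewrite mulr_ge0.
by apply: measurable_funM => //; exact: measurable_indic.
Qed.

Lemma cut_le A f : density f -> forall x, cut A f x <= f x.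
Proof.
by move=> [_ f0] x; rewrite /cut indicE; case: (_ \in _); rewrite ?mulr1 ?mulr0.
Qed.

Lemma cut_split A f : f = cut A f \+ cut (~` A) f.
Proof.
apply/funext => x; rewrite /cut /= !indicE in_setC.
by case: (_ \in _); rewrite /= ?mulr1 ?mulr0 ?addr0 ?add0r.
Qed.

Lemma le_integral_density f g : density f -> density g -> (forall x, f x <= g x) ->
  (\int[leb3]_x (f x)%:E <= \int[leb3]_x (g x)%:E)%E.
Proof.
move=> df dg fg; apply: ge0_le_integral => //.
- by move=> x _; rewrite lee_fin df.2.
- by apply/measurable_EFinP; exact: df.1.
- by apply/measurable_EFinP; exact: dg.1.
- by move=> x _; rewrite lee_fin.
Qed.

Lemma coulomb_form_cut_le A f : measurable A -> density f ->
  (B f f <= B (cut A f) (cut A f) + B f (cut (~` A) f) + B f (cut (~` A) f))%E.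
Proof.
move=> mA df; have din := density_cut mA df.
have dou := density_cut (measurableC mA) df.
have E : (B f f = B (cut A f) (cut A f) + B (cut A f) (cut (~` A) f) + B f (cut (~` A) f))%E.
  rewrite -(coulomb_formDr din din dou) -cut_split (coulomb_form_sym df dou).
  by rewrite -(coulomb_formDl din dou df) -cut_split.
rewrite E; apply: leeD; last exact: lexx.
apply: leeD; first exact: lexx.
apply: (le_coulomb_form din df dou dou); first exact: cut_le.
by move=> x; exact: lexx.
Qed.

(** The decay gives [h <= G / r ^ 3] outside the box, hence an integral of
[h ^ (5/3)] of order [r ^ -2].  In [potential_bound], first [T], then the weight
[a], and finally [r] are chosen to make each of the three terms at most
[e / 3]. *)
Lemma tail_potential (N G e : R) : 0 <= N -> 0 <= G -> 0 < e ->
  exists2 r : R, 0 < r & forall f, density f -> (\int[leb3]_x (f x)%:E <= N%:E)%E ->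
    (forall x, 0 < norm3 x -> f x * norm3 x ^+ 3 <= G) ->
    forall x, (potential (cut (~` box r) f) x <= e%:E)%E.
Proof.
move=> N0 G0 e0; have [C CP] := potential_bound (R := R).
have e30 : 0 < e / 3 by rewrite divr_gt0.
pose T := N / (e / 3) + 1.
have T0 : 0 < T by rewrite /T ltr_wpDl// divr_ge0// ltW.
have NT : N / T <= e / 3.
  rewrite ler_pdivrMr// mulrC -ler_pdivrMr// /T lerDl//.
pose D := `|C T| / (e / 3) + 1.
have D0 : 0 < D by rewrite /D ltr_wpDl// divr_ge0// ltW.
pose a := D `^ (2 / 3).
have a0 : 0 < a by exact: powR_gt0.
have aC : a `^ (- (3 / 2)) * C T <= e / 3.
  have -> : a `^ (- (3 / 2)) = D^-1.
    rewrite /a -powRrM (_ : 2 / 3 * - (3 / 2) = -1); last by field.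
    by rewrite powR_inv1// ltW.
  apply: (@le_trans _ _ (D^-1 * `|C T|)).
    by rewrite ler_pM2l ?invr_gt0// ler_norm.
  rewrite mulrC ler_pdivrMr// mulrC -ler_pdivrMr// /D lerDl//.
pose S := a * (G `^ (2 / 3) * N).
have S0 : 0 <= S by rewrite /S; pos.
pose r := S / (e / 3) + 1.
have r1 : 1 <= r by rewrite /r lerDr divr_ge0// ltW.
have r0 : 0 < r by lra.
have Sr : S / r ^+ 2 <= e / 3.
  apply: (@le_trans _ _ (S / r)).
    by rewrite ler_wpM2l// lef_pV2 ?posrE ?exprn_gt0// expr2 ler_peMr// ltW.
  by rewrite ler_pdivrMr// mulrC -ler_pdivrMr// /r lerDl.
exists r => // f df fN fG x.
have mc : measurable (~` box r) by apply: measurableC; exact: measurable_cube.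
set h := cut (~` box r) f; have dh : density h by exact: density_cut.
have hN : (\int[leb3]_x (h x)%:E <= N%:E)%E.
  by apply: le_trans fN; apply: le_integral_density => //; exact: cut_le.
have P2 : (G / r ^+ 3) `^ (2 / 3) = G `^ (2 / 3) / r ^+ 2.
  rewrite powRM//; last by pos.
  congr (_ * _); rewrite -!exprVn -[X in X `^ _]powR_mulrn; last by pos.
  rewrite -powRrM (_ : 3 * (2 / 3) = 2); last by field.
  by rewrite powR_mulrn//; pos.
have hF : (\int[leb3]_x (h x `^ (5 / 3))%:E <= (G `^ (2 / 3) / r ^+ 2 * N)%:E)%E.
  have Gr0 : 0 <= G `^ (2 / 3) / r ^+ 2 by pos.
  apply: (@le_trans _ _ (\int[leb3]_x ((G `^ (2 / 3) / r ^+ 2)%:E * (h x)%:E))%E); last first.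
    rewrite ge0_integralZl_EFin//.
    - by rewrite [leRHS]EFinM; apply: lee_wpmul2l; rewrite ?lee_fin.
    - by move=> y _; rewrite lee_fin dh.2.
    - by apply/measurable_EFinP; exact: dh.1.
  apply: ge0_le_integral => //.
  - by move=> y _; rewrite lee_fin powR_ge0.
  - by apply/measurable_EFinP; exact: measurable_density_powR.
  - by apply/measurable_EFinP; apply: measurable_funM => //; exact: dh.1.
  move=> y _; rewrite -EFinM lee_fin.
  have [yc|yc] := pselect (box r y).
    have -> : h y = 0 by rewrite /h /cut indicE memNset// mulr0.
    by rewrite powR0// mulr0.
  have ry : r <= norm3 y by have := notin_cube yc; rewrite sub0r norm3N.
  have y0 : 0 < norm3 y by exact: lt_le_trans ry.
  have hy : h y <= G / r ^+ 3.
    apply: (le_trans (cut_le _ df y)); rewrite ler_pdivlMr ?exprn_gt0//.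
    apply: le_trans (fG y y0); apply: ler_wpM2l; first exact: df.2.
    by rewrite ler_pXn2r ?nnegrE ?norm3_ge0// ltW.
  have -> : 5 / 3 = 2 / 3 + 1 :> R by field.
  rewrite powRD; last by rewrite gt_eqF.
  rewrite powRr1; last exact: dh.2.
  apply: ler_wpM2r; first exact: dh.2.
  by rewrite -P2; apply: le_powR => //; exact: dh.2.
apply: (le_trans (CP h x a T _ _ dh a0 T0 hF hN)); rewrite lee_fin.
have -> : a * (G `^ (2 / 3) / r ^+ 2 * N) = S / r ^+ 2 by rewrite /S; ring.
lra.
Qed.

Lemma cvg_prod3 (x y : nat -> R) (a b k : R) :
  x n @[n --> \oo] --> a -> y n @[n --> \oo] --> b ->
  (x n * y n * k)%:E @[n --> \oo] --> (a * b * k)%:E.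
Proof.
move=> xa yb; apply/fine_cvgP; split; first exact: nearW.
apply: cvgM; last exact: cvg_cst.
exact: cvgM.
Qed.

Lemma powR_le_sing (k p : R) : 0 <= k -> 0 <= p -> p <= 5 / 2 -> k `^ p <= 1 + k `^ (5 / 2).
Proof.
move=> k0 p0 p52; have [k1|k1] := leP k 1.
  apply: (@le_trans _ _ 1); last by rewrite lerDl powR_ge0.
  by apply: le_trans (le_powR p0 k0 k1) _; rewrite powR1.
apply: (@le_trans _ _ (k `^ (5 / 2))); last by rewrite lerDr.
by apply: ler_powR => //; exact: ltW.
Qed.

(** The pointwise bound on the box that follows from [f ^ (5/3) |x|^3 <= G].  Its
power 4/3 has the singularity [|x| ^ (- 12/5)], which is integrable, so that its
self-energy is finite by [hls]. *)
Definition majorant (r G : R) : R3 R -> R :=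
  fun x => \1_(box r) x * (G `^ (3 / 5) * ((norm3 x)^-1) `^ (9 / 5)).

Lemma density_majorant (r G : R) : density (majorant r G).
Proof.
split; last by move=> x; rewrite /majorant; pos.
apply: measurable_funM; first by apply: measurable_indic; exact: measurable_cube.
apply: measurable_funM => //.
have -> : (fun x : R3 R => (norm3 x)^-1 `^ (9 / 5)) = (@powR R)^~ (9 / 5) \o (fun x => (norm3 x)^-1) by [].
apply: measurableT_comp; first exact: measurable_powR.
have -> : (fun x : R3 R => (norm3 x)^-1) = (fun x => (norm3 (0 - x))^-1).
  by apply/funext => x; rewrite sub0r norm3N.
exact: measurable_norm3V1.
Qed.

Lemma integral_majorant (r G p : R) : 0 < r -> 0 <= G -> 0 < p -> p <= 4 / 3 ->
  exists M, (\int[leb3]_x (majorant r G x `^ p)%:E <= M%:E)%E.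
Proof.
move=> r0 G0 p0 p43; have [C CP] := sing_bound (R := R).
have dm := density_majorant r G.
pose b := (G `^ (3 / 5)) `^ p; have b0 : 0 <= b by exact: powR_ge0.
exists (b * (2 * r) ^+ 3 + b * C r).
have E (x : R3 R) : box r x -> majorant r G x `^ p <= b + b * sing (0 - x).
  move=> xc; rewrite /majorant indicE mem_set// mul1r powRM ?powR_ge0//.
  rewrite -/b -powRrM -[X in X + _]mulr1 -mulrDr; apply: ler_wpM2l => //.
  rewrite /sing sub0r norm3N; apply: powR_le_sing.
  - by rewrite invr_ge0 norm3_ge0.
  - by rewrite mulr_ge0// ltW.
  - apply: (@le_trans _ _ (9 / 5 * (4 / 3))); last by lra.
    by apply: ler_wpM2l.
have msing : measurable_fun setT (fun x => \1_(box r) x * sing (0 - x)).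
  apply: measurable_funM; last exact: measurable_sing.
  by apply: measurable_indic; exact: measurable_cube.
have mind : measurable_fun setT (\1_(box r) : R3 R -> R).
  by apply: measurable_indic; exact: measurable_cube.
apply: (@le_trans _ _ (\int[leb3]_x ((b * \1_(box r) x)%:E + b%:E * (\1_(box r) x * sing (0 - x))%:E))%E).
  apply: ge0_le_integral => //.
  - by move=> x _; rewrite lee_fin powR_ge0.
  - by apply/measurable_EFinP; exact: measurable_density_powR.
  - apply: emeasurable_funD.
      by apply/measurable_EFinP; exact: measurable_funM.
    by apply/measurable_EFinP; exact: measurable_funM.
  move=> x _; rewrite -EFinM -EFinD lee_fin.
  have [xc|xc] := pselect (box r x).
    by apply: (le_trans (E x xc)); rewrite indicE mem_set// mulr1 mul1r.
  by rewrite /majorant indicE memNset// !mul0r !mulr0 addr0 powR0// gt_eqF.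
rewrite ge0_integralD//; last 4 first.
- by move=> x _; rewrite lee_fin; pos.
- by apply/measurable_EFinP; exact: measurable_funM.
- by move=> x _; rewrite -EFinM lee_fin !mulr_ge0// powR_ge0.
- by apply/measurable_EFinP; exact: measurable_funM.
rewrite (integral_cube 0 (ltW r0) b0) EFinD; apply: leeD => //.
rewrite ge0_integralZl_EFin//; last 2 first.
- by move=> x _; rewrite lee_fin mulr_ge0// powR_ge0.
- by apply/measurable_EFinP.
rewrite EFinM lee_wpmul2l//.
apply: le_trans (CP 0 r r0); rewrite [leRHS]integral_mkcond le_eqVlt; apply/orP; left; apply/eqP.
apply: eq_integral => x _; rewrite patchE indicE; case: ifPn => _; first by rewrite mul1r.
by rewrite mul0r.
Qed.

Lemma cut_le_majorant (r G : R) f x : density f -> 0 <= G -> 0 < norm3 x ->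
  f x `^ (5 / 3) * norm3 x ^+ 3 <= G -> cut (box r) f x <= majorant r G x.
Proof.
move=> df G0 x0 fG; rewrite /cut /majorant mulrC ler_wpM2l//.
have -> : f x = (f x `^ (5 / 3)) `^ (3 / 5).
  rewrite -powRrM (_ : 5 / 3 * (3 / 5) = 1) ?powRr1//; first exact: df.2.
  by field.
have -> : (norm3 x)^-1 `^ (9 / 5) = ((norm3 x)^-1 ^+ 3) `^ (3 / 5).
  rewrite -[X in _ = X `^ _]powR_mulrn; last by pos.
  by rewrite -powRrM; congr (_ `^ _); field.
rewrite -powRM//; last by pos.
apply: le_powR => //; first exact: powR_ge0.
by rewrite exprVn ler_pdivlMr// exprn_gt0.
Qed.

(** Dominated convergence on the product space, the interaction of [majorant]
with itself being the dominating function. *)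
Lemma coulomb_form_cut_cvg (u : nat -> R3 R -> R) v (r G H : R) : 0 < r -> 0 <= G -> hls H ->
  (forall n, density (u n)) -> density v ->
  (forall n x, 0 < norm3 x -> u n x `^ (5 / 3) * norm3 x ^+ 3 <= G) ->
  {ae leb3, forall x, u n x @[n --> \oo] --> v x} ->
  B (cut (box r) (u n)) (cut (box r) (u n)) @[n --> \oo] -->
  B (cut (box r) v) (cut (box r) v) /\
  B (cut (box r) v) (cut (box r) v) \is a fin_num.
Proof.
move=> r0 G0 HLS du dv uG uv.
have mc : measurable (box r) by exact: measurable_cube.
have dc n : density (cut (box r) (u n)) by exact: density_cut.
have dcv : density (cut (box r) v) by exact: density_cut.
have dm := density_majorant r G.
have [M1 hM1] : exists M, (\int[leb3]_x (majorant r G x)%:E <= M%:E)%E.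
  have [|M hM] := @integral_majorant r G 1 r0 G0 ltr01; first by lra.
  by exists M; move: hM; rewrite (mass_powR1 dm).
have [|M2 hM2] := @integral_majorant r G (4 / 3) r0 G0 _ (lexx _); first by lra.
have Bm := HLS _ _ _ dm hM1 hM2.
have im : (leb3 \x leb3)%E.-integrable setT (interaction (majorant r G) (majorant r G)).
  apply/integrableP; split; first exact: measurable_interaction.
  apply: le_lt_trans (ltry (H * M2 * M1 `^ (2 / 3))); apply: le_trans Bm.
  rewrite coulomb_form_prod// le_eqVlt; apply/orP; left; apply/eqP.
  by apply: eq_integral => z _; rewrite gee0_abs// interaction_ge0.
have cvf : {ae (leb3 \x leb3)%E, forall z, setT z ->
    interaction (cut (box r) (u n)) (cut (box r) (u n)) z @[n --> \oo] -->
    interaction (cut (box r) v) (cut (box r) v) z}.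
  apply: filterS2 (ae_fst _ uv) (ae_snd _ uv) => z h1 h2 _.
  by apply: cvg_prod3; apply: cvgM => //; exact: cvg_cst.
have n0 : {ae leb3, forall x : R3 R, 0 < norm3 x}.
  apply: filterS (ae_neq 0) => x x0; rewrite lt_neqAle norm3_ge0 andbT eq_sym.
  by apply/eqP => /norm3_eq0.
have dom : {ae (leb3 \x leb3)%E, forall z n, setT z ->
    (`|interaction (cut (box r) (u n)) (cut (box r) (u n)) z| <=
      interaction (majorant r G) (majorant r G) z)%E}.
  apply: filterS2 (ae_fst _ n0) (ae_snd _ n0) => z h1 h2 n _.
  rewrite gee0_abs ?interaction_ge0// lee_fin ler_wpM2r//.
    by rewrite invr_ge0 norm3_ge0.
  apply: ler_pM; [exact: (dc n).2|exact: (dc n).2| |].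
  - by apply: cut_le_majorant => //; exact: uG.
  - by apply: cut_le_majorant => //; exact: uG.
have [iv _ cv] := dominated_convergence measurableT
  (fun n => measurable_interaction (dc n) (dc n)) (measurable_interaction dcv dcv) cvf im dom.
split.
  rewrite coulomb_form_prod//.
  by under eq_fun do rewrite coulomb_form_prod//.
rewrite coulomb_form_prod//; exact: integrable_fin_num.
Qed.

Lemma lee_add_small (x y : \bar R) (a b e : R) : (x <= y)%E -> a + b + b <= e ->
  (x + a%:E + b%:E + b%:E <= y + e%:E)%E.
Proof.
move=> xy abe; have -> : (x + a%:E + b%:E + b%:E = x + (a + b + b)%:E)%E.
  by rewrite !EFinD !addeA.
by apply: leeD => //; rewrite lee_fin.
Qed.

(** In a large box the Coulomb energies converge, and by the smallness of the
potential of the part outside, the rest contributes at most [2 N eta]. *)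
Lemma coulomb_form_limsup (u : nat -> R3 R -> R) v (N G1 G2 H : R) :
  0 <= N -> 0 <= G1 -> 0 <= G2 -> hls H ->
  (forall n, density (u n)) -> density v ->
  (forall n, \int[leb3]_x (u n x)%:E <= N%:E)%E ->
  (forall n x, 0 < norm3 x -> u n x * norm3 x ^+ 3 <= G1) ->
  (forall n x, 0 < norm3 x -> u n x `^ (5 / 3) * norm3 x ^+ 3 <= G2) ->
  {ae leb3, forall x, u n x @[n --> \oo] --> v x} ->
  forall e, 0 < e -> \forall n \near \oo, (B (u n) (u n) <= B v v + e%:E)%E.
Proof.
move=> N0 G10 G20 HLS du dv uN uG1 uG2 uv e e0.
pose eta := e / (4 * (N + 1)).
have N1 : 0 < N + 1 by lra.
have eta0 : 0 < eta by rewrite /eta; pos.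
have [r r0 tail] := tail_potential N0 G10 eta0.
have [cv fin] := coulomb_form_cut_cvg r0 G20 HLS du dv uG2 uv.
have mc : measurable (box r) by exact: measurable_cube.
have dc f : density f -> density (cut (box r) f) by exact: density_cut.
have dout f : density f -> density (cut (~` box r) f).
  by apply: density_cut; exact: measurableC.
have inB : (B (cut (box r) v) (cut (box r) v) <= B v v)%E.
  by apply: (le_coulomb_form (dc _ dv) dv (dc _ dv) dv); exact: cut_le.
have near_in : \forall n \near \oo, (B (cut (box r) (u n)) (cut (box r) (u n)) <=
    B (cut (box r) v) (cut (box r) v) + (e / 2)%:E)%E.
  have e20 : 0 < e / 2 by lra.
  move: cv; rewrite -(fineK fin) => /fine_cvgP[fnear /cvgrPdist_lt /(_ _ e20)].
  move: fnear; apply: filterS2 => n /fineK <-; rewrite /comp ltr_distl => /andP[h _].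
  by rewrite -EFinD lee_fin; rewrite ltrBlDr in h; exact: ltW.
apply: filterS near_in => n inn.
have din := dc _ (du n); have dou := dout _ (du n).
have Bout : (B (u n) (cut (~` box r) (u n)) <= (N * eta)%:E)%E.
  apply: (coulomb_form_le_potential (du n) dou (ltW eta0) (uN n)).
  exact: (tail (u n) (du n) (uN n) (uG1 n)).
have Bdec := coulomb_form_cut_le mc (du n).
apply: (le_trans Bdec); apply: (@le_trans _ _
   (B (cut (box r) v) (cut (box r) v) + (e / 2)%:E + (N * eta)%:E + (N * eta)%:E)%E).
  by apply: leeD; [apply: leeD; [exact: inn|exact: Bout]|exact: Bout].
apply: (lee_add_small inB).
have : N * eta <= e / 4.
  rewrite /eta mulrA ler_pdivrMr; last by pos.
  have -> : e / 4 * (4 * (N + 1)) = N * e + e by field.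
  lra.
lra.
Qed.

End coulomb_limsup.

(** * Strong convergence from convergence of integrals *)

Section strong_convergence.
Context {R : realType}.
Implicit Types (f g v : R3 R -> R) (w : nat -> R3 R -> R).

Lemma le_limn_einf (a b : nat -> \bar R) : (forall n, (a n <= b n)%E) ->
  (limn_einf a <= limn_einf b)%E.
Proof.
move=> ab; rewrite leNgt; apply/negP => lt.
have [r [h1 h2]] := rat_between_ereal lt.
have : ((ratr r)%:E <= limn_einf b)%E.
  apply: limn_einf_ge; move: (lt_limn_einf h2); apply: filterS => n h.
  exact: le_trans (ltW h) (ab n).
by rewrite leNgt h1.
Qed.

Lemma limn_einf_EFin (s : nat -> R) (l : R) : s n @[n --> \oo] --> l ->
  limn_einf (fun n => (s n)%:E) = l%:E.
Proof.
move=> sl; have h : (s n)%:E @[n --> \oo] --> l%:E.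
  by apply/fine_cvgP; split; [exact: nearW|exact: sl].
by have [-> _] := cvg_limn_einf_sup h.
Qed.

Lemma cvg_powR0 (t : nat -> R) (p : R) : 0 < p -> (forall n, 0 <= t n) ->
  t n @[n --> \oo] --> 0 -> t n `^ p @[n --> \oo] --> 0.
Proof.
move=> p0 t0 /cvgrPdist_lt tc; apply/cvgrPdist_lt => e e0.
have ep : 0 < e `^ p^-1 by exact: powR_gt0.
move: (tc _ ep); apply: filterS => n; rewrite !sub0r !normrN !ger0_norm ?powR_ge0// => h.
have -> : e = (e `^ p^-1) `^ p by rewrite -powRrM mulVf ?gt_eqF// powRr1// ltW.
by apply: gt0_ltr_powR => //; rewrite nnegrE// powR_ge0.
Qed.

Lemma cvg_of_poweR0 (y : nat -> \bar R) (p : R) : 0 < p -> (forall n, 0 <= y n)%E ->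
  (y n `^ p)%E @[n --> \oo] --> 0%E -> y n @[n --> \oo] --> 0%E.
Proof.
move=> p0 y0 /fine_cvgP[fin yc].
have yE n : (y n `^ p)%E \is a fin_num -> y n \is a fin_num.
  rewrite ge0_fin_numE ?poweR_ge0// => h; rewrite ge0_fin_numE//.
  by apply: lty_poweRy h; rewrite gt_eqF.
apply/fine_cvgP; split; first by apply: filterS fin => n; exact: yE.
have pV : 0 < p^-1 by rewrite invr_gt0.
have := @cvg_powR0 (fun n => fine (y n `^ p)%E) p^-1 pV _ yc.
move=> H; have {}H := H (fun n => fine_ge0 (poweR_ge0 _ _)).
apply: cvg_trans H; apply: near_eq_cvg.
apply: filterS fin => n /yE yn; rewrite /= fine_poweR -powRrM mulfV ?gt_eqF// powRr1//.
exact: fine_ge0.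
Qed.

Lemma cvg_LpP w v (p : R) : 0 < p -> (forall n, density (w n)) -> density v ->
  (forall n, \int[leb3]_x (w n x `^ p)%:E < +oo)%E ->
  (\int[leb3]_x (v x `^ p)%:E < +oo)%E ->
  (\int[leb3]_x (`|w n x - v x| `^ p)%:E)%E @[n --> \oo] --> 0%E ->
  cvg_Lp p w v.
Proof.
move=> p0 dw dv wp vp wv; split.
- by move=> n; exact: (Lfun_densityP p0 (dw n)).2 (wp n).
- exact: (Lfun_densityP p0 dv).2 vp.
apply: (@cvg_of_poweR0 _ p) => //; first by move=> n; exact: Lnorm_ge0.
have E : (fun n => 'N[leb3]_(p%:E)[EFin \o (w n \- v)%R] `^ p)%E =
    (fun n => \int[leb3]_x (`|w n x - v x| `^ p)%:E)%E.
  by apply/funext => n; rewrite poweR_Lnorm ?gt_eqF.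
by rewrite E.
Qed.

Lemma dist_powR_le (a b p : R) : 0 <= p -> 0 <= a -> 0 <= b ->
  `|a - b| `^ p <= a `^ p + b `^ p.
Proof.
move=> p0 a0 b0; have [ab|ba] := leP a b.
  apply: (@le_trans _ _ (b `^ p)); last by rewrite lerDr powR_ge0.
  by apply: le_powR => //; rewrite ler0_norm ?subr_le0// opprB gerBl.
apply: (@le_trans _ _ (a `^ p)); last by rewrite lerDl powR_ge0.
by apply: le_powR => //; rewrite gtr0_norm ?subr_gt0// gerBl.
Qed.

Lemma measurable_dist_powR w v (p : R) n : density (w n) -> density v ->
  measurable_fun setT (fun x => `|w n x - v x| `^ p).
Proof.
move=> dw dv; apply: (@measurable_density_powR _ (fun x => `|w n x - v x|)).
split=> //; apply: measurableT_comp => //; apply: measurable_funB; [exact: dw.1|exact: dv.1].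
Qed.

(** [fatou_scheffe] with [h = d |w - v| ^ p], which the integrands [k n + k0]
dominate. *)
Lemma strong_convergence w v (k : nat -> R3 R -> \bar R) (k0 : R3 R -> \bar R) (d p : R) :
  0 < d -> 0 < p -> (forall n, density (w n)) -> density v ->
  (forall n, measurable_fun setT (k n)) -> (forall n x, 0 <= k n x)%E ->
  measurable_fun setT k0 -> (forall x, 0 <= k0 x)%E ->
  (forall n, {ae leb3, forall x, ((d * w n x `^ p)%:E <= k n x)%E}) ->
  (forall x, ((d * v x `^ p)%:E <= k0 x)%E) ->
  {ae leb3, forall x, w n x @[n --> \oo] --> v x} ->
  {ae leb3, forall x, (k0 x <= limn_einf (k ^~ x))%E} ->
  (\int[leb3]_x k0 x < +oo)%E ->
  (forall e : R, 0 < e -> \forall n \near \oo,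
     (\int[leb3]_x k n x <= \int[leb3]_x k0 x + e%:E)%E) ->
  (\int[leb3]_x (`|w n x - v x| `^ p)%:E)%E @[n --> \oo] --> 0%E.
Proof.
move=> d0 p0 dw dv mk kge0 mk0 k00 wk vk wv kinf k0fin supk.
pose h n x := d * `|w n x - v x| `^ p.
(* k' agrees with k almost everywhere and dominates d (w n)^p at every point. *)
pose k' n x := maxe (k n x) (d * w n x `^ p)%:E.
have mwp n : measurable_fun setT (fun x => (d * w n x `^ p)%:E : \bar R).
  by apply/measurable_EFinP; apply: measurable_funM => //; exact: measurable_density_powR.
have mk' n : measurable_fun setT (k' n) by exact: measurable_maxe.
have k'0 n x : (0 <= k' n x)%E by rewrite /k' le_max kge0.
have kk' n : (\int[leb3]_x k' n x = \int[leb3]_x k n x)%E.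
  apply: ge0_ae_eq_integral => //; apply: filterS (wk n) => x h' _.
  by rewrite /k' /maxe; case: ltP => // h''; apply/eqP; rewrite eq_le h' (ltW h'').
have mh n : measurable_fun setT (h n).
  by apply: measurable_funM => //; exact: measurable_dist_powR.
have h0 n x : 0 <= h n x by rewrite /h; pos.
have hk n x : ((h n x)%:E <= k' n x + k0 x)%E.
  apply: (@le_trans _ _ ((d * w n x `^ p)%:E + (d * v x `^ p)%:E)%E).
    rewrite -EFinD lee_fin /h -mulrDr ler_pM2l//; apply: dist_powR_le.
    - exact: ltW.
    - exact: (dw n).2.
    - exact: dv.2.
  by apply: leeD; [rewrite /k' le_max lexx orbT|exact: vk].
have hcv : {ae leb3, forall x, h n x @[n --> \oo] --> 0}.
  apply: filterS wv => x wx; rewrite -(mulr0 d); apply: cvgM; first exact: cvg_cst.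
  apply: cvg_powR0 => //; rewrite -(normr0 R) -(subrr (v x)).
  by apply: cvg_norm; apply: cvgB => //; exact: cvg_cst.
have k'inf : {ae leb3, forall x, (k0 x <= limn_einf (k' ^~ x))%E}.
  apply: filterS kinf => x h'; apply: (le_trans h'); apply: le_limn_einf => n.
  by rewrite /k' le_max lexx.
have supk' e : 0 < e -> \forall n \near \oo, (\int[leb3]_x k' n x <= \int[leb3]_x k0 x + e%:E)%E.
  by move=> e0; move: (supk e e0); apply: filterS => n; rewrite kk'.
have lim := fatou_scheffe mh h0 mk' k'0 mk0 k00 hk hcv k'inf k0fin supk'.
have E n : (\int[leb3]_x (`|w n x - v x| `^ p)%:E = (d^-1)%:E * \int[leb3]_x (h n x)%:E)%E.
  rewrite -ge0_integralZl_EFin//.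
  - by apply: eq_integral => x _; rewrite -EFinM /h mulrA mulVf ?gt_eqF// mul1r.
  - by move=> x _; rewrite lee_fin.
  - by apply/measurable_EFinP.
  - by rewrite invr_ge0 ltW.
rewrite (_ : (fun n => _) = (fun n => (d^-1)%:E * \int[leb3]_x (h n x)%:E)%E); last by apply/funext => n; exact: E.
rewrite -(mule0 (d^-1)%:E); exact: cvgeZl.
Qed.

End strong_convergence.

(** * The limit of the minimizers *)

Section main.
Context {R : realType}.
Implicit Types (f g v : R3 R -> R) (w : nat -> R3 R -> R).

Local Notation B := coulomb_form.

Lemma energy_c_le_infty (kappa q m c : R) f : 0 < q -> 0 < m -> 0 < c -> density f ->
  (energy_c kappa q m c f <= energy_infty kappa q m f)%E.
Proof.
move=> q0 m0 c0 df; rewrite /energy_c /energy_infty /energy; apply: leeD2r.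
apply: ge0_le_integral; first exact: measurableT.
- by move=> x _; exact: j_mc_ge0.
- by apply: measurable_comp_density => //; exact: measurable_j_mc.
- by apply: measurable_comp_density => //; exact: measurable_j_infty.
- by move=> x _; exact: j_mc_le_infty.
Qed.

Lemma coulomb_form_fin (N H : R) f : hls H -> density f -> (\int[leb3]_x (f x)%:E <= N%:E)%E ->
  (\int[leb3]_x (f x `^ (5 / 3))%:E < +oo)%E -> (B f f < +oo)%E.
Proof.
move=> HLS df fN f53.
have f43 := L43_of_L53 df (le_lt_trans fN (ltry N)) f53.
have f430 : (0 <= \int[leb3]_x (f x `^ (4 / 3))%:E)%E.
  by apply: integral_ge0 => x _; rewrite lee_fin powR_ge0.
have [A fA] : exists A : R, (\int[leb3]_x (f x `^ (4 / 3))%:E <= A%:E)%E.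
  by move: f43 f430; case: (\int[leb3]_x (f x `^ (4 / 3))%:E)%E => [r| |] // _ _; exists r.
exact: le_lt_trans (HLS f A N df fN fA) (ltry _).
Qed.

(** The lower semicontinuity of the energy in terms of the numbers [K n] and
[Bn n], the kinetic and Coulomb energies of the sequence, and [k] and [b], those
of the limit. *)
Lemma energy_limit (kappa : R) (K Bn : nat -> \bar R) (k b e : \bar R) : 0 < kappa ->
  (0 <= k)%E -> (0 <= b)%E -> (b < +oo)%E -> (k < +oo)%E ->
  (forall n, 0 <= Bn n)%E -> (k <= limn_einf K)%E ->
  (forall d : R, 0 < d -> \forall n \near \oo, (Bn n <= b + d%:E)%E) ->
  (forall n, K n - kappa%:E * ((1 / 2)%:E * Bn n) <= e)%E ->
  (k - kappa%:E * ((1 / 2)%:E * b) <= e)%E.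
Proof.
move=> kap0; case: k => [k| |] //; case: b => [b| |] // k0 b0 _ _ Bn0 kK supB he.
apply/lee_addgt0Pr => d d0.
pose t := d / (2 + kappa); have t0 : 0 < t by rewrite /t divr_gt0//; lra.
have td : t * (2 + kappa) = d by rewrite /t mulfVK// gt_eqF//; lra.
have h1 : \forall n \near \oo, ((k - t)%:E < K n)%E.
  by apply: lt_limn_einf; apply: lt_le_trans kK; rewrite lte_fin ltrBlDr ltrDl.
have [n [hK hB]] := filter_ex (filterI h1 (supB t t0)).
move: hK hB (Bn0 n) (he n); move: (K n) (Bn n) => [x| |] [y| |] //.
- rewrite -?EFinM -?EFinD !lee_fin lte_fin => h2 h3 h4.
  case: (e) => [z| |] //=; rewrite -?EFinM -?EFinD ?lee_fin => h5; last by rewrite leey.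
  suff : kappa * (1 / 2 * y) <= kappa * (1 / 2 * (b + t)) by nra.
  by rewrite ler_pM2l// ler_pM2l//; lra.
- by rewrite -!EFinM -EFinN addye// leye_eq => _ _ _ /eqP ->; rewrite addye// leey.
Qed.

(** When the energies do not exceed that of the limit, the kinetic energies
cannot exceed the limiting one by more than the Coulomb energies do. *)
Lemma kinetic_limit (kappa : R) (K Bn : nat -> \bar R) (k b : \bar R) : 0 < kappa ->
  (0 <= k)%E -> (0 <= b)%E -> (b < +oo)%E -> (k < +oo)%E ->
  (forall n, 0 <= Bn n)%E ->
  (forall d : R, 0 < d -> \forall n \near \oo, (Bn n <= b + d%:E)%E) ->
  (forall n, K n - kappa%:E * ((1 / 2)%:E * Bn n) <=
     k - kappa%:E * ((1 / 2)%:E * b))%E ->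
  forall d : R, 0 < d -> \forall n \near \oo, (K n <= k + d%:E)%E.
Proof.
move=> kap0; case: k => [k| |] //; case: b => [b| |] // k0 b0 _ _ Bn0 supB he d d0.
have dk : 0 < d / kappa by rewrite divr_gt0.
have dE : kappa * (d / kappa) = d by rewrite mulrC mulfVK// gt_eqF.
move: (supB _ dk); apply: filterS => n hB; move: hB (Bn0 n) (he n).
move: (K n) (Bn n) => [x| |] [y| |] //; last by move=> *; exact: leNye.
rewrite -?EFinM -?EFinD ?lee_fin => h3 h4 h5.
suff : kappa * (1 / 2 * y) <= kappa * (1 / 2 * (b + d / kappa)) by nra.
by rewrite ler_pM2l// ler_pM2l//; lra.
Qed.

Lemma limit_mass_le (w : nat -> R3 R -> R) v (N : R) :
  (forall n, density (w n)) -> density v ->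
  (forall n, \int[leb3]_x (w n x)%:E = N%:E)%E ->
  {ae leb3, forall x, w n x @[n --> \oo] --> v x} ->
  (\int[leb3]_x (v x)%:E <= N%:E)%E.
Proof.
move=> dw dv wN wv.
have -> : N%:E = limn_einf (fun n => \int[leb3]_x (w n x)%:E)%E.
  under eq_fun do rewrite wN.
  by apply/esym; apply: (@limn_einf_EFin _ (cst N)); exact: cvg_cst.
apply: (@fatou_le _ _ _ _ (fun x => (v x)%:E) (fun n x => (w n x)%:E)).
- by apply/measurable_EFinP; exact: dv.1.
- by move=> n; apply/measurable_EFinP; exact: (dw n).1.
- by move=> x; rewrite lee_fin; exact: dv.2.
- by move=> n x; rewrite lee_fin; exact: (dw n).2.
- apply: filterS wv => x wx.
  by rewrite (limn_einf_EFin wx).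
Qed.

Lemma limit_kinetic_liminf (q m : R) (c : nat -> R) (w : nat -> R3 R -> R) v :
  0 < q -> 0 < m -> (forall n, 0 < c n) -> c n @[n --> \oo] --> +oo ->
  (forall n, density (w n)) -> density v ->
  {ae leb3, forall x, w n x @[n --> \oo] --> v x} ->
  {ae leb3, forall x, (j_infty q m (v x) <= limn_einf (fun n => j_mc q m (c n) (w n x)))%E} /\
  (\int[leb3]_x j_infty q m (v x) <=
    limn_einf (fun n => \int[leb3]_x j_mc q m (c n) (w n x)))%E.
Proof.
move=> q0 m0 c0 coo dw dv wv.
have h : {ae leb3, forall x,
    (j_infty q m (v x) <= limn_einf (fun n => j_mc q m (c n) (w n x)))%E}.
  by apply: filterS wv => x wx; apply: j_mc_liminf => // n; exact: (dw n).2.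
split; first exact: h.
apply: (@fatou_le _ _ _ _ (fun x => j_infty q m (v x)) (fun n x => j_mc q m (c n) (w n x))).
- by apply: measurable_comp_density dv; exact: measurable_j_infty.
- by move=> n; apply: measurable_comp_density (dw n); exact: measurable_j_mc.
- by move=> x; exact: j_infty_ge0.
- by move=> n x; exact: j_mc_ge0.
- exact: h.
Qed.

(** A density that lies below all competitors has mass exactly [N]: with less
mass, [lower_energy_by_adding_mass] would provide a competitor below it. *)
Lemma minimizer_infty_of_lower_energy (kappa q m N : R) v (G : R) : 0 < kappa -> 0 < q -> 0 < m ->
  0 <= G -> density v -> (forall x, 0 < norm3 x -> v x * norm3 x ^+ 3 <= G) ->
  (\int[leb3]_x (v x)%:E <= N%:E)%E -> (\int[leb3]_x (v x `^ (5 / 3))%:E < +oo)%E ->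
  (B v v < +oo)%E ->
  (forall s, admissible (5 / 3) N s ->
    (energy_infty kappa q m v <= energy_infty kappa q m s)%E) ->
  minimizer_infty kappa q m N v.
Proof.
move=> kap0 q0 m0 G0 dv decay vN v53 Bv low.
have p53 : 0 < 5 / 3 :> R by rewrite divr_gt0.
suff mass : (\int[leb3]_x (v x)%:E = N%:E)%E.
  have adm : admissible (5 / 3) N v by apply/(admissibleP v N p53); split.
  split; first exact: adm.
  apply: le_anti; apply/andP; split.
    by apply: le_ereal_inf_tmp => _ [s sadm <-]; exact: low.
  by apply: ereal_inf_lbound; exists v.
have v0 : (0 <= \int[leb3]_x (v x)%:E)%E.
  by apply: integral_ge0 => x _; rewrite lee_fin; exact: dv.2.
have [N' vN'] : exists N' : R, (\int[leb3]_x (v x)%:E = N'%:E)%E.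
  by move: vN v0; case: (\int[leb3]_x (v x)%:E)%E => [r| |] // _ _; exists r.
have := vN; rewrite vN' lee_fin le_eqVlt => /orP[/eqP ->//|ltN].
have [C C0 jC] := j_infty_upper q0 m0.
have [g [dg gN g53]] := @lower_energy_by_adding_mass _ (j_infty q m) v kappa C G N N'
  (measurable_j_infty q0 m0) (fun s => j_infty_ge0 s q0 m0) (ltW C0) jC kap0 G0 dv decay
  vN' ltN v53 Bv.
have gadm : admissible (5 / 3) N g by apply/(admissibleP g N p53); split.
by rewrite ltNge => /negP[]; exact: low.
Qed.

(** Competitors for the limiting problem are admissible for each [c], by
interpolation between L^1 and L^(5/3), and [j_mc <= j_infty]. *)
Lemma energy_c_minimizer_le (kappa q m c N : R) f s : 0 < q -> 0 < m -> 0 < c ->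
  minimizer_c kappa q m c N f -> admissible (5 / 3) N s ->
  (energy_c kappa q m c f <= energy_infty kappa q m s)%E.
Proof.
move=> q0 m0 c0 [_ ->] sadm.
have p53 : 0 < 5 / 3 :> R by rewrite divr_gt0.
have [ds sN s53] := (admissibleP s N p53).1 sadm.
apply: le_trans (energy_c_le_infty kappa q0 m0 c0 ds).
by apply: E_c_le; exact: admissible_L43.
Qed.

Lemma integral_powR_of_kinetic (q m d : R) v : 0 < q -> 0 < m -> 0 < d -> density v ->
  (forall x, ((d * v x `^ (5 / 3))%:E <= j_infty q m (v x))%E) ->
  (\int[leb3]_x j_infty q m (v x) < +oo)%E ->
  (\int[leb3]_x (v x `^ (5 / 3))%:E < +oo)%E.
Proof.
move=> q0 m0 d0 dv vj jfin.
have mv : measurable_fun setT (fun x => (v x `^ (5 / 3))%:E : \bar R).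
  by apply/measurable_EFinP; exact: measurable_density_powR.
have : (\int[leb3]_x (d * v x `^ (5 / 3))%:E < +oo)%E.
  apply: le_lt_trans jfin; apply: ge0_le_integral.
  - exact: measurableT.
  - by move=> x _; rewrite lee_fin mulr_ge0 ?powR_ge0// ltW.
  - by apply/measurable_EFinP; apply: measurable_funM => //; exact: measurable_density_powR.
  - by apply: measurable_comp_density dv; exact: measurable_j_infty.
  - by move=> x _; exact: vj.
have -> : (\int[leb3]_x (d * v x `^ (5 / 3))%:E = d%:E * \int[leb3]_x (v x `^ (5 / 3))%:E)%E.
  rewrite -ge0_integralZl_EFin//.
  - by move=> x _; rewrite lee_fin powR_ge0.
  - exact: ltW.
case: (\int[leb3]_x (v x `^ (5 / 3))%:E)%E => [r _| |] //; first exact: ltry.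
by rewrite gt0_muley// lte_fin.
Qed.

Lemma limit_of_minimizers (kappa q m N H F K d : R) (c : nat -> R) w v :
  0 < kappa -> 0 < q -> 0 < m -> 0 < N -> hls H -> 0 <= F -> 0 < d ->
  (forall n, 0 < c n) -> c n @[n --> \oo] --> +oo ->
  (forall n, minimizer_c kappa q m (c n) N (w n)) ->
  (forall n, symmetric_decreasing (w n)) ->
  (forall n, \int[leb3]_x (w n x `^ (5 / 3))%:E <= F%:E)%E ->
  (forall n, \int[leb3]_x j_mc q m (c n) (w n x) <= K%:E)%E ->
  (forall n, {ae leb3, forall x,
     ((d * w n x `^ (5 / 3))%:E <= j_mc q m (c n) (w n x))%E}) ->
  density v -> (forall x, 0 < norm3 x -> v x * norm3 x ^+ 3 <= 64 * N) ->
  {ae leb3, forall x, w n x @[n --> \oo] --> v x} ->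
  [/\ minimizer_infty kappa q m N v, cvg_Lp 1 w v & cvg_Lp (5 / 3) w v].
Proof.
move=> kap0 q0 m0 N0 HLS F0 d0 c0 coo minw symw wF wK wd dv vdecay wv.
have p53 : 0 < 5 / 3 :> R by rewrite divr_gt0.
have dw n : density (w n) by have [] := minimizer_cP (minw n).
have wN n : (\int[leb3]_x (w n x)%:E = N%:E)%E by have [] := minimizer_cP (minw n).
have w1 n x : 0 < norm3 x -> w n x * norm3 x ^+ 3 <= 64 * N.
  move=> x0; rewrite -{1}(@powRr1 _ (w n x)); last exact: (dw n).2.
  apply: (symmetric_decreasing_decay ltr01 (dw n) (symw n) _ x0).
  by rewrite (mass_powR1 (dw n)) wN.
have w53 n x : 0 < norm3 x -> w n x `^ (5 / 3) * norm3 x ^+ 3 <= 64 * F.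
  by move=> x0; apply: (symmetric_decreasing_decay p53 (dw n) (symw n) (wF n) x0).
have G1 : 0 <= 64 * N by rewrite mulr_ge0// ltW.
have G2 : 0 <= 64 * F by rewrite mulr_ge0.
have wNle n : (\int[leb3]_x (w n x)%:E <= N%:E)%E by rewrite wN.
have vN := limit_mass_le dw dv wN wv.
have [jinf Kinf] := limit_kinetic_liminf q0 m0 c0 coo dw dv wv.
have kv : (\int[leb3]_x j_infty q m (v x) < +oo)%E.
  apply: le_lt_trans (ltry K); apply: (le_trans Kinf).
  have -> : K%:E = limn_einf (fun _ : nat => K%:E).
    by apply/esym; apply: (@limn_einf_EFin _ (cst K)); exact: cvg_cst.
  exact: le_limn_einf.
have kv0 : (0 <= \int[leb3]_x j_infty q m (v x))%E.
  by apply: integral_ge0 => x _; exact: j_infty_ge0.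
have [d' d'0 hd'] := j_lower q0 m0.
have vj' x : ((d' * v x `^ (5 / 3))%:E <= j_infty q m (v x))%E.
  exact: (hd' _ (dv.2 x)).1.
have v53 := integral_powR_of_kinetic q0 m0 d'0 dv vj' kv.
have Bv := coulomb_form_fin HLS dv vN v53.
have Bv0 := coulomb_form_ge0 dv dv.
have Bw0 n := coulomb_form_ge0 (dw n) (dw n).
have Bsup := coulomb_form_limsup (ltW N0) G1 G2 HLS dw dv wNle w1 w53 wv.
have enE n s : admissible (5 / 3) N s ->
    (\int[leb3]_x j_mc q m (c n) (w n x) - kappa%:E * ((1 / 2)%:E * B (w n) (w n))
      <= energy_infty kappa q m s)%E.
  move=> sadm; rewrite -coulombE; exact: energy_c_minimizer_le (minw n) sadm.
have vE : energy_infty kappa q m v =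
    (\int[leb3]_x j_infty q m (v x) - kappa%:E * ((1 / 2)%:E * B v v))%E.
  by rewrite -coulombE.
have low s : admissible (5 / 3) N s ->
    (energy_infty kappa q m v <= energy_infty kappa q m s)%E.
  move=> sadm; rewrite vE.
  exact: (energy_limit kap0 kv0 Bv0 Bv kv Bw0 Kinf Bsup (fun n => enE n s sadm)).
have minv : minimizer_infty kappa q m N v.
  exact: (minimizer_infty_of_lower_energy kap0 q0 m0 G1 dv vdecay vN v53 Bv low).
have [_ vmass _] := (admissibleP v N p53).1 minv.1.
have Ksup : forall e : R, 0 < e -> \forall n \near \oo,
    (\int[leb3]_x j_mc q m (c n) (w n x) <= \int[leb3]_x j_infty q m (v x) + e%:E)%E.
  apply: (kinetic_limit kap0 kv0 Bv0 Bv kv Bw0 Bsup) => n.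
  have := enE n v minv.1; rewrite {1}vE; exact.
split; first exact: minv.
- apply: cvg_LpP; [exact: ltr01|exact: dw|exact: dv| | |].
  + by move=> n; rewrite (mass_powR1 (dw n)) wN ltry.
  + by rewrite (mass_powR1 dv) vmass ltry.
  + apply: (@strong_convergence _ w v (fun n x => (w n x)%:E) (fun x => (v x)%:E) 1 1
      ltr01 ltr01 dw dv).
    * by move=> n; apply/measurable_EFinP; exact: (dw n).1.
    * by move=> n x; rewrite lee_fin; exact: (dw n).2.
    * by apply/measurable_EFinP; exact: dv.1.
    * by move=> x; rewrite lee_fin; exact: dv.2.
    * move=> n; apply: aeW => x; rewrite mul1r powRr1; [exact: lexx|exact: (dw n).2].
    * move=> x; rewrite mul1r powRr1; [exact: lexx|exact: dv.2].
    * exact: wv.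
    * apply: filterS wv => x wx.
      by rewrite (limn_einf_EFin wx).
    * by rewrite vmass ltry.
    * move=> e e0; near=> n; rewrite wN vmass -EFinD lee_fin lerDl; exact: ltW.
- apply: cvg_LpP; [exact: p53|exact: dw|exact: dv| |exact: v53|].
  + move=> n; exact: le_lt_trans (wF n) (ltry F).
  + have dd0 : 0 < Num.min d d' by rewrite lt_min d0.
    apply: (@strong_convergence _ w v (fun n x => j_mc q m (c n) (w n x))
      (fun x => j_infty q m (v x)) (Num.min d d') (5 / 3) dd0 p53 dw dv).
    * by move=> n; apply: measurable_comp_density (dw n); exact: measurable_j_mc.
    * by move=> n x; exact: j_mc_ge0.
    * by apply: measurable_comp_density dv; exact: measurable_j_infty.
    * by move=> x; exact: j_infty_ge0.
    * move=> n; apply: filterS (wd n) => x; apply: le_trans; rewrite lee_fin.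
      by apply: ler_wpM2r; [exact: powR_ge0|rewrite ge_min lexx].
    * move=> x; apply: le_trans (vj' x); rewrite lee_fin.
      by apply: ler_wpM2r; [exact: powR_ge0|rewrite ge_min lexx orbT].
    * exact: wv.
    * exact: jinf.
    * exact: kv.
    * exact: Ksup.
Unshelve. all: by end_near.
Qed.

End main.

Theorem theorem1p2 (R : realType) (kappa q m N Nstar : R)
    (kappa_gt0 : 0 < kappa) (q_ge1 : 1 <= q) (m_gt0 : 0 < m) (N_gt0 : 0 < N)
    (Nstar_opt : is_Nstar kappa q Nstar)
    (rho : R -> R3 R -> R)
    (rho_min : forall c : R, 0 < c ->
       0 < N `^ (2 / 3) < c * Nstar `^ (2 / 3) ->
       minimizer_c kappa q m c N (rho c) /\ symmetric_decreasing (rho c))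
    (c : nat -> R)
    (c_gt0 : forall n, 0 < c n)
    (c_adm : forall n, 0 < N `^ (2 / 3) < c n * Nstar `^ (2 / 3))
    (c_oo : c n @[n --> \oo] --> +oo) :
  exists (phi : nat -> nat) (rho_oo : R3 R -> R),
    [/\ {homo phi : i j / (i < j)%N},
        minimizer_infty kappa q m N rho_oo,
        cvg_Lp 1 (fun k => rho (c (phi k))) rho_oo
      & cvg_Lp (5 / 3) (fun k => rho (c (phi k))) rho_oo].
Proof.
have q0 : 0 < q by exact: lt_le_trans ltr01 q_ge1.
have [Nstar0 ineq _] := Nstar_opt.
have [H H0 HLS] := hls_of_coulomb_inequality kappa_gt0 q0 Nstar0 ineq.
have [c1 [F [K [d [_ F0 _ d0 bounds]]]]] :=
  minimizer_bounds kappa_gt0 q0 m_gt0 N_gt0 H0 HLS.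
have [n0 _ cn0] : \forall n \near \oo, c1 <= c n.
  by have /cvgryPge := c_oo; exact.
(* The bounds hold from c1 on; the sequence is shifted by n0 accordingly. *)
have minc n : minimizer_c kappa q m (c n) N (rho (c n)).
  exact: (rho_min _ (c_gt0 n) (c_adm n)).1.
have symc n : symmetric_decreasing (rho (c n)).
  exact: (rho_min _ (c_gt0 n) (c_adm n)).2.
have denc n : density (rho (c n)) by have [] := minimizer_cP (minc n).
have decay n x : 0 < norm3 x -> rho (c n) x * norm3 x ^+ 3 <= 64 * N.
  move=> x0; rewrite -{1}(@powRr1 _ (rho (c n) x)); last exact: (denc n).2.
  apply: (symmetric_decreasing_decay ltr01 (denc n) (symc n) _ x0).
  by rewrite (mass_powR1 (denc n)); have [_ -> _ _] := minimizer_cP (minc n).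
have [psi [v [psi_inc dv vdecay vlim]]] :=
  @helly_radial _ (fun n => rho (c (n0 + n)%N)) (64 * N)
    (fun n => denc (n0 + n)%N) (fun n => symc (n0 + n)%N) (fun n => decay (n0 + n)%N).
pose phi k := (n0 + psi k)%N.
have phi_inc : {homo phi : i j / (i < j)%N}.
  by move=> i j ij; rewrite /phi ltn_add2l; exact: psi_inc.
have phi_ge k : (k <= phi k)%N.
  elim: k => [//|k IH]; exact: leq_ltn_trans IH (phi_inc _ _ (ltnSn k)).
have bnd k := bounds _ _ (cn0 (phi k) (leq_addr _ _)) (minc (phi k)) (symc (phi k)).
have coo : c (phi k) @[k --> \oo] --> +oo.
  apply: (@cvg_comp _ _ _ phi c _ \oo _ _ c_oo).
  by apply/cvgnyPge => A; near=> k; apply: leq_trans (phi_ge k); near: k; exact: nbhs_infty_ge.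
have [minv cv1 cv53] := @limit_of_minimizers R kappa q m N H F K d (c \o phi)
  (fun k => rho (c (phi k))) v kappa_gt0 q0 m_gt0 N_gt0 HLS F0 d0 (fun k => c_gt0 (phi k)) coo
  (fun k => minc (phi k)) (fun k => symc (phi k))
  (fun k => let: And3 h _ _ := bnd k in h) (fun k => let: And3 _ h _ := bnd k in h)
  (fun k => let: And3 _ _ h := bnd k in h) dv vdecay vlim.
by exists phi, v; split.
Unshelve. all: by end_near.
Qed.
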